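(* There are no closed saddle connections on the translation covers of the compact quotients of Mucube, Muoctahedron, Mutetrahedron, Octa-4, Octa-8, or Truncated Octa-8 (as specified in the context).
   Context: A saddle connection on a translation surface $(X,\omega)$ is a geodesic segment connecting two singular points (zeros of $\omega$, i.e. cone points of angle $2\pi(m+1)$ with $m\ge1$) with no singular points in its interior; it is closed if it connects a singular point to itself. Square-tiled surfaces. A pair $(\sigma_h,\sigma_v)$ of permutations of $\{1,\dots,N\}$ generating a transitive group defines a translation surface from $N$ unit squares: the right side of square $i$ is glued by translation to the left side of square $\sigma_h(i)$, and the top of square $i$ is glued to the bottom of square $\sigma_v(i)$. Only vertices with cone angle greater than $2\pi$ are singular. The surfaces. Mucube $\{4,6\}$, Muoctahedron $\{6,4\}$, Mutetrahedron $\{6,6\}$, Octa-4 $\{3,8\}$, Octa-8 $\{3,12\}$, Truncated Octa-8 $\{4,5\}$ are triply periodic polyhedral surfaces in $\mathbb{R}^3$ tiled by regular $p$-gons, $q$ at each vertex (type $\{p,q\}$); each compact quotient by its period lattice carries a flat metric given by a $k$-differential, and its translation cover is the $k$-fold branched cover on which the rotational holonomy becomes trivial ($k=2,3,2,3,1,4$ respectively). For surfaces tiled by triangles or hexagons (hexagons being subdivided into six triangles), triangles may be paired into rhombi and the linear map $\begin{pmatrix}1&1/2\\0&\sqrt3/2\end{pmatrix}^{-1}$ applied to obtain a square-tiled surface. Octa-8: let $O\subset\mathbb{R}^3$ be the regular octahedron with vertices $\pm e_1,\pm e_2,\pm e_3$, let $\Lambda$ be the lattice generated by $\tfrac43(\pm1,\pm1,\pm1)$,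 and for each face $F$ of $O$ let $O_F$ be the reflection of $O$ in the plane of $F$. Octa-8 is the boundary $\Pi$ of $\bigcup_{\lambda\in\Lambda}(\lambda+(O\cup\bigcup_FO_F))$. Its compact quotient $\Pi/\Lambda$ (genus four, 24 equilateral triangles, 12 at each of the 6 vertices), with its intrinsic flat metric, is already a translation surface with six simple zeros at the vertices, and is its own translation cover. The translation covers of the other five are the square-tiled surfaces given by the following permutations. Mucube (24 squares): $\sigma_h=(1,2,3,4)(5,6,7,8)(9,10,11,12)(13,14,15,16)(17,18,19,20)(21,22,23,24)$, $\sigma_v=(1,9,14,22)(2,20,13,7)(3,24,16,11)(4,5,15,18)(6,10,17,21)(8,23,19,12)$. Muoctahedron (72 squares): $\sigma_h=(1,2,3,4,5,6,7,8,9)(10,11,12,13,14,15,16,17,18)(19,20,21,22,23,24,25,26,27)(28,29,30,31,32,33,34,35,36)(37,38,39,40,41,42,43,44,45)(46,47,48,49,50,51,52,53,54)(55,56,57,58,59,60,61,62,63)(64,65,66,67,68,69,70,71,72)$, $\sigma_v=(1,10,3,37,54,39,36,20,29)(2,11,19,28,21,53,38,46,18)(4,16,6,33,23,35,58,70,60)(5,17,69,59,71,22,34,24,15)(7,13,9,55,64,57,40,51,42)(8,14,50,41,52,72,56,65,12)(25,31,27,66,62,68,47,44,49)(26,32,43,48,45,61,67,63,30)$. Mutetrahedron (24 squares): $\sigma_h=(1,2,3,4,5,6)(7,8,9,10,11,12)(13,14,15,16,17,18)(19,20,21,22,23,24)$, $\sigma_v=(1,7,13,11,3,21)(2,20,14,12,18,22)(4,10,16,8,6,24)(5,23,17,9,15,19)$.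 Octa-4 (48 squares): $\sigma_h=(1,2,3)(4,5,6)(7,8,9)(10,11,12)(13,14,15)(16,17,18)(19,20,21)(22,23,24)(25,26,27)(28,29,30)(31,32,33)(34,35,36)(37,38,39)(40,41,42)(43,44,45)(46,47,48)$, $\sigma_v=(1,6,35)(2,32,41)(3,48,7)(4,9,10)(5,38,20)(8,17,26)(11,25,30)(12,43,39)(13,18,47)(14,44,29)(15,36,19)(16,21,22)(23,37,42)(24,31,27)(28,33,34)(40,45,46)$. Truncated Octa-8 (120 squares): $\sigma_h$ is the product of the twenty 6-cycles $(6j+1,6j+2,6j+3,6j+4,6j+5,6j+6)$, $0\le j\le 19$, and $\sigma_v=(1,34,75,81,120,7)(2,20,111,80,62,25)(3,40,67,79,107,15)(4,10,117,84,78,31)(5,28,65,83,114,23)(6,18,104,82,70,37)(8,52,71,74,96,17)(9,24,86,73,64,43)(11,14,93,77,68,49)(12,46,61,76,89,21)(13,22,99,69,66,55)(16,58,63,72,102,19)(26,45,115,110,90,33)(27,38,98,109,103,56)(29,36,87,113,118,48)(30,59,106,112,101,41)(32,92,108,116,50,39)(35,42,53,119,105,95)(44,57,91,85,97,51)(47,54,100,88,94,60)$. *)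

(* Defs.v *)
From Stdlib Require Import Relation_Operators.
From HB Require Import structures.
From mathcomp Require Import all_boot all_order all_algebra all_fingroup.
From mathcomp Require Import generic_quotient.
From mathcomp Require Import all_classical all_reals all_analysis.

Set Implicit Arguments.
Unset Strict Implicit.
Unset Printing Implicit Defensive.

Import Order.TTheory GRing.Theory Num.Theory.
Import numFieldNormedType.Exports.

Local Open Scope classical_set_scope.
Local Open Scope quotient_scope.
Local Open Scope ring_scope.

(* A closed flat surface enters only through its intrinsic metric and its
   singular points.  The metric is generated by straight segments:
   [segment x y l] means that x and y are joined by a straight segment of
   length l contained in the surface. *)
Record flat_surface (R : realType) := FlatSurface {
  point :> Type;
  segment : point -> point -> R -> Prop;
  singular : set point
}.

Inductive broken_line (R : realType) (X : flat_surface R) (x : X) :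
    X -> R -> Prop :=
| BrokenLineNil : broken_line x x 0
| BrokenLineStep y z l m :
    broken_line x y l -> segment y z m -> broken_line x z (l + m).

Definition intrinsic_dist (R : realType) (X : flat_surface R) (x y : X) :
    \bar R :=
  ereal_inf [set l%:E | l in broken_line x y].

(* Unit-speed paths on [0, L] that are locally distance-realizing. *)
Definition geodesic (R : realType) (X : flat_surface R) (L : R) (g : R -> X) :=
  forall t, 0 <= t <= L -> exists2 e : R, 0 < e &
    forall s s', 0 <= s <= L -> 0 <= s' <= L ->
      `|s - t| < e -> `|s' - t| < e ->
      intrinsic_dist (g s) (g s') = `|s - s'|%:E.

Definition saddle_connection (R : realType) (X : flat_surface R) (L : R)
    (g : R -> X) :=
  [/\ 0 < L, geodesic L g, singular (g 0), singular (g L) &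
      forall t, 0 < t < L -> ~ singular (g t)].

Definition closed_saddle_connection (R : realType) (X : flat_surface R) (L : R)
    (g : R -> X) :=
  saddle_connection L g /\ g 0 = g L.

Section SquareTiled.
Variables (R : realType) (N : nat) (sh sv : {perm 'I_N}).

Definition unit_square : set (R * R) :=
  [set p | 0 <= p.1 <= 1 /\ 0 <= p.2 <= 1].

(* (i, p) is the point p of the i-th square. *)
Definition square_point : choiceType := ('I_N * set_type unit_square)%type.

Inductive side_glued : square_point -> square_point -> Prop :=
| GlueRightLeft i (p q : set_type unit_square) :
    (val p).1 = 1 -> (val q).1 = 0 -> (val p).2 = (val q).2 ->
    side_glued (i, p) (sh i, q)
| GlueTopBottom i (p q : set_type unit_square) :
    (val p).2 = 1 -> (val q).2 = 0 -> (val p).1 = (val q).1 ->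
    side_glued (i, p) (sv i, q).

Definition glued : rel square_point :=
  fun x y => `[< clos_refl_sym_trans square_point side_glued x y >].

Lemma glued_refl : reflexive glued.
Proof. by move=> x; apply/asboolP; exact: rst_refl. Qed.

Lemma glued_sym : symmetric glued.
Proof.
by move=> x y; apply/asboolP/asboolP => h; exact: rst_sym.
Qed.

Lemma glued_trans : transitive glued.
Proof.
by move=> y x z /asboolP xy /asboolP yz; apply/asboolP; exact: rst_trans xy yz.
Qed.

Canonical glued_equiv : equiv_rel square_point :=
  EquivRel glued glued_refl glued_sym glued_trans.

Definition square_quotient := {eq_quot glued_equiv}.

Definition square_segment (x y : square_quotient) (l : R) : Prop :=
  exists i (p q : set_type unit_square),
    [/\ x = \pi_square_quotient (i, p), y = \pi_square_quotient (i, q) &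
        l = Num.sqrt (((val p).1 - (val q).1) ^+ 2 +
                      ((val p).2 - (val q).2) ^+ 2)].

Lemma corner_in_square (b : bool * bool) :
  ((b.1%:R, b.2%:R) : R * R) \in unit_square.
Proof.
by apply/mem_set; rewrite /unit_square; case: b => [[] []] /=;
  rewrite !lexx !ler01.
Qed.

Definition corner_point (b : bool * bool) : set_type unit_square :=
  exist (fun p : R * R => p \in unit_square) _ (corner_in_square b).

Definition corner (c : 'I_N * (bool * bool)) : square_quotient :=
  \pi_square_quotient (c.1, corner_point c.2).

(* Each of the square corners identified to the vertex x contributes pi / 2.
   (The value is 0, hence irrelevant below, when x is not a vertex.) *)
Definition vertex_cone_angle (x : square_quotient) : R :=
  #|[pred c | corner c == x]|%:R * (pi / 2).

Definition square_tiled_surface : flat_surface R :=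
  FlatSurface square_segment [set x | 2 * pi < vertex_cone_angle x].

End SquareTiled.

Definition cycle_perm (T : finType) (c : seq T) : {perm T} :=
  perm (can_inj (prev_next (undup_uniq c))).

(* The squares are numbered from 1 in the cycles, and from 0 in 'I_n.+1. *)
Definition perm_of_cycles (n : nat) (cs : seq (seq nat)) : {perm 'I_n.+1} :=
  (\prod_(c <- cs) cycle_perm [seq inord k.-1 : 'I_n.+1 | k <- c])%g.

(* (1, ..., k)(k + 1, ..., 2k)... with m cycles *)
Definition consecutive_cycles (m k : nat) : seq (seq nat) :=
  [seq iota (k * j).+1 k | j <- iota 0 m].

Definition mucube_v : seq (seq nat) :=
  [:: [:: 1; 9; 14; 22];
      [:: 2; 20; 13; 7];
      [:: 3; 24; 16; 11];
      [:: 4; 5; 15; 18];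
      [:: 6; 10; 17; 21];
      [:: 8; 23; 19; 12]].

Definition muoctahedron_v : seq (seq nat) :=
  [:: [:: 1; 10; 3; 37; 54; 39; 36; 20; 29];
      [:: 2; 11; 19; 28; 21; 53; 38; 46; 18];
      [:: 4; 16; 6; 33; 23; 35; 58; 70; 60];
      [:: 5; 17; 69; 59; 71; 22; 34; 24; 15];
      [:: 7; 13; 9; 55; 64; 57; 40; 51; 42];
      [:: 8; 14; 50; 41; 52; 72; 56; 65; 12];
      [:: 25; 31; 27; 66; 62; 68; 47; 44; 49];
      [:: 26; 32; 43; 48; 45; 61; 67; 63; 30]].

Definition mutetrahedron_v : seq (seq nat) :=
  [:: [:: 1; 7; 13; 11; 3; 21];
      [:: 2; 20; 14; 12; 18; 22];
      [:: 4; 10; 16; 8; 6; 24];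
      [:: 5; 23; 17; 9; 15; 19]].

Definition octa4_v : seq (seq nat) :=
  [:: [:: 1; 6; 35];
      [:: 2; 32; 41];
      [:: 3; 48; 7];
      [:: 4; 9; 10];
      [:: 5; 38; 20];
      [:: 8; 17; 26];
      [:: 11; 25; 30];
      [:: 12; 43; 39];
      [:: 13; 18; 47];
      [:: 14; 44; 29];
      [:: 15; 36; 19];
      [:: 16; 21; 22];
      [:: 23; 37; 42];
      [:: 24; 31; 27];
      [:: 28; 33; 34];
      [:: 40; 45; 46]].

Definition truncated_octa8_v : seq (seq nat) :=
  [:: [:: 1; 34; 75; 81; 120; 7];
      [:: 2; 20; 111; 80; 62; 25];
      [:: 3; 40; 67; 79; 107; 15];
      [:: 4; 10; 117; 84; 78; 31];
      [:: 5; 28; 65; 83; 114; 23];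
      [:: 6; 18; 104; 82; 70; 37];
      [:: 8; 52; 71; 74; 96; 17];
      [:: 9; 24; 86; 73; 64; 43];
      [:: 11; 14; 93; 77; 68; 49];
      [:: 12; 46; 61; 76; 89; 21];
      [:: 13; 22; 99; 69; 66; 55];
      [:: 16; 58; 63; 72; 102; 19];
      [:: 26; 45; 115; 110; 90; 33];
      [:: 27; 38; 98; 109; 103; 56];
      [:: 29; 36; 87; 113; 118; 48];
      [:: 30; 59; 106; 112; 101; 41];
      [:: 32; 92; 108; 116; 50; 39];
      [:: 35; 42; 53; 119; 105; 95];
      [:: 44; 57; 91; 85; 97; 51];
      [:: 47; 54; 100; 88; 94; 60]].

Definition mucube (R : realType) : flat_surface R :=
  square_tiled_surface R (perm_of_cycles 23 (consecutive_cycles 6 4))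
    (perm_of_cycles 23 mucube_v).

Definition muoctahedron (R : realType) : flat_surface R :=
  square_tiled_surface R (perm_of_cycles 71 (consecutive_cycles 8 9))
    (perm_of_cycles 71 muoctahedron_v).

Definition mutetrahedron (R : realType) : flat_surface R :=
  square_tiled_surface R (perm_of_cycles 23 (consecutive_cycles 4 6))
    (perm_of_cycles 23 mutetrahedron_v).

Definition octa4 (R : realType) : flat_surface R :=
  square_tiled_surface R (perm_of_cycles 47 (consecutive_cycles 16 3))
    (perm_of_cycles 47 octa4_v).

Definition truncated_octa8 (R : realType) : flat_surface R :=
  square_tiled_surface R (perm_of_cycles 119 (consecutive_cycles 20 6))
    (perm_of_cycles 119 truncated_octa8_v).

Section Octa8.
Variable R : realType.
Local Notation space := 'rV[R]_3.

(* (i, b) |-> (-1)^b e_i *)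
Definition octahedron_vertex (k : 'I_3 * bool) : space :=
  (-1) ^+ k.2 *: delta_mx 0 k.1.

(* the convex hull of the vertices *)
Definition octahedron : set space :=
  [set x | exists w : 'I_3 * bool -> R,
     [/\ forall k, 0 <= w k, \sum_k w k = 1 &
         x = \sum_k w k *: octahedron_vertex k]].

(* A face of the octahedron is given by the sign vector s for which it lies in
   the plane <s, x> = 1. *)
Definition sign_vector (s : {ffun 'I_3 -> bool}) : space :=
  \row_i (-1) ^+ s i.

Definition dot (x y : space) : R := \sum_i x 0 i * y 0 i.

Definition face_reflection (s : {ffun 'I_3 -> bool}) (x : space) : space :=
  let n := sign_vector s in x - (2 * (dot n x - 1) / dot n n) *: n.

Definition lattice : set space :=
  [set v | exists c : {ffun 'I_3 -> bool} -> int,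
     v = \sum_s (c s)%:~R *: ((4 / 3) *: sign_vector s)].

(* The isometries carrying the octahedron to the octahedra of the union. *)
Definition placement : set (space -> space) :=
  [set f | exists2 v, lattice v &
     f = (fun x => v + x) \/ exists s, f = (fun x => v + face_reflection s x)].

Definition octa8_solid : set space :=
  \bigcup_(f in placement) (f @` octahedron).

Definition octa8_boundary : set space :=
  closure octa8_solid `\` interior octa8_solid.

Definition octa8_vertices : set space :=
  \bigcup_(f in placement) (f @` range octahedron_vertex).

Definition octa8_point : choiceType := set_type octa8_boundary.

Definition lattice_equivalent : rel octa8_point :=
  fun x y => `[< lattice (val y - val x) >].

Lemma lattice_equivalent_refl : reflexive lattice_equivalent.
Proof.
move=> x; apply/asboolP; exists (fun=> 0); rewrite subrr big1 // => s _.
by rewrite scale0r.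
Qed.

Lemma lattice_equivalent_sym : symmetric lattice_equivalent.
Proof.
suff h x y : lattice_equivalent x y -> lattice_equivalent y x.
  by move=> x y; apply/idP/idP; exact: h.
move=> /asboolP[c cE]; apply/asboolP; exists (fun s => - c s).
rewrite -opprB cE -sumrN; apply: eq_bigr => s _.
by rewrite mulrNz scaleNr.
Qed.

Lemma lattice_equivalent_trans : transitive lattice_equivalent.
Proof.
move=> y x z /asboolP[c cE] /asboolP[d dE]; apply/asboolP.
exists (fun s => d s + c s).
have -> : val z - val x = (val z - val y) + (val y - val x).
  by rewrite addrA subrK.
rewrite cE dE -big_split; apply: eq_bigr => s _ /=.
by rewrite intrD scalerDl.
Qed.

Canonical lattice_equivalent_equiv : equiv_rel octa8_point :=
  EquivRel lattice_equivalent lattice_equivalent_refl lattice_equivalent_sym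
    lattice_equivalent_trans.

Definition octa8_quotient := {eq_quot lattice_equivalent_equiv}.

Definition octa8_segment (x y : octa8_quotient) (l : R) : Prop :=
  exists p q : octa8_point,
    [/\ x = \pi_octa8_quotient p, y = \pi_octa8_quotient q,
        forall t : R, 0 <= t <= 1 ->
          octa8_boundary ((1 - t) *: val p + t *: val q) &
        l = Num.sqrt (dot (val p - val q) (val p - val q))].

(* All vertices are singular: twelve equilateral triangles meet at each. *)
Definition octa8 : flat_surface R :=
  FlatSurface octa8_segment
    [set x | exists2 p : octa8_point,
       x = \pi_octa8_quotient p & octa8_vertices (val p)].

End Octa8.

(* Main.v *)
From Stdlib Require Import Relation_Operators PArith FMapPositive.
Require Import Defs.
From mathcomp Require Import all_boot all_order all_algebra all_fingroup.
From mathcomp Require Import generic_quotient.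
From mathcomp Require Import all_classical all_reals all_analysis.
From mathcomp Require Import ring lra zify.

(** A closed saddle connection is excluded in three steps.

    Geometry. Near a point that is not singular the surface is isometric to a
    disc of the plane, so a geodesic goes straight there: a path with an angle
    could be shortened by cutting the corner ([regular_shortcut]). Its direction
    is therefore constant in the coordinates of the squares, and since all the
    squares project to one torus, a geodesic that returns to its starting point
    has a displacement with integer coordinates ([closed_geodesic_straight]).

    Euclid's algorithm. After symmetries of the square the displacement is
    [(m, n)] with [m] and [n] nonnegative. A surface tiled by squares is also
    tiled by parallelograms: cutting each parallelogram along a diagonal and
    gluing the halves differently replaces the basis [(e, f)] of the lattice by
    [(e, e + f)], and the permutations [(a, b)] that describe how cells follow
    each other to the right and upwards by [(a, b after a)]. As in Euclid's
    algorithm, finitely many such shears lead to parallelograms whose lower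
    side is parallel to the path ([family_along]). The path then runs along
    lower sides, through cells [i], [a i], ..., and closes up at the [k]-th one
    ([path_closed_orbit]). Two cells have the same lower left vertex exactly
    when they are in the same orbit of the commutator of [a] and [b], which
    shears do not change. So a closed saddle connection produces, in the orbit
    of the initial pair under the moves of [reach], a pair with a
    [closed_orbit].

    Finiteness. Up to relabeling the squares these orbits have 9, 16, 4, 4, 4
    and 15 elements for Mucube, Muoctahedron, Mutetrahedron, Octa-4, Octa-8 and
    Truncated Octa-8. They are enumerated, together with the relabelings that
    show that they are closed under the moves, and no element has a closed
    orbit ([cycles_no_closed]).

    Octa-8 is not given by squares, and its metric has to be computed from its
    embedding. The reflections in the planes [x_i = 4 m / 3], [m] an integer,
    preserve the solid, hence everything is determined by what happens in
    the cube [0, 4/3]^3. There, in suitable affine coordinates, the solid is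
    given by the six inequalities of the cube [0, 1]^3, and its boundary is
    the set of points where one of them is an equality ([octa8_boundaryE]).
    The six faces form a band around the diagonal of the cube, in which
    consecutive triangles are paired to three rhombi. Modulo the lattice
    there are four cubes, hence twelve rhombi, glued like the squares of a
    square-tiled surface ([octa8_tiling]).
    The previous argument applies with the quadratic form of an equilateral
    triangle in place of the Euclidean one. *)

Set Implicit Arguments.
Unset Strict Implicit.
Unset Printing Implicit Defensive.

Import Order.TTheory GRing.Theory Num.Theory.

(** * Pairs of permutations *)

Section Permutations.
Local Open Scope group_scope.
Variable N : nat.
Implicit Types a b c d : {perm 'I_N}.

(** Going once around the lower left corner of a square. *)
Definition turn a b : {perm 'I_N} := [~ a, b].

Lemma turnE a b i : turn a b (a (b i)) = b (a i).
Proof. by rewrite /turn commgEl !permM /= !permK. Qed.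

Lemma turn_shear a b : turn a (a * b) = turn a b.
Proof. by rewrite /turn !commgEl conjgM [a ^ a]conjgE mulKg. Qed.

Lemma turn_swap a b : turn b a = (turn a b)^-1.
Proof. by rewrite /turn invg_comm. Qed.

(** The pairs obtained by changing the basis of the lattice of the squares:
    the three moves generate the action of GL(2, Z). *)
Inductive reach a b : {perm 'I_N} -> {perm 'I_N} -> Prop :=
| ReachRefl : reach a b a b
| ReachSwap c d : reach a b c d -> reach a b d c
| ReachFlip c d : reach a b c d -> reach a b c^-1 d
| ReachShear c d : reach a b c d -> reach a b c (c * d).

Lemma reach_trans a b c d c' d' :
  reach a b c d -> reach c d c' d' -> reach a b c' d'.
Proof.
move=> r; elim=> // *; [exact: ReachSwap|exact: ReachFlip|exact: ReachShear].
Qed.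

(** The combinatorial form of a closed saddle connection: it runs along the
    lower sides of the squares [i], [a i], ... up to the [k]-th one. Its
    endpoints are the same singular vertex, and the vertices in between have
    angle 2 pi, that is, they are fixed by [turn]. *)
Definition closed_orbit a b i k :=
  [/\ (0 < k)%N, turn a b i <> i,
      forall l, (0 < l < k)%N -> turn a b ((a ^+ l) i) = (a ^+ l) i &
      (a ^+ k) i \in porbit (turn a b) i].

End Permutations.

(** * Finiteness of the modular orbits *)

Definition table := PositiveMap.t positive.
Definition look (m : table) (p : positive) : positive :=
  if PositiveMap.find p m is Some q then q else p.
Definition tabulate (f g : positive -> positive) (s : seq positive) : table :=
  foldr (fun p m => PositiveMap.add (f p) (g p) m) (PositiveMap.empty positive) s.

Definition square_codes (n : nat) : seq positive := [seq Pos.of_succ_nat k | k <- iota 0 n].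

Inductive modular_move := Swap | Flip | Shear.

(** Squares are numbered by binary integers, and permutations are stored as
    binary tries, so that the certificates can be checked by computation.
    Soundness only uses the values found in the tables, never how they were
    built. *)
Section Certificate.
Variables (n : nat) (period : nat).
Let dom := square_codes n.

Definition invert (f : table) := tabulate (look f) id dom.

Definition apply_move (mv : modular_move) (r : table * table) : table * table :=
  let (f, g) := r in
  match mv with
  | Swap => (g, f)
  | Flip => (invert f, g)
  | Shear => (f, tabulate id (fun p => look g (look f p)) dom)
  end.

(** An isomorphism between two pairs of permutations is determined by the image
    of one square, since the generated group is transitive. *)
Fixpoint spread (r r' : table * table) (fuel : nat) (todo : seq positive) (t : table)
    : table :=
  match fuel, todo with
  | k.+1, p :: todo =>
    let visit (f f' : table) (x : seq positive * table) :=
      let q := look f p in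
      if PositiveMap.mem q x.2 then x
      else (q :: x.1, PositiveMap.add q (look f' (look t p)) x.2) in
    let x := visit r.2 r'.2 (visit r.1 r'.1 (todo, t)) in
    spread r r' k x.1 x.2
  | _, _ => t
  end.

Definition relabeling (r r' : table * table) (q : positive) : table :=
  spread r r' n [:: 1%positive]
    (PositiveMap.add 1%positive q (PositiveMap.empty positive)).

Definition check_relabeling (mv : modular_move) (r r' : table * table) (t : table) :=
  let t' := tabulate (look t) id dom in
  all (fun p => [&& Pos.eqb (look t' (look t p)) p, has (Pos.eqb (look t p)) dom &
    match mv with
    | Swap => Pos.eqb (look r'.1 (look t p)) (look t (look r.2 p)) &&
              Pos.eqb (look r'.2 (look t p)) (look t (look r.1 p))
    | Flip => Pos.eqb (look r'.1 (look t (look r.1 p))) (look t p) &&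
              Pos.eqb (look r'.2 (look t p)) (look t (look r.2 p))
    | Shear => Pos.eqb (look r'.1 (look t p)) (look t (look r.1 p)) &&
              Pos.eqb (look r'.2 (look t p)) (look t (look r.2 (look r.1 p)))
    end]) dom.

(** All orbits of the commutator have a length dividing [period], so it is
    enough to iterate [period] times. *)
Fixpoint not_in_orbit (c : table) (l : nat) (p q : positive) :=
  if l is l.+1 then ~~ Pos.eqb p q && not_in_orbit c l (look c p) q else true.

Fixpoint walk (f c : table) (fuel : nat) (p q : positive) :=
  if fuel is k.+1 then
    let q := look f q in
    if Pos.eqb (look c q) q then walk f c k p q else not_in_orbit c period p q
  else false.

Definition check_no_closed (r : table * table) :=
  let c := tabulate (fun p => look r.1 (look r.2 p)) (fun p => look r.2 (look r.1 p)) dom in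
  all (fun p => [&& Pos.eqb (look c (look r.1 (look r.2 p))) (look r.2 (look r.1 p)),
     Pos.eqb (iter period (look c) p) p &
     Pos.eqb (look c p) p || walk r.1 c n p p]) dom.

(** Each representative is obtained by a move from an earlier one, given by its
    index. *)
Definition orbit_reps (r0 : table * table) (parents : seq (nat * modular_move)) :=
  foldl (fun rs x => rcons rs (apply_move x.2 (nth r0 rs x.1))) [:: r0] parents.

(** For each of the three moves: the representative to which the result is
    isomorphic, and the square that corresponds to the first one. *)
Definition hint := ((nat * nat) * (nat * nat) * (nat * nat))%type.

Definition hint_for (mv : modular_move) (h : hint) : nat * nat :=
  match mv with Swap => h.1.1 | Flip => h.1.2 | Shear => h.2 end.

Definition certified (r0 : table * table) (parents : seq (nat * modular_move))
    (hints : seq hint) :=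
  let rs := orbit_reps r0 parents in
  (size hints == size rs) &&
  all (fun x : (table * table) * hint => check_no_closed x.1 &&
      all (fun mv => let h := hint_for mv x.2 in (h.1 < size rs) &&
        let r' := nth r0 rs h.1 in
        check_relabeling mv x.1 r' (relabeling (apply_move mv x.1) r' (Pos.of_nat h.2)))
      [:: Swap; Flip; Shear])
    (zip rs hints).

Section Soundness.
Variables (N : nat).
Hypothesis period0 : (0 < period)%N.
Implicit Types (a b : {perm 'I_N}).

(** The numbering [s] of the squares is arbitrary, which is what makes the
    enumeration up to relabeling enough. *)
Definition represents a b (r : table * table) (s : 'I_N -> positive) :=
  [/\ injective s, forall i, has (Pos.eqb (s i)) dom,
      forall i, look r.1 (s i) = s (a i) & forall i, look r.2 (s i) = s (b i)].

Lemma all_has (P : pred positive) p l : all P l -> has (Pos.eqb p) l -> P p.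
Proof.
elim: l => //= q l IH /andP[Pq /IH{}IH] /orP[/Pos.eqb_eq -> //|]; exact: IH.
Qed.

Lemma not_in_orbitP c l p q : not_in_orbit c l p q ->
  forall k, (k < l)%N -> iter k (look c) p <> q.
Proof.
elim: l p => // l IH p /= /andP[pq /IH{}IH] [_|k kl]; last by rewrite iterSr; exact: IH.
by move=> /= e; move: pq; rewrite e Pos.eqb_refl.
Qed.

Lemma iter_mod (T : Type) (f : T -> T) (x : T) l : iter period f x = x ->
  iter l f x = iter (l %% period) f x.
Proof.
move=> e; rewrite {1}(divn_eq l period) addnC iterD; congr iter.
by elim: (l %/ period)%N => [//|k IH]; rewrite mulSn iterD IH.
Qed.

(** [walk] follows the lower sides until it meets a vertex that is not fixed by
    the commutator; this is where a closed orbit would have to end. *)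
Lemma represented_no_closed a b r s : represents a b r s -> check_no_closed r ->
  forall i d, ~ closed_orbit a b i d.
Proof.
move=> [inj sdom fa gb]; rewrite /check_no_closed.
set c := tabulate _ _ _ => chk i d [d0 ti fix_ porb].
have chkp x := all_has chk (sdom x).
have cs x : look c (s x) = s (turn a b x).
  pose y := (b^-1 (a^-1 x))%g; have -> : x = a (b y) by rewrite /y !permKV.
  rewrite turnE; have /and3P[/Pos.eqb_eq e _ _] := chkp y.
  by rewrite -fa -gb e fa gb.
have ics l x : iter l (look c) (s x) = s ((turn a b ^+ l)%g x).
  elim: l => [|l IH]; first by rewrite expg0 perm1.
  by rewrite iterS IH cs expgSr [in RHS]permM.
have ias l x : iter l (look r.1) (s x) = s ((a ^+ l)%g x).
  elim: l => [|l IH]; first by rewrite expg0 perm1.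
  by rewrite iterS IH fa expgSr permM.
have /and3P[_ /Pos.eqb_eq per w] := chkp i.
have {}w : walk r.1 c n (s i) (s i).
  by case/orP: w => // /Pos.eqb_eq; rewrite cs => /inj.
suff main fuel j : (j < d)%N -> walk r.1 c fuel (s i) (s ((a ^+ j)%g i)) -> False.
  by apply: (main n 0%N) => //; rewrite expg0 perm1.
elim: fuel j => // fuel IH j jd /=; rewrite fa cs.
have -> : a ((a ^+ j)%g i) = (a ^+ j.+1)%g i by rewrite expgSr permM.
have [jd1|] := ltnP j.+1 d.
  by rewrite fix_ ?jd1 // Pos.eqb_refl => /(IH _ jd1).
move=> dj; have {dj jd} ed : j.+1 = d by apply/eqP; rewrite eqn_leq jd dj.
rewrite ed; case/porbitP: porb => l el.
case: Pos.eqb_spec => [/inj fixd|_].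
  case: ti; rewrite el in fixd; move: fixd.
  have comm : (turn a b * turn a b ^+ l = turn a b ^+ l * turn a b)%g.
    by rewrite -expgS -expgSr.
  by rewrite -permM -comm permM => /perm_inj.
move=> /not_in_orbitP no; apply: (no (l %% period)%N); first by rewrite ltn_mod.
rewrite -(iter_mod _ per) ics el.
by [].
Qed.

Lemma represented_move a b r r' t mv s : represents a b r s ->
  check_relabeling mv r r' t ->
  let ab := match mv with
    | Swap => (b, a) | Flip => (a^-1, b)%g | Shear => (a, a * b)%g end in
  represents ab.1 ab.2 r' (look t \o s).
Proof.
move=> [inj sdom fa gb] chk; have {}chk x := all_has chk (sdom x).
have injt : injective (look t \o s).
  move=> x y /= e; apply: inj.
  have /and3P[/Pos.eqb_eq ex _ _] := chk x; have /and3P[/Pos.eqb_eq ey _ _] := chk y.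
  by rewrite -ex -ey e.
case: mv chk => chk; (split=> //= x; first by have /and3P[] := chk x).
- by have /and3P[_ _ /andP[/Pos.eqb_eq -> _]] := chk x; rewrite gb.
- by have /and3P[_ _ /andP[_ /Pos.eqb_eq ->]] := chk x; rewrite fa.
- have /and3P[_ _ /andP[/Pos.eqb_eq + _]] := chk (a^-1 x)%g.
  by rewrite fa permKV => ->.
- by have /and3P[_ _ /andP[_ /Pos.eqb_eq ->]] := chk x; rewrite gb.
- by have /and3P[_ _ /andP[/Pos.eqb_eq -> _]] := chk x; rewrite fa.
- by have /and3P[_ _ /andP[_ /Pos.eqb_eq ->]] := chk x; rewrite fa gb permM.
Qed.

Lemma certified_no_closed a b r0 parents hints s : represents a b r0 s ->
  certified r0 parents hints ->
  forall c d, reach a b c d -> forall i k, ~ closed_orbit c d i k.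
Proof.
move=> rep0; rewrite /certified; set rs := orbit_reps _ _.
move=> /andP[/eqP sz /all_nthP chk].
have rs0 : (0 < size rs)%N /\ nth r0 rs 0 = r0.
  rewrite /rs /orbit_reps -[parents]revK foldl_rev.
  elim: (rev parents) => //= x l [h1 h2]; split; first by rewrite size_rcons.
  by rewrite nth_rcons h1.
pose h0 : hint := ((0, 0), (0, 0), (0, 0))%N.
have {}chk k : (k < size rs)%N -> let x := (nth r0 rs k, nth h0 hints k) in
    check_no_closed x.1 /\ all (fun mv => let h := hint_for mv x.2 in
      (h.1 < size rs)%N && let r' := nth r0 rs h.1 in
      check_relabeling mv x.1 r' (relabeling (apply_move mv x.1) r' (Pos.of_nat h.2)))
      [:: Swap; Flip; Shear].
  move=> kr; have := chk (r0, h0) k; rewrite size_zip sz minnn => /(_ kr).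
  by rewrite nth_zip // => /andP.
have step mv k s' c d : (k < size rs)%N -> represents c d (nth r0 rs k) s' ->
    exists k' s'', (k' < size rs)%N /\ let ab := match mv with
    | Swap => (d, c) | Flip => (c^-1, d)%g | Shear => (c, c * d)%g end in
    represents ab.1 ab.2 (nth r0 rs k') s''.
  move=> kr rep; have [_ /and4P[h1 h2 h3 _]] := chk k kr.
  have [k'r ch'] : let h := hint_for mv (nth h0 hints k) in
      (h.1 < size rs)%N /\ check_relabeling mv (nth r0 rs k) (nth r0 rs h.1)
        (relabeling (apply_move mv (nth r0 rs k)) (nth r0 rs h.1)
          (Pos.of_nat h.2)).
    by apply/andP; case: mv.
  by eexists; eexists; split; [exact: k'r|exact: represented_move rep ch'].
move=> c d r; suff [k [s' [kr rep]]] : exists k s', (k < size rs)%N /\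
    represents c d (nth r0 rs k) s'.
  by have [h _] := chk k kr; exact: represented_no_closed rep h.
elim: r => [|c' d' _ [k [s' [kr rep]]]|c' d' _ [k [s' [kr rep]]]|c' d' _ [k [s' [kr rep]]]].
- by exists 0%N, s; rewrite rs0.2; split=> //; exact: rs0.1.
- exact: (step Swap k s').
- exact: (step Flip k s').
- exact: (step Shear k s').
Qed.

End Soundness.
End Certificate.

Definition cycle_table (cs : seq (seq nat)) : table :=
  foldr (fun c m => foldr (fun x m => PositiveMap.add (Pos.of_nat x)
    (Pos.of_nat (next c x)) m) m c) (PositiveMap.empty positive) cs.

Definition cycles_apply (cs : seq (seq nat)) (k : nat) : nat :=
  foldl (fun k c => next (undup [seq j.-1 | j <- c]) k) k cs.

Lemma perm_of_cyclesE n cs (i : 'I_n.+1) : all (all (fun k => k.-1 < n.+1)%N) cs ->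
  perm_of_cycles n cs i = cycles_apply cs i :> nat.
Proof.
rewrite /perm_of_cycles; elim: cs i => [|c cs IH] i /= => [_|/andP[hc hcs]].
  by rewrite big_nil perm1.
rewrite big_cons permM IH // permE; congr cycles_apply.
rewrite -(next_map val_inj (undup_uniq _)) -(undup_map_inj val_inj) -map_comp.
congr (next (undup _) _); apply/eq_in_map => k kc /=.
by rewrite inordK //; exact: (allP hc).
Qed.

Definition check_cycles n cs := all (all (fun k => k.-1 < n.+1)%N) cs &&
  all (fun k => Pos.eqb (look (cycle_table cs) (Pos.of_succ_nat k))
    (Pos.of_succ_nat (cycles_apply cs k))) (iota 0 n.+1).

Lemma cycle_tableP n cs (i : 'I_n.+1) : check_cycles n cs ->
  look (cycle_table cs) (Pos.of_succ_nat i) =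
  Pos.of_succ_nat (perm_of_cycles n cs i).
Proof.
move=> /andP[ok /allP h]; rewrite perm_of_cyclesE //; apply/Pos.eqb_eq; apply: h.
by rewrite mem_iota ltn_ord.
Qed.

Lemma cycles_no_closed n period ch cv parents hints :
  [&& (0 < period)%N, check_cycles n ch, check_cycles n cv &
    certified n.+1 period (cycle_table ch, cycle_table cv) parents hints] ->
  forall c d, reach (perm_of_cycles n ch) (perm_of_cycles n cv) c d ->
  forall i k, ~ closed_orbit c d i k.
Proof.
move=> /and4P[p0 okh okv cert].
apply: (certified_no_closed p0 (s := fun i : 'I_n.+1 => Pos.of_succ_nat i)) cert.
split=> [i j|i|i|i].
- by move=> /SuccNat2Pos.inj /val_inj.
- rewrite has_map; apply/hasP; exists (val i); last exact: Pos.eqb_refl.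
  by rewrite mem_iota ltn_ord.
- exact: cycle_tableP.
- exact: cycle_tableP.
Qed.
(** The upward gluing of the twelve rhombi of Octa-8, derived below in
    [octa8_glued]. *)
Definition octa8_v : seq (seq nat) :=
  [:: [:: 1; 9; 11]; [:: 2; 10; 6]; [:: 3; 5; 7]; [:: 4; 12; 8]].

Lemma mucube_no_closed_orbit c d :
  reach (perm_of_cycles 23 (consecutive_cycles 6 4)) (perm_of_cycles 23 mucube_v) c d ->
  forall i k, ~ closed_orbit c d i k.
Proof.
apply: (@cycles_no_closed 23 3 (consecutive_cycles 6 4) mucube_v
    [:: (0, Shear); (1, Swap); (1, Flip); (1, Shear); (2, Flip); (2, Shear);
      (4, Swap); (6, Swap)]
    [:: ((0, 1), (0, 1), (1, 1)); ((2, 1), (3, 1), (4, 1)); ((1, 1), (5, 1),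
      (6, 1)); ((5, 1), (1, 1), (0, 1)); ((7, 1), (4, 1), (3, 1)); ((3, 1),
      (2, 1), (2, 1)); ((8, 1), (6, 1), (5, 1)); ((4, 1), (7, 1), (8, 1));
      ((6, 1), (8, 1), (7, 1))]).
by vm_compute.
Qed.

Lemma muoctahedron_no_closed_orbit c d :
  reach (perm_of_cycles 71 (consecutive_cycles 8 9)) (perm_of_cycles 71 muoctahedron_v) c d ->
  forall i k, ~ closed_orbit c d i k.
Proof.
apply: (@cycles_no_closed 71 4 (consecutive_cycles 8 9) muoctahedron_v
    [:: (0, Flip); (1, Shear); (2, Swap); (2, Flip); (2, Shear); (3, Flip);
      (3, Shear); (5, Swap); (5, Flip); (5, Shear); (7, Swap); (8, Flip);
      (10, Flip); (10, Shear); (14, Swap)]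
    [:: ((0, 1), (1, 1), (1, 1)); ((1, 3), (0, 1), (2, 1)); ((3, 1), (4, 1),
      (5, 1)); ((2, 1), (6, 1), (7, 1)); ((6, 1), (2, 1), (0, 1)); ((8, 1),
      (9, 1), (10, 1)); ((4, 1), (3, 1), (3, 1)); ((11, 1), (7, 1), (6, 1));
      ((5, 1), (12, 1), (12, 1)); ((12, 2), (5, 1), (4, 1)); ((10, 3), (13,
      1), (14, 1)); ((7, 1), (11, 1), (8, 1)); ((9, 2), (8, 1), (11, 1));
      ((13, 1), (10, 1), (9, 1)); ((15, 1), (14, 1), (13, 1)); ((14, 1),
      (15, 1), (15, 1))]).
by vm_compute.
Qed.

Lemma mutetrahedron_no_closed_orbit c d :
  reach (perm_of_cycles 23 (consecutive_cycles 4 6)) (perm_of_cycles 23 mutetrahedron_v) c d ->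
  forall i k, ~ closed_orbit c d i k.
Proof.
apply: (@cycles_no_closed 23 2 (consecutive_cycles 4 6) mutetrahedron_v
    [:: (0, Flip); (0, Shear); (2, Swap)]
    [:: ((0, 3), (1, 1), (2, 1)); ((1, 1), (0, 1), (0, 2)); ((3, 1), (2, 2),
      (1, 2)); ((2, 1), (3, 1), (3, 1))]).
by vm_compute.
Qed.

Lemma octa4_no_closed_orbit c d :
  reach (perm_of_cycles 47 (consecutive_cycles 16 3)) (perm_of_cycles 47 octa4_v) c d ->
  forall i k, ~ closed_orbit c d i k.
Proof.
apply: (@cycles_no_closed 47 4 (consecutive_cycles 16 3) octa4_v
    [:: (0, Flip); (1, Shear); (2, Swap)]
    [:: ((0, 1), (1, 1), (1, 1)); ((1, 1), (0, 1), (2, 1)); ((3, 1), (2, 1),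
      (0, 1)); ((2, 1), (3, 1), (3, 1))]).
by vm_compute.
Qed.

Lemma truncated_octa8_no_closed_orbit c d :
  reach (perm_of_cycles 119 (consecutive_cycles 20 6)) (perm_of_cycles 119 truncated_octa8_v) c d ->
  forall i k, ~ closed_orbit c d i k.
Proof.
apply: (@cycles_no_closed 119 5 (consecutive_cycles 20 6) truncated_octa8_v
    [:: (0, Shear); (1, Swap); (1, Flip); (1, Shear); (2, Flip); (2, Shear);
      (4, Swap); (4, Flip); (4, Shear); (6, Swap); (7, Flip); (7, Shear);
      (9, Swap); (12, Swap)]
    [:: ((0, 1), (0, 1), (1, 1)); ((2, 1), (3, 1), (4, 1)); ((1, 1), (5, 1),
      (6, 1)); ((5, 1), (1, 1), (0, 1)); ((7, 1), (8, 1), (9, 1)); ((3, 1),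
      (2, 1), (2, 1)); ((10, 1), (6, 1), (5, 1)); ((4, 1), (11, 1), (12,
      1)); ((11, 1), (4, 1), (3, 1)); ((13, 1), (9, 1), (8, 1)); ((6, 1),
      (10, 1), (7, 1)); ((8, 1), (7, 1), (10, 1)); ((14, 1), (12, 1), (11,
      1)); ((9, 1), (13, 1), (14, 1)); ((12, 1), (14, 1), (13, 1))]).
by vm_compute.
Qed.

Lemma octa8_no_closed_orbit c d :
  reach (perm_of_cycles 11 (consecutive_cycles 4 3)) (perm_of_cycles 11 octa8_v) c d ->
  forall i k, ~ closed_orbit c d i k.
Proof.
apply: (@cycles_no_closed 11 2 (consecutive_cycles 4 3) octa8_v
    [:: (0, Flip); (0, Shear); (2, Swap)]
    [:: ((0, 1), (1, 1), (2, 1)); ((1, 1), (0, 1), (0, 1)); ((3, 1), (2, 1),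
      (1, 1)); ((2, 1), (3, 1), (3, 1))]).
by vm_compute.
Qed.

(** * Surfaces tiled by squares *)

Local Open Scope ring_scope.

Section Tiling.
Variables (R : realType) (N : nat).
Implicit Types (a b : {perm 'I_N}).

Definition in01 (s : R) := 0 <= s <= 1.

Definition glued_family a b (Y : Type) (f : 'I_N -> R -> R -> Y) :=
  (forall i t, in01 t -> f i 1 t = f (a i) 0 t) /\
  (forall i s, in01 s -> f i s 1 = f (b i) s 0).

(** [ch i s t] is the point with coordinates [(s, t)] in the [i]-th cell. The
    second clause says that no more points are identified than the gluing of the
    sides requires. As a universal property it is inherited by the charts
    obtained by exchanging or reversing coordinates, which allows to assume that
    displacements point up and to the right. *)
Definition tiling a b (X : Type) (ch : 'I_N -> R -> R -> X) :=
  glued_family a b ch /\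
  forall (Y : Type) (f : 'I_N -> R -> R -> Y), glued_family a b f ->
  forall i s t j s' t', in01 s -> in01 t -> in01 s' -> in01 t' ->
    ch i s t = ch j s' t' -> f i s t = f j s' t'.

(** The displacement of [x] by [(u, v)] within one cell. It is a relation since
    a point on a side, or at a corner, belongs to several cells. *)
Definition move (X : Type) (ch : 'I_N -> R -> R -> X) x u v y :=
  exists i s t, [/\ in01 s, in01 t, in01 (s + u) & in01 (t + v)] /\
    (x = ch i s t /\ y = ch i (s + u) (t + v)).

(** A vertex is regular if the angle around it is 2 pi, that is, if it is the
    lower left corner of one cell only. All other points satisfy the condition
    trivially. *)
Definition regular (X : Type) (ch : 'I_N -> R -> R -> X) x :=
  forall i j, ch i 0 0 = x -> ch j 0 0 = x -> i = j.

Definition swap_chart (X : Type) (ch : 'I_N -> R -> R -> X) i s t := ch i t s.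
Definition flip_chart (X : Type) (ch : 'I_N -> R -> R -> X) i s t :=
  ch i (1 - s) t.

Lemma in01_0 : in01 0. Proof. by rewrite /in01 lexx ler01. Qed.
Lemma in01_1 : in01 1. Proof. by rewrite /in01 lexx ler01. Qed.
Lemma zero_ico : 0 <= (0 : R) < 1. Proof. by rewrite lexx ltr01. Qed.
Lemma in01_flip s : in01 s -> in01 (1 - s). Proof. rewrite /in01; lra. Qed.
Hint Resolve in01_0 in01_1 in01_flip : core.

Lemma glued_swap a b Y (f : 'I_N -> R -> R -> Y) :
  glued_family a b f -> glued_family b a (swap_chart f).
Proof. by case=> h v; split. Qed.

Lemma glued_flip a b Y (f : 'I_N -> R -> R -> Y) :
  glued_family a b f -> glued_family (a^-1)%g b (flip_chart f).
Proof.
case=> h v; split=> i s s01; rewrite /flip_chart; last exact: v (in01_flip s01).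
by rewrite subrr subr0 h // permKV.
Qed.

Lemma glued_flip' a b Y (f : 'I_N -> R -> R -> Y) :
  glued_family (a^-1)%g b f -> glued_family a b (flip_chart f).
Proof. by move/glued_flip; rewrite invgK. Qed.

Lemma tiling_swap a b X (ch : 'I_N -> R -> R -> X) :
  tiling a b ch -> tiling b a (swap_chart ch).
Proof.
case=> g u; split; first exact: glued_swap.
move=> Y f /glued_swap gf i s t j s' t' hs ht hs' ht' e.
exact: (u Y _ gf i t s j t' s').
Qed.

Lemma tiling_flip a b X (ch : 'I_N -> R -> R -> X) :
  tiling a b ch -> tiling (a^-1)%g b (flip_chart ch).
Proof.
case=> g u; split; first exact: glued_flip.
move=> Y f /glued_flip' gf i s t j s' t' hs ht hs' ht' e.
have := u Y _ gf i (1 - s) t j (1 - s') t' (in01_flip hs) ht (in01_flip hs') ht' e.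
by rewrite /flip_chart !subKr.
Qed.

Lemma move_swap X (ch : 'I_N -> R -> R -> X) x u v y :
  move ch x u v y -> move (swap_chart ch) x v u y.
Proof. by move=> [i [s [t [[s0 t0 s1 t1] e]]]]; exists i, t, s. Qed.

Lemma move_swap' X (ch : 'I_N -> R -> R -> X) x u v y :
  move (swap_chart ch) x v u y -> move ch x u v y.
Proof. by move=> [i [s [t [[s0 t0 s1 t1] e]]]]; exists i, t, s. Qed.

Lemma move_flip X (ch : 'I_N -> R -> R -> X) x u v y :
  move ch x u v y -> move (flip_chart ch) x (- u) v y.
Proof.
move=> [i [s [t [[s0 t0 s1 t1] [-> ->]]]]]; exists i, (1 - s), t.
rewrite /flip_chart (_ : 1 - (1 - s + - u) = s + u); last by ring.
rewrite subKr; split=> //; split=> //; move: s0 s1; rewrite /in01; lra.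
Qed.

Lemma move_flip' X (ch : 'I_N -> R -> R -> X) x u v y :
  move (flip_chart ch) x (- u) v y -> move ch x u v y.
Proof.
move=> m; have := move_flip m; rewrite opprK => -[i [s [t [h [-> ->]]]]].
by exists i, s, t; rewrite /flip_chart !subKr.
Qed.

Lemma move_opp X (ch : 'I_N -> R -> R -> X) x u v y :
  move ch x u v y -> move ch y (- u) (- v) x.
Proof.
move=> [i [s [t [[s0 t0 s1 t1] [-> ->]]]]].
by exists i, (s + u), (t + v); rewrite !addrK.
Qed.

Lemma regular_swap X (ch : 'I_N -> R -> R -> X) x :
  regular ch x -> regular (swap_chart ch) x.
Proof. by []. Qed.

Lemma regular_flip a b X (ch : 'I_N -> R -> R -> X) x : glued_family a b ch ->
  regular ch x -> regular (flip_chart ch) x.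
Proof.
move=> [g _] r i j; rewrite /flip_chart subr0 !g // => hi hj.
exact: (@perm_inj _ a) (r _ _ hi hj).
Qed.

Section Chart.
Variables (a b : {perm 'I_N}) (X : Type) (ch : 'I_N -> R -> R -> X).
Hypothesis til : tiling a b ch.

Let gh i t : in01 t -> ch i 1 t = ch (a i) 0 t.
Proof. by case: til => -[h _] _; exact: h. Qed.
Let gv i s : in01 s -> ch i s 1 = ch (b i) s 0.
Proof. by case: til => -[_ h] _; exact: h. Qed.

(** The image of a coordinate in [R / Z], by its representative in [0, 1[. *)
Definition wrap (s : R) : R := if s == 1 then 0 else s.

Lemma wrap0 : wrap 0 = 0. Proof. by rewrite /wrap eq_sym oner_eq0. Qed.
Lemma wrap1 : wrap 1 = 0. Proof. by rewrite /wrap eqxx. Qed.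
Lemma wrap_lt s : s < 1 -> wrap s = s.
Proof. by rewrite /wrap; case: eqVneq => // ->; rewrite ltxx. Qed.

Lemma chart_wrap i s t j s' t' : in01 s -> in01 t -> in01 s' -> in01 t' ->
  ch i s t = ch j s' t' -> wrap s = wrap s' /\ wrap t = wrap t'.
Proof.
move=> hs ht hs' ht' e.
have gf : glued_family a b (fun (_ : 'I_N) s t => (wrap s, wrap t)).
  by split=> k r _; rewrite wrap0 wrap1.
by have [-> ->] := til.2 _ _ gf i s t j s' t' hs ht hs' ht' e.
Qed.

(** The lower left square at a corner is only determined up to a rotation
    around the vertex, which is why corners carry an orbit of [turn]. *)
Definition square_class i (s t : R) : {set 'I_N} :=
  let j := (if t == 1 then b else 1%g) ((if s == 1 then a else 1%g) i) in
  if (wrap s == 0) && (wrap t == 0) then porbit (turn a b) j else [set j].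

Lemma glued_class :
  glued_family a b (fun i s t => (square_class i s t, (wrap s, wrap t))).
Proof.
have ne01 : (0 == 1 :> R) = false by rewrite eq_sym oner_eq0.
split=> i s hs; rewrite /square_class wrap0 wrap1 !eqxx ne01 !perm1 //=.
congr (_, _); rewrite andbT; case: ifP => w0.
  case: ifP => s1; last by rewrite !perm1.
  by rewrite -turnE; have := porbit_perm (turn a b) 1 (a (b i)); rewrite expg1.
case: ifP => s1; last by rewrite !perm1.
by rewrite /wrap s1 eqxx in w0.
Qed.

(** The family that maps a point to its image in the torus and to the class of
    its cell is glued, so it separates points of the surface. *)
Lemma chart_base i s t j s' t' : 0 <= s < 1 -> 0 <= t < 1 -> 0 <= s' < 1 ->
    0 <= t' < 1 -> ch i s t = ch j s' t' ->
  [/\ s = s', t = t', j \in porbit (turn a b) i & (s != 0) || (t != 0) -> i = j].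
Proof.
move=> hs ht hs' ht' e.
have w r : 0 <= r < 1 -> in01 r /\ wrap r = r.
  by move=> hr; split; [rewrite /in01; lra|apply: wrap_lt; lra].
have [[hs1 ws] [ht1 wt]] := (w s hs, w t ht).
have [[hs1' ws'] [ht1' wt']] := (w s' hs', w t' ht').
have := til.2 _ _ glued_class i s t j s' t' hs1 ht1 hs1' ht1' e.
rewrite /square_class ws wt ws' wt'; case=> cls es et.
have n1 r : 0 <= r < 1 -> (r == 1) = false by case/andP=> _ /lt_eqF.
move: cls; rewrite es et !n1 // !perm1; case: ifP => [/andP[/eqP-> /eqP->]|n0].
  by move=> ->; rewrite porbit_id eqxx; split.
by move=> /set1_inj ->; rewrite porbit_id; split.
Qed.

Lemma chart_turn i : ch (turn a b i) 0 0 = ch i 0 0.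
Proof.
pose k := (b^-1 (a^-1 i))%g.
have -> : i = a (b k) by rewrite /k !permKV.
by rewrite turnE -!gv // -!gh // -gv.
Qed.

Lemma regular_turn i : regular ch (ch i 0 0) -> turn a b i = i.
Proof. by move=> r; apply: r => //; rewrite chart_turn. Qed.

(** Representatives on the right or upper side are replaced by those in the
    neighbouring square. *)
Lemma move_normal x u v y : 0 <= u -> 0 <= v -> move ch x u v y ->
  exists i s t, [/\ 0 <= s < 1, 0 <= t < 1, s + u <= 1 & t + v <= 1] /\
    (x = ch i s t /\ y = ch i (s + u) (t + v)).
Proof.
move=> u0 v0 [i [s [t [[hs ht hsu htv] [-> ->]]]]].
have [j [s' [hs' su' [ex ey]]]] : exists j s', [/\ 0 <= s' < 1, s' + u <= 1 &
    ch i s t = ch j s' t /\ ch i (s + u) (t + v) = ch j (s' + u) (t + v)].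
  have [s1|sn1] := eqVneq s 1.
    have u00 : u = 0 by move: hsu; rewrite s1 /in01; lra.
    by exists (a i), 0; rewrite s1 u00 !addr0 !gh //; split=> //; lra.
  by exists i, s; split=> //; move: hs hsu sn1; rewrite /in01; lra.
have hs1 : in01 s' by rewrite /in01; lra.
have hsu1 : in01 (s' + u) by rewrite /in01; lra.
rewrite ex ey; have [t1|tn1] := eqVneq t 1.
  have v00 : v = 0 by move: htv; rewrite t1 /in01; lra.
  by exists (b j), s', 0; rewrite t1 v00 !addr0 !gv //; split=> //; split=> //; lra.
by exists j, s', t; move: ht htv tn1; rewrite /in01 => *; split=> //; split=> //; lra.
Qed.

Lemma regular_base x i s t j s' t' : regular ch x -> 0 <= s < 1 -> 0 <= t < 1 ->
  0 <= s' < 1 -> 0 <= t' < 1 -> x = ch i s t -> x = ch j s' t' ->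
  [/\ i = j, s = s' & t = t'].
Proof.
move=> r hs ht hs' ht' ex ex'.
have [es et _ ij] := chart_base hs ht hs' ht' (etrans (esym ex) ex').
split=> //; case: (boolP ((s != 0) || (t != 0))) => [/ij//|].
rewrite negb_or !negbK => /andP[/eqP s0 /eqP t0].
by apply: r; [rewrite ex|rewrite ex']; rewrite -?es -?et s0 t0.
Qed.

(** In one quadrant around a regular point there is only one cell, and the
    surface is the plane. *)
Lemma move_quadrant x u v y u' v' y' : regular ch x ->
  0 <= u -> 0 <= v -> 0 <= u' -> 0 <= v' ->
  move ch x u v y -> move ch x u' v' y' -> move ch y (u' - u) (v' - v) y'.
Proof.
move=> r u0 v0 u0' v0' /(move_normal u0 v0)[i [s [t [[hs ht hsu htv] [ex ey]]]]].
move=> /(move_normal u0' v0')[j [s' [t' [[hs' ht' hsu' htv'] [ex' ey']]]]].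
have [ij es et] := regular_base r hs ht hs' ht' ex ex'.
exists i, (s + u), (t + v); rewrite ey ey' -ij -es -et.
rewrite (_ : s + u + (u' - u) = s + u'); last by ring.
rewrite (_ : t + v + (v' - v) = t + v'); last by ring.
by rewrite /in01; split=> //; split=> //; lra.
Qed.

Lemma move_exists_quadrant x : (exists i s t, [/\ in01 s, in01 t & x = ch i s t]) ->
  exists2 r : R, 0 < r & forall u v, 0 <= u < r -> 0 <= v < r ->
  exists y, move ch x u v y.
Proof.
move=> [i [s [t [hs ht ->]]]].
have z0 : (0 : R) <= 0 by [].
have m0 : move ch (ch i s t) 0 0 (ch i s t).
  by exists i, s, t; rewrite !addr0.
have [j [s' [t' [[hs' ht' _ _] [-> _]]]]] := move_normal z0 z0 m0.
exists (Num.min (1 - s') (1 - t')); first by rewrite lt_min; lra.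
move=> u v; rewrite !lt_min => hu hv.
exists (ch j (s' + u) (t' + v)), j, s', t'; rewrite /in01; split=> //.
split; lra.
Qed.

(** Near [x], a point reached from [x] by a small displacement has no other
    representatives than those obtained by displacing a representative of [x]
    itself. *)
Lemma move_back x : (exists i s t, [/\ in01 s, in01 t & x = ch i s t]) ->
  exists2 r : R, 0 < r & forall u v k q1 q2, `|u| < r -> `|v| < r ->
    in01 q1 -> in01 q2 -> move ch x u v (ch k q1 q2) ->
    [/\ in01 (q1 - u), in01 (q2 - v) & ch k (q1 - u) (q2 - v) = x].
Proof.
move=> [i0 [s0 [t0 [hs0 ht0 ex]]]].
pose rad (s : R) := if wrap s == 0 then 1 else Num.min s (1 - s).
have rad_gt0 s : in01 s -> 0 < rad s.
  rewrite /rad /wrap /in01; case: (eqVneq s 1) => [_|s1]; first by rewrite eqxx ltr01.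
  by case: eqVneq => [_|sn0] hs; rewrite ?ltr01 // lt_min; lra.
exists (Num.min (rad s0) (rad t0)); first by rewrite lt_min !rad_gt0.
move=> u v k q1 q2; rewrite !lt_min => /andP[us ut] /andP[vs vt] hq1 hq2.
move=> [i [s [t [[hs ht hsu htv] [ex' ey]]]]].
have [ws wt] := chart_wrap hs0 ht0 hs ht (etrans (esym ex) ex').
have [wq1 wq2] := chart_wrap hq1 hq2 hsu htv ey.
(* In each coordinate, either the point stays on the same side of the square,
   or it is in the interior of the unit interval. *)
have coord s' u' q : in01 s' -> in01 (s' + u') -> in01 q -> `|u'| < rad s' ->
    wrap q = wrap (s' + u') ->
    (u' = 0 /\ wrap s' = 0) \/ (0 < q < 1 /\ q = s' + u').
  rewrite /rad /wrap /in01.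
  case: (eqVneq s' 1) => [->|s1].
    rewrite eqxx => hs' hsu' hq; rewrite ltr_norml => hu.
    case: (eqVneq (1 + u') 1) => [?|?]; first by left; split=> //; lra.
    by case: (eqVneq q 1) => ? ?; right; lra.
  case: (eqVneq s' 0) => [->|sn0] hs' hsu' hq.
    rewrite ltr_norml add0r => hu.
    case: (eqVneq u' 1) => [?|?]; first by lra.
    case: (eqVneq q 1) => ? ?; first by left; lra.
    by case: (eqVneq u' 0) => ?; [left|right; lra].
  rewrite lt_min !ltr_norml => hu.
  case: (eqVneq (s' + u') 1) => [?|?]; first by lra.
  by case: (eqVneq q 1) => ? ?; right; lra.
have rads : rad s0 = rad s.
  move: ws hs0 hs; rewrite /rad /wrap /in01.
  case: (eqVneq s0 1) => ?; case: (eqVneq s 1) => ? ws; subst; rewrite -?ws ?eqxx //.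
have radt : rad t0 = rad t.
  move: wt ht0 ht; rewrite /rad /wrap /in01.
  case: (eqVneq t0 1) => ?; case: (eqVneq t 1) => ? wt; subst; rewrite -?wt ?eqxx //.
rewrite rads in us; rewrite radt in vt.
have side s' : in01 s' -> wrap s' = 0 -> s' = 0 \/ s' = 1.
  by move=> _; rewrite /wrap; case: eqVneq => ? ?; [right|left].
have [[u0 s00]|[q1i q1e]] := coord s u q1 hs hsu hq1 us wq1;
have [[v0 t00]|[q2i q2e]] := coord t v q2 ht htv hq2 vt wq2.
- by rewrite u0 v0 !subr0 ey ex' u0 v0 !addr0.
- have q1s : wrap q1 = 0 by rewrite wq1 u0 addr0.
  rewrite u0 subr0 q2e addrK; split=> //; rewrite ex'.
  rewrite u0 addr0 -q2e in ey.
  have q2r : in01 q2 by [].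
  have q2b : 0 <= q2 < 1 by lra.
  have q2n : (0 != 0 :> R) || (q2 != 0) by apply/orP; right; rewrite gt_eqF; case/andP: q2i.
  move: ey; case: (side _ hq1 q1s) => ->; case: (side _ hs s00) => ->;
    rewrite ?gh // => /(chart_base zero_ico q2b zero_ico q2b)[_ _ _ /(_ q2n)].
  + by move=> ->.
  + by move=> ->.
  + by move=> ->.
  + by move=> ->.
- have q2s : wrap q2 = 0 by rewrite wq2 v0 addr0.
  rewrite v0 subr0 q1e addrK; split=> //; rewrite ex'.
  rewrite v0 addr0 -q1e in ey.
  have q1b : 0 <= q1 < 1 by lra.
  have q1n : (q1 != 0) || (0 != 0 :> R) by rewrite gt_eqF //; case/andP: q1i.
  move: ey; case: (side _ hq2 q2s) => ->; case: (side _ ht t00) => ->;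
    rewrite ?gv // => /(chart_base q1b zero_ico q1b zero_ico)[_ _ _ /(_ q1n)].
  + by move=> ->.
  + by move=> ->.
  + by move=> ->.
  + by move=> ->.
- have q1b : 0 <= q1 < 1 by lra.
  have q2b : 0 <= q2 < 1 by lra.
  have q1n : (q1 != 0) || (q2 != 0) by rewrite gt_eqF //; case/andP: q1i.
  move: ey; rewrite -q1e -q2e => /(chart_base q1b q2b q1b q2b)[_ _ _ /(_ q1n) ->].
  by rewrite q1e q2e !addrK ex'.
Qed.

End Chart.
End Tiling.

#[local] Hint Resolve in01_0 in01_1 in01_flip : core.

Section Moves.
Variables (R : realType) (N : nat).

Lemma sign_cases (u : R) : 0 <= u \/ 0 <= - u.
Proof. by case: (leP 0 u) => h; [left|right; rewrite oppr_ge0 ltW]. Qed.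

Definition same_sign (u u' : R) := (0 <= u) && (0 <= u') || (u <= 0) && (u' <= 0).

Lemma same_sign_cases (u u' : R) : same_sign u u' ->
  0 <= u /\ 0 <= u' \/ 0 <= - u /\ 0 <= - u'.
Proof. by rewrite !oppr_ge0 => /orP[]/andP[]; [left|right]. Qed.

Section Move.
Variables (X : Type).
Implicit Types (ch : 'I_N -> R -> R -> X) (a b : {perm 'I_N}).

Lemma move_half a b ch x u v y u' v' y' : tiling a b ch -> regular ch x ->
  same_sign u u' -> 0 <= v -> 0 <= v' ->
  move ch x u v y -> move ch x u' v' y' -> move ch y (u' - u) (v' - v) y'.
Proof.
move=> til r /same_sign_cases[] [u0 u0'] v0 v0' m m'.
  exact: (move_quadrant til r u0 v0 u0' v0').
apply: move_flip'; rewrite opprB -{1}[u]opprK [_ + - u']addrC.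
exact: (move_quadrant (tiling_flip til) (regular_flip til.1 r) u0 v0 u0' v0'
  (move_flip m) (move_flip m')).
Qed.

(** The other quadrants follow by symmetry. *)
Lemma move_same_quadrant a b ch x u v y u' v' y' : tiling a b ch ->
  regular ch x -> same_sign u u' -> same_sign v v' ->
  move ch x u v y -> move ch x u' v' y' -> move ch y (u' - u) (v' - v) y'.
Proof.
move=> til r su /same_sign_cases[] [v0 v0'] m m'.
  exact: (move_half til r su v0 v0').
have tils := tiling_swap til; have rs := regular_swap r.
have tf := tiling_flip tils; have rf := regular_flip tils.1 rs.
apply: move_swap'; apply: move_flip'; apply: move_swap'.
rewrite opprB -{1}[v]opprK [_ + - v']addrC.
exact: (move_half (tiling_swap tf) (regular_swap rf) su v0 v0'
  (move_swap (move_flip (move_swap m))) (move_swap (move_flip (move_swap m')))).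
Qed.

Lemma same_signxx (u : R) : same_sign u u.
Proof. by rewrite /same_sign !andbb; case: leP => //= /ltW. Qed.

(** A regular point has a Euclidean neighbourhood, so displacements starting
    there lead to one point only. *)
Lemma move_unique a b ch x u v y y' : tiling a b ch -> regular ch x ->
  move ch x u v y -> move ch x u v y' -> y = y'.
Proof.
move=> til r m m'.
have [i [s [t [_ [-> ->]]]]] :=
  move_same_quadrant til r (same_signxx u) (same_signxx v) m m'.
by rewrite !subrr !addr0.
Qed.

Definition covered ch x := exists i s t, [/\ in01 s, in01 t & x = ch i s t].

Lemma covered_swap ch x : covered ch x -> covered (swap_chart ch) x.
Proof. by move=> [i [s [t [hs ht e]]]]; exists i, t, s. Qed.

Lemma covered_flip ch x : covered ch x -> covered (flip_chart ch) x.
Proof.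
move=> [i [s [t [hs ht e]]]]; exists i, (1 - s), t.
by rewrite /flip_chart subKr; split=> //; exact: in01_flip.
Qed.

Lemma move_exists_half a b ch x : tiling a b ch -> covered ch x ->
  exists2 r : R, 0 < r & forall u v, `|u| < r -> 0 <= v < r ->
  exists y, move ch x u v y.
Proof.
move=> til c; have [r r0 h] := move_exists_quadrant til c.
have [r' r0' h'] := move_exists_quadrant (tiling_flip til) (covered_flip c).
exists (Num.min r r'); first by rewrite lt_min r0.
move=> u v; rewrite !lt_min !ltr_norml => /andP[ur ur'] /andP[v0 /andP[vr vr']].
case: (sign_cases u) => u0; first by apply: h; lra.
have [||y m] := h' (- u) v; [lra|lra|].
by exists y; exact: move_flip'.
Qed.

Lemma move_exists a b ch x : tiling a b ch -> covered ch x ->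
  exists2 r : R, 0 < r & forall u v, `|u| < r -> `|v| < r ->
  exists y, move ch x u v y.
Proof.
move=> til c; have [r r0 h] := move_exists_half til c.
have [r' r0' h'] := move_exists_half
  (tiling_swap (tiling_flip (tiling_swap til)))
  (covered_swap (covered_flip (covered_swap c))).
exists (Num.min r r'); first by rewrite lt_min r0.
move=> u v; rewrite !lt_min => /andP[ur ur'] /andP[vr vr'].
case: (sign_cases v) => v0.
  by apply: h => //; rewrite v0 /=; move: vr; rewrite ltr_norml => /andP[].
have [//||y m] := h' u (- v).
  by rewrite v0 /=; move: vr'; rewrite -normrN ltr_norml => /andP[].
by exists y; apply: move_swap'; apply: move_flip'; exact: move_swap'.
Qed.

(** The projection to the torus obtained by identifying all squares, as a
    relation because coordinates on the torus are only defined modulo 1. *)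
Definition over ch x p q := exists i s t, [/\ in01 s, in01 t & x = ch i s t] /\
  exists m n : int, p = s + m%:~R /\ q = t + n%:~R.

Lemma covered_over ch x : covered ch x -> exists p q, over ch x p q.
Proof.
move=> [i [s [t [hs ht e]]]]; exists s, t, i, s, t; split=> //.
by exists 0, 0; rewrite !addr0.
Qed.

Lemma wrap_int (s s' : R) : wrap s = wrap s' -> exists m : int, s' = s + m%:~R.
Proof.
rewrite /wrap; case: eqVneq => [->|_]; case: eqVneq => [->|_] e.
- by exists 0; rewrite addr0.
- by exists (-1); rewrite -e mulrNz mulr1z subrr.
- by exists 1; rewrite e add0r.
- by exists 0; rewrite addr0.
Qed.

Lemma over_unique a b ch x p q p' q' : tiling a b ch ->
  over ch x p q -> over ch x p' q' ->
  exists m n : int, p' = p + m%:~R /\ q' = q + n%:~R.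
Proof.
move=> til [i [s [t [[hs ht e] [m [n [-> ->]]]]]]].
move=> [j [s' [t' [[hs' ht' e'] [m' [n' [-> ->]]]]]]].
have [/wrap_int[k ->] /wrap_int[l ->]] :=
  chart_wrap til hs ht hs' ht' (etrans (esym e) e').
exists (k + m' - m), (l + n' - n); rewrite !rmorphB !rmorphD /=.
by split; ring.
Qed.

Lemma over_shift ch x p q (m n : int) : over ch x p q ->
  over ch x (p + m%:~R) (q + n%:~R).
Proof.
move=> [i [s [t [h [m' [n' [-> ->]]]]]]]; exists i, s, t; split=> //.
by exists (m' + m), (n' + n); rewrite !rmorphD /= !addrA.
Qed.

Lemma over_move a b ch x u v y p q : tiling a b ch ->
  over ch x p q -> move ch x u v y -> over ch y (p + u) (q + v).
Proof.
move=> til o [i [s [t [[hs ht hsu htv] [ex ->]]]]].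
have ox : over ch x s t.
  by exists i, s, t; split=> //; exists 0, 0; rewrite !addr0.
have [m [n [-> ->]]] := over_unique til ox o.
rewrite addrAC [t + _ + _]addrAC; apply: over_shift.
by exists i, (s + u), (t + v); split=> //; exists 0, 0; rewrite !addr0.
Qed.

Lemma small_int (m : int) : `|m%:~R : R| < 1 -> m = 0.
Proof. by rewrite -intr_norm ltrz1 => h; case: m h => -[]. Qed.

(** Displacements shorter than half a cell are determined by their endpoints in
    the torus. *)
Lemma over_small a b ch x p q u v u' v' : tiling a b ch ->
  over ch x (p + u) (q + v) -> over ch x (p + u') (q + v') ->
  `|u' - u| < 1 -> `|v' - v| < 1 -> u = u' /\ v = v'.
Proof.
move=> til o o' hu hv; have [m [n [em en]]] := over_unique til o o'.
have em' : u' - u = m%:~R.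
  by rewrite -[m%:~R](addKr (p + u)) -em; ring.
have en' : v' - v = n%:~R.
  by rewrite -[n%:~R](addKr (q + v)) -en; ring.
move: hu hv; rewrite em' en' => /small_int m0 /small_int n0.
by move: em' en'; rewrite m0 n0 => /subr0_eq-> /subr0_eq->.
Qed.

Definition straight_at ch (g : R -> X) (u v t : R) := exists2 e : R, 0 < e &
  forall tau, `|tau| < e -> move ch (g t) (tau * u) (tau * v) (g (t + tau)).

End Move.
End Moves.

Section IntervalChain.
Variable R : realType.

(** Connectedness of an interval, in the form of chaining: a transitive
    relation that relates every point to its neighbours on both sides relates
    the endpoints. *)
Lemma interval_chain (P : R -> R -> Prop) (a b : R) : a <= b ->
  (forall x, a <= x <= b -> P x x) ->
  (forall x y z, a <= x -> x <= y -> y <= z -> z <= b ->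
     P x y -> P y z -> P x z) ->
  (forall t, a <= t <= b -> exists2 d : R, 0 < d &
     forall s, a <= s <= b -> `|s - t| < d ->
       (s <= t -> P s t) /\ (t <= s -> P t s)) ->
  P a b.
Proof.
move=> ab Pxx Ptr Ploc.
pose S := [set s | a <= s <= b /\ P a s]%classic.
have Sa : S a by rewrite /S /= lexx ab; split=> //; apply: Pxx; rewrite lexx.
have bS : has_ubound S by exists b => s [/andP[]].
have hS : has_sup S by split=> //; exists a.
pose c := sup S.
have ac : a <= c by exact: ub_le_sup.
have cb : c <= b by apply: ge_sup; [exists a|move=> s [/andP[]]].
have cab : a <= c <= b by rewrite ac.
have [d d0 hd] := Ploc c cab.
have Pac : P a c.
  have [s [sab Pas] cs] := sup_adherent d0 hS.
  have sc : s <= c by exact: ub_le_sup.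
  have [||h _] := hd s; [exact: sab| |].
    by rewrite distrC ger0_norm; rewrite -/c in cs; lra.
  by apply: (Ptr _ s) => //; [case/andP: sab|exact: h].
have [bd|db] := ltP (b - c) d.
  have [||_ h] := hd b; [by rewrite ab lexx|by rewrite ger0_norm // subr_ge0|].
  by apply: (Ptr _ c) => //; exact: h.
have [||_ h] := hd (c + d / 2); [lra| |].
  by rewrite addrC addKr ger0_norm; lra.
have : S (c + d / 2).
  split; first by lra.
  by apply: (Ptr _ c) => //; [lra|lra|apply: h; lra].
by move/(ub_le_sup bS); rewrite -/c; lra.
Qed.

End IntervalChain.

(** * Geodesics are straight *)

Section Geodesics.
Variable R : realType.

(** The norm of the plane is kept abstract, as Octa-8 is tiled by rhombi: the
    proof needs a strictly convex norm. *)
Record strict_norm (nrm : R -> R -> R) : Prop := StrictNorm {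
  nrm_bound : exists2 K : R, 0 < K &
    forall u v, `|u| <= K * nrm u v /\ `|v| <= K * nrm u v;
  nrm_opp : forall u v, nrm (- u) (- v) = nrm u v;
  nrm_hom : forall k u v, 0 <= k -> nrm (k * u) (k * v) = k * nrm u v;
  nrm_tri : forall u v u' v', nrm (u + u') (v + v') <= nrm u v + nrm u' v';
  nrm_strict : forall u v u' v', nrm (u + u') (v + v') = nrm u v + nrm u' v' ->
    nrm u' v' * u = nrm u v * u' /\ nrm u' v' * v = nrm u v * v'
}.

Lemma broken_cat (X : flat_surface R) (x y z : X) l m :
  broken_line x y l -> broken_line y z m -> broken_line x z (l + m).
Proof.
move=> xy; elim=> [|{}z w m' k _ IH s]; first by rewrite addr0.
by rewrite addrA; apply: BrokenLineStep IH s.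
Qed.

Definition near_line (X : flat_surface R) (x y : X) L :=
  exists2 l, l <= L & broken_line x y l.

Lemma near_cat (X : flat_surface R) (x y z : X) l m :
  near_line x y l -> near_line y z m -> near_line x z (l + m).
Proof.
move=> [l' hl xy] [m' hm yz]; exists (l' + m'); first exact: lerD.
exact: broken_cat yz.
Qed.

Lemma near_dist (X : flat_surface R) (x y : X) L : near_line x y L ->
  (intrinsic_dist x y <= L%:E)%E.
Proof.
move=> [l lL xy]; apply: (@le_trans _ _ l%:E); last by rewrite lee_fin.
by apply: ereal_inf_lbound; exists l.
Qed.

Lemma dist_near (X : flat_surface R) (x y : X) e e' :
  intrinsic_dist x y = e%:E -> e < e' ->
  exists2 l, l < e' & broken_line x y l.
Proof.
move=> d ee'; have : (intrinsic_dist x y < e'%:E)%E by rewrite d lte_fin.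
by move=> /ereal_inf_lt [_ /= [l xy <-]]; rewrite lte_fin; exists l.
Qed.

Variables (X : flat_surface R) (N : nat) (a b : {perm 'I_N}).
Variables (nrm : R -> R -> R) (ch : 'I_N -> R -> R -> X).
Hypothesis nrmP : strict_norm nrm.
Hypothesis til : tiling a b ch.
Hypothesis cov : forall x, covered ch x.

Definition cell_surface : flat_surface R :=
  FlatSurface (fun x y l => exists u v, move ch x u v y /\ l = nrm u v) set0.

Definition cell_line (x y : X) (l : R) := @broken_line R cell_surface x y l.

Hypothesis segment_cell : forall (x y : X) l, segment x y l ->
  exists2 l', l' <= l & cell_line x y l'.
Hypothesis cell_segment : forall (x y : X) u v, move ch x u v y ->
  near_line x y (nrm u v).

Lemma nrm0 : nrm 0 0 = 0.
Proof. by have := nrm_hom nrmP 0 0 (lexx 0); rewrite !mul0r. Qed.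

Lemma nrm_ge0 u v : 0 <= nrm u v.
Proof.
by have := nrm_tri nrmP u v (- u) (- v); rewrite !subrr nrm0 nrm_opp //; lra.
Qed.

Lemma broken_cell (x y : X) l : broken_line x y l ->
  exists2 l', l' <= l & cell_line x y l'.
Proof.
elim=> [|{}y z {}l m _ [l' hl xy] /segment_cell [m' hm yz]].
  by exists 0 => //; exact: BrokenLineNil.
by exists (l' + m'); [exact: lerD|exact: (@broken_cat cell_surface _ y)].
Qed.

Lemma move0 x : move ch x 0 0 x.
Proof.
by have [i [s [t [hs ht ->]]]] := cov x; exists i, s, t; rewrite !addr0.
Qed.

(** A short broken line starting at [x] never leaves the cells that contain [x],
    so it can be replaced by one displacement. *)
Lemma cell_star (x : X) : exists2 r : R, 0 < r & forall y l, cell_line x y l ->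
  l < r -> exists u v, move ch x u v y /\ nrm u v <= l.
Proof.
have [r r0 back] := move_back til (cov x).
have [K K0 hK] := nrm_bound nrmP.
exists (r / K); first by rewrite divr_gt0.
move=> y l; elim=> [_|{}y z {}l m _ IH [u' [v' [yz ->]]] lr].
  by exists 0, 0; rewrite nrm0; split=> //; exact: move0.
have {}IH := IH (le_lt_trans _ lr); have [|u [v [xy uvl]]] := IH.
  by rewrite lerDl nrm_ge0.
have lt_r w : `|w| <= K * nrm u v -> `|w| < r.
  move=> h; apply: (le_lt_trans h); rewrite mulrC -ltr_pdivlMr //.
  by apply: le_lt_trans lr; apply: (le_trans uvl); rewrite lerDl nrm_ge0.
have [/lt_r ur /lt_r vr] := hK u v.
exists (u + u'), (v + v'); split; last first.
  by apply: (le_trans (nrm_tri nrmP _ _ _ _)); rewrite lerD2r.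
case: yz => k [q1 [q2 [[h1 h2 h1' h2'] [ey ez]]]]; rewrite ey in xy.
have [b1 b2 eb] := back u v k q1 q2 ur vr h1 h2 xy.
exists k, (q1 - u), (q2 - v); rewrite eb !addrA !subrK; split=> //.
Qed.

(** At small scale the intrinsic distance to [x] is the norm of the
    displacement. *)
Lemma dist_move (x : X) : exists2 r : R, 0 < r & forall y e,
  intrinsic_dist x y = e%:E -> e < r ->
  exists u v, move ch x u v y /\ nrm u v = e.
Proof.
have [r r0 star] := cell_star x; have [K K0 hK] := nrm_bound nrmP.
exists (Num.min r (1 / (2 * K))); first by rewrite lt_min r0 divr_gt0 // mulr_gt0.
move=> y e d er; set r' := Num.min _ _ in er.
have near e' : e < e' -> e' <= r' ->
    exists u v, [/\ move ch x u v y, nrm u v < e', e <= nrm u v,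
      `|u| < 1 / 2 & `|v| < 1 / 2].
  move=> ee' er'; have [l le' /broken_cell[l' l'l xy]] := dist_near d ee'.
  have lr : l' < r by move: er' l'l; rewrite /r' le_min; lra.
  have [u [v [m uvl]]] := star y l' xy lr; exists u, v.
  have uve : nrm u v < e' by apply: (le_lt_trans uvl); lra.
  have half w : `|w| <= K * nrm u v -> `|w| < 1 / 2.
    move=> h; apply: (le_lt_trans h); rewrite mulrC -ltr_pdivlMr //.
    apply: (lt_le_trans uve); apply: (le_trans er').
    by rewrite /r' ge_min invfM !mulrA lexx orbT.
  have [/half hu /half hv] := hK u v; split=> //.
  by have := near_dist (cell_segment m); rewrite d lee_fin.
have [u [v [m uvr euv hu hv]]] := near r' er (lexx _).
exists u, v; split=> //; apply/eqP; rewrite eq_le euv andbT leNgt.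
apply/negP => lt; have [u' [v' [m' lt' _ hu' hv']]] := near _ lt (ltW uvr).
have [p [q o]] := covered_over (cov x).
have [||eu ev] := over_small til (over_move til o m) (over_move til o m').
- by apply: (le_lt_trans (ler_normB _ _)); lra.
- by apply: (le_lt_trans (ler_normB _ _)); lra.
by move: lt'; rewrite -eu -ev ltxx.
Qed.

(** A regular point has a Euclidean neighbourhood: the segment between two
    nearby points, seen in the plane, is cut by the axes through [x] into
    pieces that each lie in one square. *)
Lemma regular_shortcut (x : X) : regular ch x -> exists2 r : R, 0 < r &
  forall u v u' v' y y', `|u| < r -> `|v| < r -> `|u'| < r -> `|v'| < r ->
    move ch x u v y -> move ch x u' v' y' ->
    near_line y y' (nrm (u' - u) (v' - v)).
Proof.
move=> reg; have [r r0 ex] := move_exists til (cov x); exists r => //.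
have quad u v u' v' y y' : same_sign u u' -> same_sign v v' ->
    move ch x u v y -> move ch x u' v' y' ->
    near_line y y' (nrm (u' - u) (v' - v)).
  by move=> su sv m m'; exact: cell_segment (move_same_quadrant til reg su sv m m').
have cut (k u v u' v' : R) (y z y' : X) : 0 <= k <= 1 ->
    near_line y z (nrm (k * (u' - u)) (k * (v' - v))) ->
    near_line z y' (nrm ((1 - k) * (u' - u)) ((1 - k) * (v' - v))) ->
    near_line y y' (nrm (u' - u) (v' - v)).
  move=> /andP[k0 k1] h h'; have := near_cat h h'.
  by rewrite !nrm_hom ?subr_ge0 // -mulrDl addrC subrK mul1r.
have cross (u u' : R) : ~~ same_sign u u' ->
    exists2 k : R, 0 <= k <= 1 & u + k * (u' - u) = 0.
  move=> h; have d0 : u - u' != 0.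
    by apply: contraNneq h => /subr0_eq ->; exact: same_signxx.
  exists (u / (u - u')); last by field.
  move: h d0; rewrite /same_sign; case: (ltrgtP u u') => [lt|lt|->] h d0.
  + by rewrite ler_ndivlMr ?ler_ndivrMr ?subr_lt0 // mul0r mul1r; lra.
  + by rewrite ler_pdivlMr ?ler_pdivrMr ?subr_gt0 // mul0r mul1r; lra.
  + by rewrite subrr eqxx in d0.
have convex (w w' k : R) : `|w| < r -> `|w'| < r -> 0 <= k <= 1 ->
    `|w + k * (w' - w)| < r.
  move=> hw hw' /andP[k0 k1].
  have -> : w + k * (w' - w) = (1 - k) * w + k * w' by ring.
  apply: (le_lt_trans (ler_normD _ _)); rewrite !normrM.
  rewrite (ger0_norm k0) ger0_norm ?subr_ge0 //.
  have [->|kn] := eqVneq k 0; first by rewrite subr0 mul1r mul0r addr0.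
  have k0' : 0 < k by rewrite lt0r kn.
  have : k * `|w'| < k * r by rewrite ltr_pM2l.
  have : (1 - k) * `|w| <= (1 - k) * r by rewrite ler_wpM2l ?subr_ge0 // ltW.
  lra.
have half u v u' v' y y' : `|u| < r -> `|v| < r -> `|u'| < r -> `|v'| < r ->
    same_sign v v' -> move ch x u v y -> move ch x u' v' y' ->
    near_line y y' (nrm (u' - u) (v' - v)).
  move=> hu hv hu' hv' sv m m'; case: (boolP (same_sign u u')) => [su|].
    exact: quad m m'.
  move=> /cross[k hk ek].
  have [z mz] := ex _ _ (convex u u' k hu hu' hk) (convex v v' k hv hv' hk).
  rewrite ek in mz.
  have svz : same_sign v (v + k * (v' - v)) /\ same_sign (v + k * (v' - v)) v'.
    have -> : v + k * (v' - v) = (1 - k) * v + k * v' by ring.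
    have k1 : 0 <= 1 - k by lra.
    have k0 : 0 <= k by lra.
    rewrite /same_sign; case/orP: sv => /andP[s s'].
      by rewrite s s' addr_ge0 ?mulr_ge0.
    have : (1 - k) * v + k * v' <= 0 by rewrite -oppr_ge0 opprD -!mulrN
       addr_ge0 ?mulr_ge0 ?oppr_ge0.
    by move=> ->; rewrite s s' /= !orbT.
  have sz (w : R) : same_sign w 0 /\ same_sign 0 w.
    by rewrite /same_sign lexx !andbT /=; case: (leP 0 w) => //= /ltW ->.
  apply: (cut k u v u' v' y z y' hk).
    have := quad _ _ _ _ _ _ (sz u).1 svz.1 m mz.
    by rewrite -ek !(addrC _ (k * _)) !addrK.
  have := quad _ _ _ _ _ _ (sz u').2 svz.2 mz m'.
  by rewrite -ek; congr (near_line _ _ (nrm _ _)); ring.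
move=> u v u' v' y y' hu hv hu' hv' m m'.
case: (boolP (same_sign v v')) => [sv|]; first exact: half m m'.
move=> /cross[k hk ek].
have hcu := convex u u' k hu hu' hk; have hcv := convex v v' k hv hv' hk.
have [z mz] := ex _ _ hcu hcv; rewrite ek in mz hcv.
have sz (w : R) : same_sign w 0 /\ same_sign 0 w.
  by rewrite /same_sign lexx !andbT /=; case: (leP 0 w) => //= /ltW ->.
apply: (cut k u v u' v' y z y' hk).
  have := half _ _ _ _ _ _ hu hv hcu hcv (sz v).1 m mz.
  by rewrite -ek !(addrC _ (k * _)) !addrK.
have := half _ _ _ _ _ _ hcu hcv hu' hv' (sz v').2 mz m'.
by rewrite -ek; congr (near_line _ _ (nrm _ _)); ring.
Qed.

(** A geodesic passes through a regular point without changing direction: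
    otherwise the shortcut across the angle would be shorter. *)
Lemma geodesic_straight L (g : R -> X) t : geodesic L g -> 0 < t < L ->
  regular ch (g t) -> exists u v, nrm u v = 1 /\ straight_at ch g u v t.
Proof.
move=> geo tL reg; have [|e1 e10 he1] := geo t; first by lra.
have [r2 r20 h2] := dist_move (g t).
have [r3 r30 h3] := regular_shortcut reg.
have [K K0 hK] := nrm_bound nrmP.
pose e := Num.min (Num.min e1 r2) (Num.min (r3 / K) (Num.min t (L - t))).
have e0 : 0 < e by rewrite /e !lt_min e10 r20 divr_gt0 //=; lra.
have [ee1 [er2 [er3 [et eL]]]] :
    e <= e1 /\ e <= r2 /\ e <= r3 / K /\ e <= t /\ e <= L - t.
  by rewrite /e !ge_min !lexx ?orbT; do !split.
have dis (s s' : R) : `|s| < e -> `|s'| < e ->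
    intrinsic_dist (g (t + s)) (g (t + s')) = (`|s - s'|)%:E.
  rewrite !ltr_norml => hs hs'; rewrite he1; last 4 [idtac].
  - by congr (_%:E); congr (`|_|); ring.
  - by lra.
  - by lra.
  - by rewrite addrC addKr ltr_norml; lra.
  - by rewrite addrC addKr ltr_norml; lra.
have hw (s : R) : `|s| < e -> exists w : R * R,
    move ch (g t) w.1 w.2 (g (t + s)) /\ nrm w.1 w.2 = `|s|.
  move=> hs; have := dis 0 s; rewrite addr0 normr0 sub0r normrN => /(_ e0 hs) d.
  have [|u [v [m n]]] := h2 _ _ d; first exact: lt_le_trans er2.
  by exists (u, v).
have small (s : R) (w : R * R) : `|s| < e -> nrm w.1 w.2 = `|s| ->
    `|w.1| < r3 /\ `|w.2| < r3.
  move=> hs ns; have [b1 b2] := hK w.1 w.2.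
  have : K * nrm w.1 w.2 < r3.
    by rewrite ns mulrC -ltr_pdivlMr //; exact: lt_le_trans er3.
  by split; [exact: le_lt_trans b1 _|exact: le_lt_trans b2 _].
have opp (s s' : R) (w w' : R * R) : 0 < s < e -> 0 < s' < e ->
    move ch (g t) w.1 w.2 (g (t + s)) -> nrm w.1 w.2 = s ->
    move ch (g t) w'.1 w'.2 (g (t - s')) -> nrm w'.1 w'.2 = s' ->
    s' * w.1 = - (s * w'.1) /\ s' * w.2 = - (s * w'.2).
  move=> hs hs' m ns m' ns'.
  have as1 : `|s| = s by rewrite ger0_norm //; lra.
  have as1' : `|- s'| = s' by rewrite normrN ger0_norm //; lra.
  have ase : `|s| < e by rewrite as1; lra.
  have ase' : `|- s'| < e by rewrite as1'; lra.
  have [u3 v3] := small s w ase (etrans ns (esym as1)).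
  have [u3' v3'] := small (- s') w' ase' (etrans ns' (esym as1')).
  have := near_dist (h3 _ _ _ _ _ _ u3' v3' u3 v3 m' m).
  rewrite (dis _ _ ase' ase) lee_fin distrC opprK ger0_norm; last by lra.
  move=> le1; have le2 := nrm_tri nrmP w.1 w.2 (- w'.1) (- w'.2).
  rewrite nrm_opp // ns ns' in le2.
  have eq : nrm (w.1 - w'.1) (w.2 - w'.2) = nrm w.1 w.2 + nrm (- w'.1) (- w'.2).
    by rewrite nrm_opp // ns ns'; apply/eqP; rewrite eq_le le1 le2.
  by have [] := nrm_strict nrmP eq; rewrite nrm_opp // ns ns' !mulrN.
have he : `|e / 2| < e by rewrite ger0_norm; lra.
have hne : `|- (e / 2)| < e by rewrite normrN.
have [w0 [m0 n0]] := hw _ hne.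
rewrite normrN ger0_norm in n0; last by lra.
pose c := e / 2.
have c0 : 0 < c by rewrite /c; lra.
have ce : 0 < c < e by rewrite c0 /=; move: he; rewrite ger0_norm // -/c; lra.
have cn : c != 0 by rewrite gt_eqF.
exists (- w0.1 / c), (- w0.2 / c); split.
  rewrite ![_ / c]mulrC nrm_hom ?invr_ge0 ?(ltW c0) // nrm_opp // n0 -/c.
  by rewrite mulVf.
have pos (s : R) : 0 < s < e -> exists w : R * R,
    [/\ move ch (g t) w.1 w.2 (g (t + s)), nrm w.1 w.2 = s,
        w.1 = s * (- w0.1 / c) & w.2 = s * (- w0.2 / c)].
  move=> hs; have as1 : `|s| = s by rewrite ger0_norm //; lra.
  have [|w [m n]] := hw s; first by rewrite as1; lra.
  rewrite as1 in n; exists w; split=> //;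
    have [e1' e2'] := opp s c w w0 hs ce m n m0 n0.
    by apply: (mulfI cn); rewrite e1'; field.
  by apply: (mulfI cn); rewrite e2'; field.
have [wc [mc nc wc1 wc2]] := pos c ce.
exists e => // tau htau.
have [tpos|tneg|t0] := ltrgtP 0 tau.
- have [|w [m _ <- <- //]] := pos tau.
  by rewrite tpos /=; move: htau; rewrite gtr0_norm.
- have tn : 0 < - tau < e by move: htau; rewrite ltr0_norm //; lra.
  have [w [m n]] := hw tau htau; rewrite ltr0_norm // in n.
  have m' : move ch (g t) w.1 w.2 (g (t - - tau)) by rewrite opprK.
  have [e1' e2'] := opp c (- tau) wc w ce tn mc nc m' n.
  have -> : tau * (- w0.1 / c) = w.1.
    by apply: (mulfI cn); rewrite -[c * w.1]opprK -e1' wc1; field.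
  have -> : tau * (- w0.2 / c) = w.2.
    by apply: (mulfI cn); rewrite -[c * w.2]opprK -e2' wc2; field.
  by [].
- by rewrite -t0 !mul0r addr0; exact: move0.
Qed.

(** Directions at two nearby times agree because both give the same path in the
    torus. *)
Lemma straight_eq g u v u' v' t e tau : 0 < e ->
  (forall s, `|s| < e -> move ch (g t) (s * u) (s * v) (g (t + s))) ->
  `|tau| < e -> straight_at ch g u' v' (t + tau) -> u = u' /\ v = v'.
Proof.
move=> e0 he htau [e' e0' he'].
pose d := Num.min (Num.min e' (e - `|tau|))
  (Num.min (1 / (1 + `|u - u'|)) (1 / (1 + `|v - v'|))) / 2.
have d2 : 0 < d * 2 /\ [/\ d * 2 <= e', d * 2 <= e - `|tau|,
   d * 2 <= 1 / (1 + `|u - u'|) & d * 2 <= 1 / (1 + `|v - v'|)].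
  rewrite /d mulfVK // !lt_min !ge_min !lexx ?orbT e0' subr_gt0 htau.
  by rewrite !divr_gt0 // ?ltr_pwDl //.
have [d0 [d1 d3 du dv]] := d2.
have dg : 0 < d by lra.
have ad : `|d| = d by rewrite gtr0_norm.
have [p [q o]] := covered_over (cov (g t)).
have m1 := he' d; rewrite ad in m1; have {}m1 := m1 ltac:(lra).
have m2 := he (tau + d) ltac:(apply: (le_lt_trans (ler_normD _ _)); lra).
have o1 := over_move til (over_move til o (he _ htau)) m1.
have o2 := over_move til o m2; rewrite -!addrA in o1, o2.
have small w w' : d * 2 <= 1 / (1 + `|w - w'|) ->
    `|(tau + d) * w - (tau * w + d * w')| < 1.
  rewrite ler_pdivlMr ?ltr_pwDl // => h.
  have -> : (tau + d) * w - (tau * w + d * w') = d * (w - w') by ring.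
  rewrite normrM ad; have : 0 <= d * `|w - w'| by rewrite mulr_ge0 // ltW.
  lra.
have [e1 e2] := over_small til o1 o2 (small u u' du) (small v v' dv).
have fin w w' : tau * w + d * w' = (tau + d) * w -> w = w'.
  move=> h; apply: (mulfI (lt0r_neq0 dg)).
  by apply: (addrI (tau * w)); rewrite h mulrDl.
by split; apply: fin.
Qed.

Lemma geodesic_direction L (g : R -> X) : 0 < L -> geodesic L g ->
  (forall t, 0 < t < L -> regular ch (g t)) ->
  exists u v, nrm u v = 1 /\ forall t, 0 < t < L -> straight_at ch g u v t.
Proof.
move=> L0 geo reg; have h2 : 0 < L / 2 < L by lra.
have [u [v [n su]]] := geodesic_straight geo h2 (reg _ h2).
exists u, v; split=> //.
have iff s s' : 0 < s -> s <= s' -> s' < L ->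
    (straight_at ch g u v s <-> straight_at ch g u v s').
  move=> s0 ss' sL.
  apply: (@interval_chain _ (fun s s' => straight_at ch g u v s <->
    straight_at ch g u v s')) => //; first by move=> x y z _ _ _ _ -> .
  move=> t ht; have tL : 0 < t < L by lra.
  have [u' [v' [_ [e e0 he]]]] := geodesic_straight geo tL (reg t tL).
  have st : straight_at ch g u' v' t by exists e.
  pose e' := Num.min e (Num.min t (L - t)).
  exists (e / 2); first by lra.
  move=> r hr rt.
  have hrt : `|r - t| < e by lra.
  have same : straight_at ch g u v r <-> straight_at ch g u v t.
    have [u'' [v'' [_ sr]]] := geodesic_straight geo (t := r) ltac:(lra)
      (reg r ltac:(lra)).
    have er : t + (r - t) = r by ring.
    have loc w w' : straight_at ch g w w' r -> u' = w /\ v' = w'.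
      by move=> sw; apply: (straight_eq (tau := r - t) e0 he hrt); rewrite er.
    have [eu ev] := loc _ _ sr.
    split=> [/loc[<- <-] //|sw].
    have [e1 e2] : u' = u /\ v' = v.
      apply: (straight_eq (tau := 0) e0 he); rewrite ?normr0 //.
      by rewrite addr0.
    by rewrite -e1 -e2 eu ev.
  by split=> _; rewrite same.
move=> t tL; case: (leP (L / 2) t) => ht; first by apply: (iff (L / 2) t _ _ _).1 => //; lra.
by apply: (iff t (L / 2) _ _ _).2 => //; lra.
Qed.

Lemma over_straight L (g : R -> X) u v s s' p q :
  (forall t, 0 < t < L -> straight_at ch g u v t) ->
  0 < s -> s <= s' -> s' < L -> over ch (g s) p q ->
  over ch (g s') (p + (s' - s) * u) (q + (s' - s) * v).
Proof.
move=> str s0 ss' sL.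
pose P r r' := forall p q, over ch (g r) p q ->
  over ch (g r') (p + (r' - r) * u) (q + (r' - r) * v).
suff : P s s' by apply.
apply: interval_chain => //.
- by move=> x _ p' q'; rewrite subrr !mul0r !addr0.
- move=> x y z _ _ _ _ xy yz p' q' /xy /yz.
  by congr (over _ _ _ _); ring.
move=> t ht; have [e e0 he] := str t ltac:(lra).
exists e => // r hr rt; have := he _ rt; rewrite (addrC t) subrK => m.
split=> _ p' q' o; last exact: (over_move til o m).
have := over_move til o (move_opp m).
by congr (over _ _ _ _); ring.
Qed.

(** At a singular endpoint the direction is read off by letting a second point
    of the geodesic tend to the endpoint. *)
Lemma geodesic_start L (g : R -> X) u v : 0 < L -> geodesic L g ->
  nrm u v = 1 -> (forall t, 0 < t < L -> straight_at ch g u v t) ->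
  exists2 e : R, 0 < e &
    forall tau, 0 < tau < e -> move ch (g 0) (tau * u) (tau * v) (g tau).
Proof.
move=> L0 geo n1 str; have [|e1 e10 he1] := geo 0; first by lra.
have [r2 r20 h2] := dist_move (g 0).
have [K K0 hK] := nrm_bound nrmP.
pose e := Num.min (Num.min e1 r2) (Num.min (1 / (4 * K)) L).
have e0 : 0 < e by rewrite /e !lt_min e10 r20 divr_gt0 ?mulr_gt0.
have [ee1 [er2 [eK eL]]] : e <= e1 /\ e <= r2 /\ e <= 1 / (4 * K) /\ e <= L.
  by rewrite /e !ge_min !lexx ?orbT; do !split.
exists e => // tau htau.
have hw (s : R) : 0 < s < e -> exists w : R * R,
    [/\ move ch (g 0) w.1 w.2 (g s), `|w.1| <= K * s & `|w.2| <= K * s].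
  move=> hs; have d : intrinsic_dist (g 0) (g s) = s%:E.
    rewrite he1 ?sub0r ?normrN ?subr0 ?normr0 ?gtr0_norm //; lra.
  have [|a1 [a2 [m n]]] := h2 _ _ d; first by lra.
  by exists (a1, a2); have := hK a1 a2; rewrite n => -[].
have [w [m b1 b2]] := hw tau htau.
have Ks (s : R) : s < e -> K * s < 1 / 4.
  move=> hs; rewrite mulrC -ltr_pdivlMr //; apply: (lt_le_trans hs).
  by apply: (le_trans eK); rewrite invfM mulrA.
have [p [q o]] := covered_over (cov (g 0)).
have [bu bv] := hK u v; rewrite n1 mulr1 in bu bv.
have step (s : R) : 0 < s < tau -> exists w' : R * R,
    [/\ `|w'.1| <= K * s, `|w'.2| <= K * s,
        w.1 = w'.1 + (tau - s) * u & w.2 = w'.2 + (tau - s) * v].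
  move=> hs; have hse : 0 < s < e by lra.
  have [w' [m' b1' b2']] := hw s hse; exists w'.
  have o1 := over_straight str (s := s) (s' := tau) ltac:(lra) ltac:(lra)
    ltac:(lra) (over_move til o m').
  have o2 := over_move til o m; rewrite -!addrA in o1, o2.
  have st (x x' y : R) : `|x| <= K * tau -> `|x'| <= K * s -> `|y| <= K ->
      `|x - (x' + (tau - s) * y)| < 1.
    move=> hx hx' hy.
    have ks := Ks s (andP hse).2; have kt := Ks tau (andP htau).2.
    have : `|(tau - s) * y| <= (tau - s) * K.
      have ts : 0 <= tau - s by lra.
      by rewrite normrM ger0_norm // ler_wpM2l.
    have := ler_normB x (x' + (tau - s) * y).
    have := ler_normD x' ((tau - s) * y).
    lra.
  by have [e1' e2'] := over_small til o1 o2 (st _ _ _ b1 b1' bu) (st _ _ _ b2 b2' bv).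
have lim (x y : R) : `|y| <= K -> (forall s, 0 < s < tau -> exists2 x',
    `|x'| <= K * s & x = x' + (tau - s) * y) -> tau * y = x.
  move=> hy hx; apply/eqP; rewrite -subr_eq0 -normr_le0; apply/ler_addgt0Pl => d d0.
  pose s := Num.min (tau / 2) (d / (2 * K)).
  have s0 : 0 < s by rewrite /s lt_min !divr_gt0 ?mulr_gt0 //; lra.
  have st : s <= tau / 2 by rewrite /s ge_min lexx.
  have sd : s * (2 * K) <= d.
    by rewrite -ler_pdivlMr ?mulr_gt0 // /s ge_min lexx orbT.
  have [|x' hx' ->] := hx s; first by lra.
  have -> : tau * y - (x' + (tau - s) * y) = s * y - x' by ring.
  apply: (le_trans (ler_normB _ _)); rewrite normrM gtr0_norm //.
  have : s * `|y| <= s * K by rewrite ler_wpM2l // ltW.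
  lra.
rewrite (lim w.1 u bu) ?(lim w.2 v bv) //.
  by move=> s /step[w' [_ ? _ ->]]; exists w'.2.
by move=> s /step[w' [? _ -> _]]; exists w'.1.
Qed.

Lemma geodesic_rev L (g : R -> X) : geodesic L g ->
  geodesic L (fun s => g (L - s)).
Proof.
move=> geo t tL; have [|e e0 he] := geo (L - t); first by lra.
exists e => // s s' hs hs' st st'; rewrite he; [|lra|lra| |].
- by rewrite (_ : L - s - (L - s') = - (s - s')) ?normrN //; ring.
- by rewrite (_ : L - s - (L - t) = - (s - t)) ?normrN //; ring.
- by rewrite (_ : L - s' - (L - t) = - (s' - t)) ?normrN //; ring.
Qed.

Lemma straight_rev L (g : R -> X) u v t : straight_at ch g u v (L - t) ->
  straight_at ch (fun s => g (L - s)) (- u) (- v) t.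
Proof.
move=> [e e0 he]; exists e => // s hs; have := he (- s); rewrite normrN => /(_ hs).
rewrite !mulNr !mulrN (_ : L - t - s = L - (t + s)) //; ring.
Qed.

(** In the torus the path is a line segment with equal endpoints, so its
    displacement is an integer vector. The endpoints may be singular; there the
    direction comes from [geodesic_start], applied in both time directions. *)
Theorem closed_geodesic_straight L (g : R -> X) : 0 < L -> geodesic L g ->
  (forall t, 0 < t < L -> regular ch (g t)) -> g 0 = g L ->
  exists u v : R, exists m n : int,
    [/\ L * u = m%:~R, L * v = n%:~R, (m != 0) || (n != 0) &
     [/\ forall t, 0 < t < L -> straight_at ch g u v t,
         exists2 e : R, 0 < e & forall tau, 0 < tau < e ->
           move ch (g 0) (tau * u) (tau * v) (g tau) &
         exists2 e : R, 0 < e & forall tau, 0 < tau < e ->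
           move ch (g (L - tau)) (tau * u) (tau * v) (g L)]].
Proof.
move=> L0 geo reg clo.
have [u [v [n1 str]]] := geodesic_direction L0 geo reg.
have [e e0 he] := geodesic_start L0 geo n1 str.
have [|t tL|e' e0' he'] := geodesic_start (u := - u) (v := - v) L0 (geodesic_rev geo).
- by rewrite nrm_opp.
- by apply: straight_rev; apply: str; lra.
have {}he' tau : 0 < tau < e' ->
    move ch (g (L - tau)) (tau * u) (tau * v) (g L).
  by move=> /he' m; have := move_opp m; rewrite subr0 !mulrN !opprK.
have [p [q o]] := covered_over (cov (g 0)).
pose d := Num.min (Num.min e e') L / 2.
have d2 : 0 < d * 2 /\ [/\ d * 2 <= e, d * 2 <= e' & d * 2 <= L].
  by rewrite /d mulfVK // !lt_min !ge_min !lexx ?orbT e0 e0'.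
have [d0 [de de' dL]] := d2.
have o1 := over_move til o (he d ltac:(lra)).
have o2 := over_straight str (s := d) (s' := L - d) ltac:(lra) ltac:(lra)
  ltac:(lra) o1.
have o3 := over_move til o2 (he' d ltac:(lra)).
have {}o3 : over ch (g 0) (p + L * u) (q + L * v).
  by move: o3; rewrite -clo; congr (over _ _ _ _); ring.
have [m [n [/addrI em /addrI en]]] := over_unique til o o3.
exists u, v, m, n; split=> //; last by split; [|exists e|exists e'].
apply/negPn/negP; rewrite negb_or !negbK => /andP[/eqP m0 /eqP n0].
move: em en; rewrite m0 n0 => /eqP; rewrite mulf_eq0 (gt_eqF L0) => /eqP u0.
move=> /eqP; rewrite mulf_eq0 (gt_eqF L0) => /eqP v0.
by move: n1; rewrite u0 v0 nrm0 => /esym/eqP; rewrite oner_eq0.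
Qed.

End Geodesics.

(** * Closed straight paths and Euclid's algorithm *)

Section Families.
Variables (R : realType) (N : nat) (X : Type) (ch : 'I_N -> R -> R -> X).
Variables (a0 b0 : {perm 'I_N}).
Hypothesis til : tiling a0 b0 ch.

(** [M] maps coordinates with respect to the basis [(e, f)] to the surface in
    such a way that, near [(s, t)], coordinates change by displacements. *)
Definition developing (M : R -> R -> X) (e f : R * R) s t :=
  exists2 r : R, 0 < r & forall u v, `|u| < r -> `|v| < r ->
    move ch (M s t) (u * e.1 + v * f.1) (u * e.2 + v * f.2) (M (s + u) (t + v)).

(** A cell extended by its neighbour on the right. *)
Definition glue_right (P : 'I_N -> R -> R -> X) (c : {perm 'I_N}) i s t :=
  if s <= 1 then P i s t else P (c i) (s - 1) t.

Definition glue_top (P : 'I_N -> R -> R -> X) (c : {perm 'I_N}) i s t :=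
  if t <= 1 then P i s t else P (c i) s (t - 1).

(** The surface tiled by parallelograms with sides [e] and [f]. Their sides may
    pass through the interior of squares, so that [P] must be developing across
    the common sides, and not only in the interior. [fam_sector] describes the
    way paths leave a vertex in a direction between [e] and [f], and [fam_end]
    the way they arrive at the opposite corner. *)
Record family P (c d : {perm 'I_N}) (e f : R * R) : Prop := Family {
  fam_glue : glued_family c d P;
  fam_in : forall i s t, 0 < s < 1 -> 0 < t < 1 -> developing (P i) e f s t;
  fam_right : forall i t, 0 < t < 1 -> developing (glue_right P c i) e f 1 t;
  fam_top : forall i s, 0 < s < 1 -> developing (glue_top P d i) e f s 1;
  fam_0 : forall i, P i 0 0 = ch i 0 0;
  fam_sector : exists2 r : R, 0 < r & forall x y u v, 0 <= u < r -> 0 <= v < r ->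
    (exists i, x = ch i 0 0) ->
    move ch x (u * e.1 + v * f.1) (u * e.2 + v * f.2) y ->
    exists i, x = P i 0 0 /\ y = P i u v;
  fam_end : exists2 r : R, 0 < r & forall i u v, 0 <= u < r -> 0 <= v < r ->
    move ch (P i (1 - u) (1 - v)) (u * e.1 + v * f.1) (u * e.2 + v * f.2)
      (P i 1 1);
  fam_turn : turn c d = turn a0 b0 \/ turn c d = ((turn a0 b0)^-1)%g
}.

Lemma base_family : family ch a0 b0 (1, 0) (0, 1).
Proof.
have [gh gv] := til.1.
split=> //=; last by left.
- move=> i s t hs ht.
  exists (Num.min (Num.min s (1 - s)) (Num.min t (1 - t))).
    by rewrite !lt_min; lra.
  move=> u v; rewrite !lt_min !ltr_norml => hu hv.
  by exists i, s, t; rewrite !mulr1 !mulr0 addr0 add0r /in01; split=> //; split; lra.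
- move=> i t ht; exists (Num.min 1 (Num.min t (1 - t))).
    by rewrite !lt_min; lra.
  move=> u v; rewrite !lt_min !ltr_norml => hu hv.
  rewrite /glue_right lexx !mulr1 !mulr0 addr0 add0r; case: leP => u0.
    by exists i, 1, t; rewrite /in01; split=> //; split; lra.
  rewrite gh; last by rewrite /in01; lra.
  exists (a0 i), 0, t; rewrite add0r addrAC subrr add0r /in01; split=> //.
  split; lra.
- move=> i s hs; exists (Num.min 1 (Num.min s (1 - s))).
    by rewrite !lt_min; lra.
  move=> u v; rewrite !lt_min !ltr_norml => hu hv.
  rewrite /glue_top lexx !mulr1 !mulr0 addr0 add0r; case: leP => u0.
    by exists i, s, 1; rewrite /in01; split=> //; split; lra.
  rewrite gv; last by rewrite /in01; lra.
  exists (b0 i), s, 0; rewrite add0r addrAC subrr add0r /in01; split=> //.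
  split; lra.
- exists 1 => // x y u v /andP[u0 _] /andP[v0 _] [k ek].
  rewrite !mulr1 !mulr0 addr0 add0r => /(move_normal til u0 v0).
  move=> [i [s [t [[hs ht _ _] [ex ey]]]]].
  have [es et _ _] := chart_base til hs ht (zero_ico R) (zero_ico R)
    (etrans (esym ex) ek).
  by exists i; rewrite ex ey es et !add0r.
- exists 1 => // i u v hu hv; exists i, (1 - u), (1 - v).
  rewrite !mulr1 !mulr0 addr0 add0r !subrK /in01; split=> //; split; lra.
Qed.

Lemma swap_family P c d e f : family P c d e f ->
  family (swap_chart P) d c f e.
Proof.
have dev_swap M s t : developing M e f s t ->
    developing (fun s t => M t s) f e t s.
  move=> [r r0 h]; exists r => // u v hu hv.
  by rewrite ![u * _ + _]addrC; exact: h.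
case=> g fin fr ft f0 [r r0 sec] [r' r0' en] tu; split.
- exact: glued_swap.
- by move=> i s t hs ht; apply/dev_swap/fin.
- by move=> i t ht; apply/dev_swap/ft.
- by move=> i s hs; apply/dev_swap/fr.
- exact: f0.
- exists r => // x y u v hu hv hx; rewrite ![u * _ + _]addrC.
  exact: sec.
- by exists r' => // i u v hu hv; rewrite ![u * _ + _]addrC; exact: en.
- by rewrite turn_swap; case: tu => ->; [right|left; rewrite invgK].
Qed.

Lemma developing_shear M M' e f s t s' t' : developing M e f s t ->
  (exists2 r : R, 0 < r & forall u v, `|u| < r -> `|v| < r ->
     M' (s' + u) (t' + v) = M (s + (u + v)) (t + v)) ->
  developing M' e (e.1 + f.1, e.2 + f.2) s' t'.
Proof.
move=> [r r0 h] [r' r0' eM].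
exists (Num.min (r / 2) r'); first by rewrite lt_min r0' divr_gt0.
move=> u v; rewrite !lt_min => /andP[ur ur'] /andP[vr vr'].
have -> : M' s' t' = M s t.
  by have := eM 0 0; rewrite normr0 !addr0; apply.
rewrite eM // /= (_ : u * e.1 + v * (e.1 + f.1) = (u + v) * e.1 + v * f.1);
  last by ring.
rewrite (_ : u * e.2 + v * (e.2 + f.2) = (u + v) * e.2 + v * f.2); last by ring.
by apply: h; [apply: (le_lt_trans (ler_normD _ _)); lra|lra].
Qed.

Lemma developing_local M M' e f s t s' t' : developing M e f s t ->
  (exists2 r : R, 0 < r & forall u v, `|u| < r -> `|v| < r ->
     M' (s' + u) (t' + v) = M (s + u) (t + v)) ->
  developing M' e f s' t'.
Proof.
move=> [r r0 h] [r' r0' eM].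
exists (Num.min r r'); first by rewrite lt_min r0 r0'.
move=> u v; rewrite !lt_min => /andP[ur ur'] /andP[vr vr'].
have -> : M' s' t' = M s t.
  by have := eM 0 0; rewrite normr0 !addr0; apply.
by rewrite eM //; exact: h.
Qed.

Lemma glue_right_developing P c d e f i s t : family P c d e f ->
  0 < s < 2 -> 0 < t < 1 -> developing (glue_right P c i) e f s t.
Proof.
move=> fam hs ht; have [s1|s1|->] := ltrgtP s 1; last exact: fam_right fam _ _ ht.
- apply: (developing_local (fam_in fam i (s := s) (t := t) _ ht)); first by lra.
  exists (1 - s); first by lra.
  move=> u v; rewrite ltr_norml => hu _; rewrite /glue_right ifT //; lra.
- apply: (developing_local (fam_in fam (c i) (s := s - 1) (t := t) _ ht)).
    by lra.
  exists (s - 1); first by lra.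
  move=> u v; rewrite ltr_norml => hu _; rewrite /glue_right ifF 1?addrAC //.
  by apply/negbTE; rewrite -ltNge; lra.
Qed.

(** Each new parallelogram is the union of two triangles of adjacent old
    ones. *)
Definition shear_chart (P : 'I_N -> R -> R -> X) c i s t :=
  glue_right P c i (s + t) t.

Lemma shear_family P c d e f : family P c d e f ->
  family (shear_chart P c) c (c * d)%g e (e.1 + f.1, e.2 + f.2).
Proof.
move=> fam; have [gc gd] := fam_glue fam.
split.
- split=> i s hs; rewrite /shear_chart /glue_right.
  + rewrite add0r (_ : s <= 1); last by case/andP: hs.
    case: leP => h; last by congr (P _ _ _); ring.
    have -> : s = 0 by move: hs; rewrite /in01; lra.
    by rewrite addr0 gc.
  + rewrite addr0 (_ : s <= 1); last by case/andP: hs.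
    rewrite permM; case: leP => h; last by rewrite addrK gd.
    have -> : s = 0 by move: hs; rewrite /in01; lra.
    by rewrite add0r gc // gd.
- move=> i s t hs ht.
  apply: (developing_shear (glue_right_developing i (s := s + t) (t := t) fam _ ht)).
    by lra.
  exists 1 => // u v _ _; rewrite /shear_chart.
  by rewrite (_ : s + u + (t + v) = s + t + (u + v)) //; ring.
- move=> i t ht.
  apply: (developing_shear (fam_in fam (c i) (s := t) (t := t) ht ht)).
  exists (Num.min (t / 2) ((1 - t) / 2)); first by rewrite lt_min; lra.
  move=> u v; rewrite !lt_min !ltr_norml => hu hv.
  rewrite {1}/glue_right /shear_chart /glue_right; case: leP => u0.
    rewrite ifF; last by apply/negbTE; rewrite -ltNge; lra.
    by congr (P _ _ _); ring.
  rewrite ifT; last by lra.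
  by congr (P _ _ _); ring.
- move=> i s hs.
  apply: (developing_shear (fam_top fam (c i) (s := s) hs)).
  exists (Num.min (s / 2) ((1 - s) / 2)); first by rewrite lt_min; lra.
  move=> u v; rewrite !lt_min !ltr_norml => hu hv.
  rewrite /glue_top /shear_chart /glue_right permM; case: leP => u0.
    rewrite ifF; last by apply/negbTE; rewrite -ltNge; lra.
    by congr (P _ _ _); ring.
  rewrite ifT; last by lra.
  by congr (P _ _ _); ring.
- by move=> i; rewrite /shear_chart /glue_right addr0 ler01 (fam_0 fam).
- have [r r0 sec] := fam_sector fam.
  exists (Num.min (r / 2) (1 / 2)); first by rewrite lt_min; lra.
  move=> x y u v; rewrite !lt_min /= => hu hv hx.
  rewrite (_ : u * e.1 + v * (e.1 + f.1) = (u + v) * e.1 + v * f.1); last by ring.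
  rewrite (_ : u * e.2 + v * (e.2 + f.2) = (u + v) * e.2 + v * f.2); last by ring.
  move=> /sec[||//|i [-> ->]]; [lra|lra|exists i].
  by rewrite /shear_chart /glue_right addr0 ler01 ifT //; lra.
- have [r r0 en] := fam_end fam.
  exists (Num.min (r / 2) (1 / 2)); first by rewrite lt_min; lra.
  move=> i u v; rewrite !lt_min /= => hu hv.
  rewrite (_ : u * e.1 + v * (e.1 + f.1) = (u + v) * e.1 + v * f.1); last by ring.
  rewrite (_ : u * e.2 + v * (e.2 + f.2) = (u + v) * e.2 + v * f.2); last by ring.
  rewrite /shear_chart /glue_right !ifF; first last.
  + by apply/negbTE; rewrite -ltNge; lra.
  + by apply/negbTE; rewrite -ltNge; lra.
  rewrite addrK (_ : 1 - u + (1 - v) - 1 = 1 - (u + v)); last by ring.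
  by apply: en; lra.
- by rewrite turn_shear; exact: fam_turn fam.
Qed.

(** Subtracting the smaller of [m] and [n] from the larger one is a shear. *)
Lemma family_along P c d e f (m n : nat) : family P c d e f -> (0 < m + n)%N ->
  exists P' c' d' e' f' k, [/\ family P' c' d' e' f', reach c d c' d', (0 < k)%N,
    k%:R * e'.1 = m%:R * e.1 + n%:R * f.1 &
    k%:R * e'.2 = m%:R * e.2 + n%:R * f.2].
Proof.
move: {2}(m + n)%N (leqnn (m + n)) => k.
elim: k P c d e f m n => [|k IH] P c d e f m n; first by lia.
wlog nm : P c d e f m n / (n <= m)%N.
  move=> W mnk fam mn; case: (leqP n m) => nm; first exact: (W P c d e f m n).
  have [|||P' [c' [d' [e' [f' [l [fam' r l0 e1 e2]]]]]]] :=
    W _ _ _ _ _ n m _ _ (swap_family fam); [lia|lia|lia|].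
  exists P', c', d', e', f', l; split=> //.
  - by apply: reach_trans r; exact: ReachSwap (ReachRefl _ _).
  - by rewrite e1 addrC.
  - by rewrite e2 addrC.
case: (posnP n) => [->|n0] mnk fam mn.
  exists P, c, d, e, f, m; split=> //; first exact: ReachRefl.
  - by move: mn; rewrite addn0.
  - by rewrite mul0r addr0.
  - by rewrite mul0r addr0.
have [||P' [c' [d' [e' [f' [l [fam' r l0 e1 e2]]]]]]] :=
  IH _ _ _ _ _ (m - n)%N n _ (shear_family fam); [lia|lia|].
exists P', c', d', e', f', l; split=> //.
- by apply: reach_trans r; exact: ReachShear (ReachRefl _ _).
- by rewrite e1 /= natrB //; ring.
- by rewrite e2 /= natrB //; ring.
Qed.

Lemma bottom_straight P c d e f i s : family P c d e f -> 0 < s < 1 ->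
  exists2 r : R, 0 < r & forall u, `|u| < r ->
    move ch (P i s 0) (u * e.1) (u * e.2) (P i (s + u) 0).
Proof.
move=> fam hs; have [_ gd] := fam_glue fam.
have [r r0 h] := fam_top fam ((d^-1)%g i) hs.
exists (Num.min r (Num.min s (1 - s))); first by rewrite !lt_min r0; lra.
move=> u; rewrite !lt_min => /andP[ur us].
have := h u 0 ur; rewrite normr0 => /(_ r0); rewrite !mul0r !addr0 /glue_top lexx.
by rewrite !gd ?permKV //; move: us; rewrite !ltr_norml /in01; lra.
Qed.

Lemma bottom_end P c d e f i : family P c d e f ->
  exists2 r : R, 0 < r & forall u, 0 <= u < r ->
    move ch (P i (1 - u) 0) (u * e.1) (u * e.2) (P i 1 0).
Proof.
move=> fam; have [_ gd] := fam_glue fam.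
have [r r0 h] := fam_end fam.
exists (Num.min r 1); first by rewrite !lt_min r0 ltr01.
move=> u; rewrite !lt_min => hu.
have := h ((d^-1)%g i) u 0; rewrite lexx r0 => /(_ ltac:(lra) isT).
rewrite !mul0r !addr0 subr0.
by rewrite !gd ?permKV //; rewrite /in01; lra.
Qed.

Section Path.
Variables (L : R) (g : R -> X) (u v : R).
Hypothesis L0 : 0 < L.
Hypothesis reg : forall t, 0 < t < L -> regular ch (g t).
Hypothesis str : forall t, 0 < t < L -> straight_at ch g u v t.
Hypothesis start : exists2 e : R, 0 < e & forall tau, 0 < tau < e ->
  move ch (g 0) (tau * u) (tau * v) (g tau).
Hypothesis arrive : exists2 e : R, 0 < e & forall tau, 0 < tau < e ->
  move ch (g (L - tau)) (tau * u) (tau * v) (g L).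

Lemma leaving S : 0 <= S < L -> exists2 e : R, 0 < e & forall tau, 0 < tau < e ->
  move ch (g S) (tau * u) (tau * v) (g (S + tau)).
Proof.
move=> hS; have [->|Sn] := eqVneq S 0.
  by have [e e0 h] := start; exists e => // tau; rewrite add0r; exact: h.
have [|e e0 h] := str (t := S); first by lra.
by exists e => // tau htau; apply: h; rewrite gtr0_norm; lra.
Qed.

Lemma arriving S : 0 < S <= L -> exists2 e : R, 0 < e & forall tau, 0 < tau < e ->
  move ch (g (S - tau)) (tau * u) (tau * v) (g S).
Proof.
move=> hS; have [->|Sn] := eqVneq S L; first exact: arrive.
have [|e e0 h] := str (t := S); first by lra.
exists e => // tau htau; have m := h (- tau).
have := move_opp (m _); rewrite -!mulNr opprK; apply.
by rewrite normrN gtr0_norm; lra.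
Qed.

(** By unique continuation through regular points, a straight path in direction
    [e] that agrees at one time with a lower side runs along all of it. *)
Lemma follow_edge P c d e f i S T s0 : family P c d e f -> 0 < T -> 0 <= S ->
  S + T <= L -> T * u = e.1 -> T * v = e.2 -> 0 < s0 < T ->
  g (S + s0) = P i (s0 / T) 0 -> g (S + T) = P i 1 0.
Proof.
move=> fam T0 S0 STL e1 e2 hs0 gs0.
have scale (s : R) (w : R) : s / T * (T * w) = s * w by rewrite mulrA divfK ?gt_eqF.
have ins s : 0 < s < T -> 0 < s / T < 1.
  by move=> hs; rewrite divr_gt0 ?ltr_pdivrMr //; lra.
pose Q s := g (S + s) = P i (s / T) 0.
have iff s s' : 0 < s -> s <= s' -> s' < T -> (Q s <-> Q s').
  move=> hs ss' hs'; apply: (@interval_chain _ (fun s s' => Q s <-> Q s')) => //.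
    by move=> x y z _ _ _ _ -> .
  move=> t ht; have [|r1 r10 h1] := str (t := S + t); first by lra.
  have [|r2 r20 h2] := bottom_straight (s := t / T) i fam; first by apply: ins; lra.
  exists (Num.min r1 (r2 * T)); first by rewrite lt_min r10 mulr_gt0.
  move=> r hr; rewrite lt_min => /andP[rt1 rt2].
  have m1 := h1 _ rt1; have := h2 ((r - t) / T).
  rewrite normrM normfV (gtr0_norm T0) ltr_pdivrMr // => /(_ rt2).
  rewrite -mulrDl [t + _]addrC subrK -e1 -e2 !scale => m2.
  have er : S + t + (r - t) = S + r by ring.
  rewrite er in m1.
  suff : Q r <-> Q t by move=> h; split=> _; rewrite h.
  split=> h.
    have m2' := move_opp m2; rewrite -h in m2'.
    exact: (move_unique til (reg (t := S + r) ltac:(lra)) (move_opp m1) m2').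
  rewrite -h in m2.
  exact: (move_unique til (reg (t := S + t) ltac:(lra)) m1 m2).
have all s : 0 < s < T -> Q s.
  move=> hs; case: (leP s0 s) => h.
    by apply: (iff s0 s _ _ _).1 => //; lra.
  by apply: (iff s s0 _ _ _).2 => //; lra.
have [|r1 r10 h1] := arriving (S := S + T); first by lra.
have [r2 r20 h2] := bottom_end i fam.
pose t := Num.min (Num.min r1 (r2 * T)) T / 2.
have t2 : 0 < t * 2 /\ [/\ t * 2 <= r1, t * 2 <= r2 * T & t * 2 <= T].
  by rewrite /t divfK // !lt_min !ge_min !lexx ?orbT r10 T0 mulr_gt0.
have [t0 [t1 t3 tT]] := t2.
have m1 := h1 t ltac:(lra).
have tr : 0 <= t / T < r2.
  by rewrite ltr_pdivrMr // divr_ge0 ?(ltW T0) //=; lra.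
have m2 := h2 _ tr.
have q : Q (T - t) by apply: all; lra.
rewrite -e1 -e2 !scale in m2.
have eq : 1 - t / T = (T - t) / T by rewrite mulrBl divff ?gt_eqF.
rewrite eq -q addrA in m2.
exact: (move_unique til (reg (t := S + T - t) ltac:(lra)) m1 m2).
Qed.

Lemma path_closed_orbit P c d e f k : family P c d e f -> (0 < k)%N ->
  L * u = k%:R * e.1 -> L * v = k%:R * e.2 -> (exists i, g 0 = ch i 0 0) ->
  ~ regular ch (g 0) -> g 0 = g L -> exists i, closed_orbit c d i k.
Proof.
move=> fam k0 eu ev vert sing clo.
have kR : 0 < k%:R :> R by rewrite ltr0n.
pose T := L / k%:R; have T0 : 0 < T by rewrite divr_gt0.
have kT : k%:R * T = L by rewrite mulrC divfK ?gt_eqF.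
have e1 : T * u = e.1.
  by rewrite /T mulrAC eu mulrAC divff ?mul1r ?gt_eqF.
have e2 : T * v = e.2.
  by rewrite /T mulrAC ev mulrAC divff ?mul1r ?gt_eqF.
clearbody T; have [r r0 sec] := fam_sector fam.
have scale (s w : R) : s / T * (T * w) = s * w by rewrite mulrA divfK ?gt_eqF.
have go S : 0 <= S < L -> (exists i, g S = ch i 0 0) -> exists j s0,
    [/\ g S = ch j 0 0, 0 < s0 < T & g (S + s0) = P j (s0 / T) 0].
  move=> hS vS; have [e' e0' h] := leaving hS.
  pose t := Num.min (Num.min e' (r * T)) T / 2.
  have t2 : 0 < t * 2 /\ [/\ t * 2 <= e', t * 2 <= r * T & t * 2 <= T].
    by rewrite /t divfK // !lt_min !ge_min !lexx ?orbT e0' T0 mulr_gt0.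
  have [t0 [t1 t3 tT]] := t2.
  have m := h t ltac:(lra).
  have tr : 0 <= t / T < r.
    by rewrite ltr_pdivrMr // divr_ge0 ?(ltW T0) //=; lra.
  have := sec (g S) (g (S + t)) (t / T) 0 tr; rewrite lexx r0.
  rewrite -e1 -e2 !scale !mul0r !addr0.
  move=> /(_ isT vS m)[j [gS gSt]].
  by exists j, t; rewrite -(fam_0 fam); split=> //; lra.
have kT_lt l : (l < k)%N -> 0 <= l%:R * T < L.
  move=> lk; rewrite -kT ltr_pM2r // ltr_nat lk andbT.
  by rewrite mulr_ge0 // ltW.
have kTS l : l.+1%:R * T = l%:R * T + T by rewrite -natr1 mulrDl mul1r.
have [i [s0 [g0 hs0 gs0]]] := go 0 ltac:(rewrite lexx L0 //) vert.
have step l : (l <= k)%N -> g (l%:R * T) = ch ((c ^+ l)%g i) 0 0 /\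
   ((l < k)%N -> exists2 s, 0 < s < T &
      g (l%:R * T + s) = P ((c ^+ l)%g i) (s / T) 0).
  elim: l => [_|l IH lk].
    by rewrite mul0r expg0 perm1; split=> // _; exists s0.
  have [gl /(_ lk)[s hs gls]] := IH (ltnW lk).
  have gl1 : g (l.+1%:R * T) = ch ((c ^+ l.+1)%g i) 0 0.
    have [gc _] := fam_glue fam.
    rewrite kTS (follow_edge fam T0 _ _ e1 e2 hs gls); last 2 first.
    - by case/andP: (kT_lt _ lk).
    - by rewrite -kTS -kT ler_pM2r // ler_nat.
    by rewrite gc // (fam_0 fam) expgSr permM.
  split=> // lk1.
  have [j [s1 [gj hs1 gs1]]] := go _ (kT_lt _ lk1) (ex_intro _ _ gl1).
  have rl : regular ch (g (l.+1%:R * T)).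
    by apply: reg; have := kT_lt _ lk1; rewrite lt_def mulr_gt0 ?ltr0n //; lra.
  by rewrite -(rl _ _ (esym gj) (esym gl1)); exists s1.
have turn_iff x : (turn c d x = x) <-> (turn a0 b0 x = x).
  case: (fam_turn fam) => ->; first by [].
  by split=> {1}<-; rewrite ?permK ?permKV.
have porb : porbit (turn c d) =1 porbit (turn a0 b0).
  by move=> x; case: (fam_turn fam) => ->; rewrite ?porbitV.
have [gk _] := step k (leqnn k).
have ek : ch ((c ^+ k)%g i) 0 0 = ch i 0 0 by rewrite -gk -g0 kT clo.
exists i; split=> //.
- move/turn_iff => ti; apply: sing => j j' hj hj'.
  have one x : ch x 0 0 = g 0 -> x = i.
    move=> hx; have [_ _ + _] := chart_base til (zero_ico R) (zero_ico R)
      (zero_ico R) (zero_ico R) (etrans (esym g0) (esym hx)).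
    case/porbitP=> l ->; elim: l => [|l IH]; first by rewrite expg0 perm1.
    by rewrite expgSr permM IH.
  by rewrite (one _ hj) (one _ hj').
- move=> l /andP[l0 lk]; apply/turn_iff; have [gl _] := step l (ltnW lk).
  apply: (regular_turn til); rewrite -gl; apply: reg.
  by have := kT_lt _ lk; rewrite lt_def mulr_gt0 ?ltr0n //; lra.
- rewrite porb; have [_ _ -> _] := chart_base til (zero_ico R) (zero_ico R)
    (zero_ico R) (zero_ico R) (esym ek).
  by [].
Qed.

End Path.
End Families.

Section Loops.
Variables (R : realType) (N : nat) (X : Type) (L : R) (g : R -> X).
Implicit Types (a b : {perm 'I_N}) (ch : 'I_N -> R -> R -> X).

Record straight_loop ch u v : Prop := StraightLoop {
  loop_length : 0 < L;
  loop_regular : forall t, 0 < t < L -> regular ch (g t);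
  loop_straight : forall t, 0 < t < L -> straight_at ch g u v t;
  loop_start : exists2 e : R, 0 < e & forall tau, 0 < tau < e ->
    move ch (g 0) (tau * u) (tau * v) (g tau);
  loop_arrive : exists2 e : R, 0 < e & forall tau, 0 < tau < e ->
    move ch (g (L - tau)) (tau * u) (tau * v) (g L);
  loop_vertex : exists i, g 0 = ch i 0 0;
  loop_singular : ~ regular ch (g 0);
  loop_closed : g 0 = g L
}.

Lemma loop_swap ch u v : straight_loop ch u v ->
  straight_loop (swap_chart ch) v u.
Proof.
case=> L0 reg str [e e0 he] [e' e0' he'] vert sing clo; split=> //.
- move=> t /str[d d0 hd]; exists d => // s hs; exact: move_swap (hd s hs).
- by exists e => // s hs; exact: move_swap (he s hs).
- by exists e' => // s hs; exact: move_swap (he' s hs).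
Qed.

Lemma loop_flip a b ch u v : tiling a b ch -> straight_loop ch u v ->
  straight_loop (flip_chart ch) (- u) v.
Proof.
move=> til [L0 reg str [e e0 he] [e' e0' he'] [i vert] sing clo].
have [gh _] := til.1.
have corner j : flip_chart ch ((a^-1)%g j) 0 0 = ch j 0 0.
  by rewrite /flip_chart subr0 gh // permKV.
split=> //.
- by move=> t /reg; exact: regular_flip til.1.
- move=> t /str[d d0 hd]; exists d => // s hs.
  by rewrite mulrN; exact: move_flip (hd s hs).
- by exists e => // s hs; rewrite mulrN; exact: move_flip (he s hs).
- by exists e' => // s hs; rewrite mulrN; exact: move_flip (he' s hs).
- by exists ((a^-1)%g i); rewrite corner.
- move=> r; apply: sing => j k hj hk; apply: (@perm_inj _ (a^-1)%g).
  by apply: r; rewrite corner.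
Qed.

Lemma loop_orbit_nat a b ch u v (m n : nat) : tiling a b ch ->
  straight_loop ch u v -> L * u = m%:R -> L * v = n%:R -> (0 < m + n)%N ->
  exists c d i k, reach a b c d /\ closed_orbit c d i k.
Proof.
move=> til [L0 reg str st ar vert sing clo] eu ev mn.
have [P [c [d [e [f [k [fam r k0 e1 e2]]]]]]] := family_along (base_family til) mn.
rewrite /= !mulr0 !mulr1 ?addr0 ?add0r in e1 e2.
have [|| i ci] := path_closed_orbit til L0 reg str st ar fam k0 _ _ vert sing clo.
- by rewrite eu e1.
- by rewrite ev e2.
by exists c, d, i, k.
Qed.

Lemma loop_orbit a b ch u v (m n : int) : tiling a b ch ->
  straight_loop ch u v -> L * u = m%:~R -> L * v = n%:~R ->
  (m != 0) || (n != 0) ->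
  exists c d i k, reach a b c d /\ closed_orbit c d i k.
Proof.
wlog m0 : a b ch u m / 0 <= m.
  move=> W til lo eu ev mn; case: (leP 0 m) => m0; first exact: (W a b ch u m).
  have [|||c [d [i [k [r ci]]]]] := W _ _ _ _ (- m) _ (tiling_flip til)
    (loop_flip til lo) _ ev.
  - by rewrite oppr_ge0 ltW.
  - by rewrite mulrN eu mulrNz.
  - by rewrite oppr_eq0.
  by exists c, d, i, k; split=> //; apply: reach_trans r; exact/ReachFlip/ReachRefl.
wlog n0 : a b ch v n / 0 <= n.
  move=> W til lo eu ev mn; case: (leP 0 n) => n0; first exact: (W a b ch v n).
  have til' := tiling_swap til; have lo' := loop_swap lo.
  have [|||c [d [i [k [r ci]]]]] := W _ _ _ _ (- n) _
    (tiling_swap (tiling_flip til')) (loop_swap (loop_flip til' lo')) eu.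
  - by rewrite oppr_ge0 ltW.
  - by rewrite mulrN ev mulrNz.
  - by rewrite oppr_eq0.
  exists c, d, i, k; split=> //; apply: reach_trans r.
  by apply/ReachSwap/ReachFlip/ReachSwap/ReachRefl.
case: m m0 => // m _; case: n n0 => // n _ til lo eu ev mn.
by apply: (loop_orbit_nat til lo (m := m) (n := n)) => //; move: mn; lia.
Qed.

End Loops.

(** The metric may be generated by other segments than those contained in a
    cell, as long as both kinds give the same distances: the faces of Octa-8 are
    halves of cells. *)
Theorem no_closed_saddle_connection (R : realType) (X : flat_surface R) (N : nat)
    (a b : {perm 'I_N}) (nrm : R -> R -> R) (ch : 'I_N -> R -> R -> X) :
  strict_norm nrm -> tiling a b ch -> (forall x, covered ch x) ->
  (forall (x y : X) l, segment x y l ->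
     exists2 l', l' <= l & cell_line nrm ch x y l') ->
  (forall (x y : X) u v, move ch x u v y -> near_line x y (nrm u v)) ->
  (forall x : X, ~ singular x -> regular ch x) ->
  (forall x : X, singular x -> exists i, x = ch i 0 0 /\ turn a b i != i) ->
  (forall c d, reach a b c d -> forall i k, ~ closed_orbit c d i k) ->
  forall (L : R) (g : R -> X), ~ closed_saddle_connection L g.
Proof.
move=> nP til cov sc cs nsr sing no L g [[L0 geo s0 _ int] clo].
have reg t : 0 < t < L -> regular ch (g t) by move=> /int /nsr.
have [u [v [m [n [eu ev mn [str st ar]]]]]] :=
  closed_geodesic_straight nP til cov sc cs L0 geo reg clo.
have [i [g0 ti]] := sing _ s0.
have lo : straight_loop L g ch u v.
  split=> //; first by exists i.
  by rewrite g0 => /(regular_turn til)/eqP; rewrite (negPf ti).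
have [c [d [j [k [r cj]]]]] := loop_orbit til lo eu ev mn.
exact: no r j k cj.
Qed.

Local Open Scope quotient_scope.

(** * Square-tiled surfaces *)

Section QuadraticNorm.
Variables (R : realType) (k c : R).
Hypotheses (k0 : 0 < k) (c2 : `|c| < 2).

Definition quad_norm (u v : R) := Num.sqrt (k * (u ^+ 2 + c * (u * v) + v ^+ 2)).

Let Q (u v : R) := k * (u ^+ 2 + c * (u * v) + v ^+ 2).
Let B (u v u' v' : R) := k * (u * u' + c / 2 * (u * v' + u' * v) + v * v').
Let D := k * (1 - (c / 2) ^+ 2).

Let D0 : 0 < D.
Proof.
rewrite mulr_gt0 // subr_gt0 -real_normK ?num_real // expr_lt1 //.
by rewrite normrM normfV (@ger0_norm _ 2) // ltr_pdivrMr // mul1r.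
Qed.

Let Q_ge u v : D * u ^+ 2 <= Q u v /\ D * v ^+ 2 <= Q u v.
Proof.
have sq x y : 0 <= k * (x + c / 2 * y) ^+ 2.
  by rewrite mulr_ge0 ?sqr_ge0 // ltW.
split; rewrite -subr_ge0.
  have -> : Q u v - D * u ^+ 2 = k * (v + c / 2 * u) ^+ 2 by rewrite /Q /D; field.
  exact: sq.
have -> : Q u v - D * v ^+ 2 = k * (u + c / 2 * v) ^+ 2 by rewrite /Q /D; field.
exact: sq.
Qed.

Let Q_ge0 u v : 0 <= Q u v.
Proof. by apply: le_trans (Q_ge u v).1; rewrite mulr_ge0 ?sqr_ge0 // ltW. Qed.

Let cauchy u v u' v' : B u v u' v' <= quad_norm u v * quad_norm u' v'.
Proof.
apply: (le_trans (ler_norm _)); rewrite -sqrtr_sqr -sqrtrM ?Q_ge0 //.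
apply: ler_wsqrtr; rewrite -subr_ge0.
have -> : k * (u ^+ 2 + c * (u * v) + v ^+ 2) *
    (k * (u' ^+ 2 + c * (u' * v') + v' ^+ 2)) - B u v u' v' ^+ 2 =
    k * D * (u * v' - u' * v) ^+ 2 by rewrite /B /D; field.
by rewrite mulr_ge0 ?sqr_ge0 // mulr_ge0 // ltW.
Qed.

Let sqQ u v : quad_norm u v ^+ 2 = Q u v.
Proof. by rewrite sqr_sqrtr // Q_ge0. Qed.

Let QD u v u' v' : Q (u + u') (v + v') =
  (quad_norm u v + quad_norm u' v') ^+ 2 -
  2 * (quad_norm u v * quad_norm u' v' - B u v u' v').
Proof. by rewrite sqrrD !sqQ /Q /B; field. Qed.

Lemma quad_norm_strict : strict_norm quad_norm.
Proof.
have n0 u v : 0 <= quad_norm u v by exact: sqrtr_ge0.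
split.
- exists (Num.sqrt D)^-1; first by rewrite invr_gt0 sqrtr_gt0.
  move=> u v; rewrite ![_^-1 * _]mulrC !ler_pdivlMr ?sqrtr_gt0 //.
  by rewrite -!sqrtr_sqr -!sqrtrM ?sqr_ge0 // ![_ ^+ 2 * D]mulrC;
    split; apply: ler_wsqrtr; [exact: (Q_ge u v).1|exact: (Q_ge u v).2].
- by move=> u v; rewrite /quad_norm !sqrrN mulrNN.
- move=> l u v l0; rewrite -{3}(ger0_norm l0) -sqrtr_sqr -sqrtrM ?sqr_ge0 //.
  by congr Num.sqrt; ring.
- move=> u v u' v'; rewrite -(@ler_pXn2r _ 2) ?nnegrE ?addr_ge0 //.
  rewrite sqQ QD; have := cauchy u v u' v'; lra.
- move=> u v u' v' e.
  have eB : B u v u' v' = quad_norm u v * quad_norm u' v'.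
    have : quad_norm (u + u') (v + v') ^+ 2 = (quad_norm u v + quad_norm u' v') ^+ 2.
      by rewrite e.
    by rewrite sqQ QD; lra.
  set n := quad_norm u v in eB *; set n' := quad_norm u' v' in eB *.
  have z : Q (n' * u - n * u') (n' * v - n * v') = 0.
    have -> : Q (n' * u - n * u') (n' * v - n * v') =
        n' ^+ 2 * Q u v + n ^+ 2 * Q u' v' - 2 * (n * n') * B u v u' v'.
      by rewrite /Q /B; field.
    by rewrite eB -!sqQ -/n -/n'; ring.
  have [] := Q_ge (n' * u - n * u') (n' * v - n * v'); rewrite z.
  rewrite !(pmulr_rle0 _ D0) => h1 h2.
  have zero x : x ^+ 2 <= 0 :> R -> x = 0.
    by move=> h; apply/eqP; rewrite -sqrf_eq0 eq_le h sqr_ge0.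
  by split; apply/eqP; rewrite -subr_eq0; apply/eqP; exact: zero.
Qed.

End QuadraticNorm.

Section SquareTiledSurface.
Variables (R : realType) (N : nat) (a b : {perm 'I_N}).

Local Notation surface := (square_tiled_surface R a b).

Lemma in_square (s t : R) : in01 s -> in01 t -> (s, t) \in @unit_square R.
Proof. by move=> hs ht; apply/mem_set; split. Qed.

Definition square_pt (s t : R) : set_type (@unit_square R) :=
  match pselect (in01 s /\ in01 t) with
  | left h => exist _ (s, t) (in_square h.1 h.2)
  | right _ => corner_point R (false, false)
  end.

Lemma square_ptE s t : in01 s -> in01 t -> val (square_pt s t) = (s, t).
Proof. by move=> hs ht; rewrite /square_pt; case: pselect => // -[]. Qed.

Lemma square_pt_val (p : set_type (@unit_square R)) :
  [/\ in01 (val p).1, in01 (val p).2 & p = square_pt (val p).1 (val p).2].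
Proof.
have [h1 h2] := set_mem (valP p); split=> //.
by apply: val_inj; rewrite square_ptE // -surjective_pairing.
Qed.

Definition square_chart (i : 'I_N) (s t : R) : surface :=
  \pi_(square_quotient R a b) (i, square_pt s t).

Lemma square_tiling : tiling a b square_chart.
Proof.
split.
  split=> i s hs; apply/eqquotP; apply/asboolP; apply: rst_step.
    by apply: GlueRightLeft; rewrite !square_ptE.
  by apply: GlueTopBottom; rewrite !square_ptE.
move=> Y f [gh gv] i s t j s' t' hs ht hs' ht' /eqquotP /asboolP h.
have : forall x y : square_point R N, clos_refl_sym_trans _ (@side_glued R N a b) x y ->
    f x.1 (val x.2).1 (val x.2).2 = f y.1 (val y.2).1 (val y.2).2.
  move=> x y; elim=> //= {x y}; last by move=> x y z _ -> _ ->.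
  move=> x y [k p q e1 e2 e3|k p q e1 e2 e3] /=; rewrite e1 e2 e3.
    by apply: gh; have [] := square_pt_val q.
  by apply: gv; have [] := square_pt_val q.
by move=> /(_ _ _ h); rewrite /= !square_ptE.
Qed.

Lemma square_covered (x : surface) : covered square_chart x.
Proof.
have [] := square_pt_val (repr x).2 => h1 h2 e.
exists (repr x).1, (val (repr x).2).1, (val (repr x).2).2; split=> //.
by rewrite /square_chart -e -surjective_pairing reprK.
Qed.

Lemma square_cell (x y : surface) l : segment x y l ->
  exists2 l', l' <= l & cell_line (quad_norm 1 0) square_chart x y l'.
Proof.
move=> [i [p [q [-> -> ->]]]].
have [hp1 hp2 ep] := square_pt_val p; have [hq1 hq2 eq] := square_pt_val q.
exists (0 + quad_norm 1 0 ((val q).1 - (val p).1) ((val q).2 - (val p).2)).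
  rewrite add0r /quad_norm le_eqVlt; apply/orP; left; apply/eqP.
  by congr Num.sqrt; ring.
apply: BrokenLineStep; first exact: BrokenLineNil.
exists ((val q).1 - (val p).1), ((val q).2 - (val p).2); split=> //.
exists i, (val p).1, (val p).2.
by rewrite ![_ + (_ - _)]addrC !subrK /square_chart -ep -eq.
Qed.

Lemma square_near (x y : surface) u v : move square_chart x u v y ->
  near_line x y (quad_norm 1 0 u v).
Proof.
move=> [i [s [t [[hs ht hsu htv] [-> ->]]]]].
exists (0 + quad_norm 1 0 u v); first by rewrite add0r.
apply: BrokenLineStep; first exact: BrokenLineNil.
exists i, (square_pt s t), (square_pt (s + u) (t + v)); split=> //.
by rewrite !square_ptE //=; congr Num.sqrt; ring.
Qed.

Lemma cornerE (x : 'I_N * (bool * bool)) : corner R a b x =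
  square_chart ((if x.2.2 then b else 1%g) ((if x.2.1 then a else 1%g) x.1)) 0 0.
Proof.
have [gh gv] := square_tiling.1.
case: x => i [b1 b2]; transitivity (square_chart i b1%:R b2%:R).
  rewrite /corner /square_chart /=.
  suff -> : corner_point R (b1, b2) = square_pt b1%:R b2%:R by [].
  by apply: val_inj; rewrite square_ptE //=; [case: b1|case: b2].
by case: b1; case: b2; rewrite /= ?perm1 ?gh ?gv.
Qed.

Lemma singularE (x : surface) :
  singular x = (4 < #|[pred c | corner R a b c == x]|)%N :> Prop.
Proof.
have -> : singular x = (2 * pi < vertex_cone_angle x) :> Prop by [].
rewrite /vertex_cone_angle (_ : 2 * pi = 4%:R * (pi / 2)); last by field.
by rewrite ltr_pM2r ?ltr_nat // divr_gt0 ?pi_gt0.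
Qed.

(** A vertex that is the lower left corner of two squares has at least eight
    corners around it. *)
Lemma square_regular (x : surface) : ~ singular x -> regular square_chart x.
Proof.
rewrite singularE => /negP; rewrite -leqNgt => le4 i j hi hj.
apply/eqP; apply: contraLR le4 => ij; rewrite -ltnNge.
pose f (w : bool * (bool * bool)) : 'I_N * (bool * bool) :=
  (((if w.2.1 then a else 1)^-1 ((if w.2.2 then b else 1)^-1
     (if w.1 then i else j)))%g, w.2).
have fi : injective f.
  move=> [w1 w2] [w1' w2'] [/= + e]; rewrite e => /perm_inj /perm_inj.
  by case: w1; case: w1' => // h; rewrite h eqxx in ij.
have sub : f @: [set: bool * (bool * bool)] \subset
    [set c | corner R a b c == x].
  apply/fintype.subsetP => _ /imsetP[w _ ->]; rewrite inE cornerE /=.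
  rewrite !permKV; apply/eqP; by case: w.1.
have := subset_leq_card sub; rewrite card_imset // cardsT !card_prod card_bool.
by rewrite cardsE => h; apply: leq_trans h.
Qed.

(** If the commutator fixes [i], then at each of the four kinds of corners only
    one square meets the lower left vertex of [i]. *)
Lemma square_singular (x : surface) : singular x ->
  exists i, x = square_chart i 0 0 /\ turn a b i != i.
Proof.
rewrite singularE => h.
have /card_gt0P[c] : (0 < #|[pred c | corner R a b c == x]|)%N by lia.
rewrite inE cornerE => /eqP; set i := (X in square_chart X) => ex.
exists i; split=> //; apply/negP => /eqP ti; move: h; apply/negP; rewrite -leqNgt.
have pi1 : porbit (turn a b) i = [set i]%SET.
  apply/setP => j; rewrite inE; apply/porbitP/eqP => [[l ->]|->].
    elim: l => [|l IH]; first by rewrite expg0 perm1.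
    by rewrite expgSr permM IH.
  by exists 0; rewrite expg0 perm1.
have inj : {in [pred c | corner R a b c == x] &, injective (fun c => c.2)}.
  have base d : d \in [pred c | corner R a b c == x] ->
      ((if d.2.2 then b else 1) ((if d.2.1 then a else 1) d.1))%g = i.
    rewrite inE cornerE -ex => /eqP e.
    have [_ _ + _] := chart_base square_tiling (zero_ico R) (zero_ico R)
      (zero_ico R) (zero_ico R) (esym e).
    by rewrite pi1 inE => /eqP.
  move=> [d1 d2] [d1' d2'] /base + /base + /= e; rewrite -e /= => <-.
  by move=> /perm_inj/perm_inj ->.
have := card_in_image inj; rewrite -card_bool.
move=> <-; apply: (leq_trans (max_card _)).
by rewrite card_prod card_bool.
Qed.

Theorem square_no_closed_saddle_connection :
  (forall c d, reach a b c d -> forall i k, ~ closed_orbit c d i k) ->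
  forall (L : R) (g : R -> surface), ~ closed_saddle_connection L g.
Proof.
apply: (@no_closed_saddle_connection _ _ _ _ _ (quad_norm 1 0) square_chart).
- by apply: quad_norm_strict; rewrite ?normr0.
- exact: square_tiling.
- exact: square_covered.
- exact: square_cell.
- exact: square_near.
- exact: square_regular.
- exact: square_singular.
Qed.

End SquareTiledSurface.

Import numFieldNormedType.Exports.
Local Open Scope classical_set_scope.

(** * The solid bounded by Octa-8 *)

Section Fold.
Variable R : realType.

(** The distance to the nearest multiple of 8/3: the quotient of the line by the
    reflections in the multiples of 4/3. *)
Definition fold (r : R) : R := `|r - 8 / 3 * (Num.floor (r * (3 / 8) + 1 / 2))%:~R|.

Definition signed (e : bool) (y : R) := if e then - y else y.

Lemma signedN e y : signed (~~ e) y = - signed e y.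
Proof. by case: e; rewrite /= ?opprK. Qed.

Lemma fold_range r : 0 <= fold r <= 4 / 3.
Proof.
rewrite normr_ge0 ler_norml /=; have := floor_itv (r * (3 / 8) + 1 / 2).
rewrite intrD; lra.
Qed.

Lemma fold_repr r : exists (m : int) (e : bool), r = 8 / 3 * m%:~R + signed e (fold r).
Proof.
rewrite /fold; set m := Num.floor _; exists m, (r - 8 / 3 * m%:~R < 0).
by rewrite /signed; case: ltrP => h; [rewrite ltr0_norm //|rewrite ger0_norm //]; ring.
Qed.

Lemma int_le_or (m n : int) : (m%:~R : R) <= n%:~R \/ (n%:~R + 1 : R) <= m%:~R.
Proof.
case: (leP m n) => h; [left; by rewrite ler_int|right].
by rewrite -(@intrD R n 1) ler_int; lia.
Qed.

Lemma fold_min r (m : int) : fold r <= `|r - 8 / 3 * m%:~R|.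
Proof.
rewrite /fold; set k := Num.floor _.
have := floor_itv (r * (3 / 8) + 1 / 2); rewrite -/k intrD => h.
have [h1|h1] := int_le_or m k; have [h2|h2] := int_le_or k m.
- by have -> : m%:~R = k%:~R :> R by lra.
- have -> : `|r - 8 / 3 * m%:~R| = r - 8 / 3 * m%:~R by rewrite ger0_norm //; lra.
  by rewrite ler_norml; lra.
- have -> : `|r - 8 / 3 * m%:~R| = - (r - 8 / 3 * m%:~R) by rewrite ler0_norm //; lra.
  by rewrite ler_norml; lra.
- lra.
Qed.

Lemma fold_lip r r' : `|fold r - fold r'| <= `|r - r'|.
Proof.
suff h x y : fold x <= fold y + `|x - y|.
  by rewrite ler_norml; have := h r r'; have := h r' r; rewrite (distrC r'); lra.
apply: (le_trans (fold_min x (Num.floor (y * (3 / 8) + 1 / 2)))).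
rewrite /fold; set k := Num.floor _.
have -> : x - 8 / 3 * k%:~R = (y - 8 / 3 * k%:~R) + (x - y) by ring.
exact: ler_normD.
Qed.

Lemma fold_signed (m : int) e y : 0 <= y <= 4 / 3 ->
  fold (8 / 3 * m%:~R + signed e y) = y.
Proof.
move=> hy; apply/eqP; rewrite eq_le; apply/andP; split.
  apply: (le_trans (fold_min _ m)); rewrite addrC addKr.
  by rewrite /signed; case: e; rewrite ?normrN ger0_norm //; lra.
rewrite /fold; move: (Num.floor _) => k.
have [h1|h1] := int_le_or m k; have [h2|h2] := int_le_or k m.
- have -> : m%:~R = k%:~R :> R by lra.
  rewrite addrC addKr.
  by rewrite /signed; case: e; rewrite ?normrN ger0_norm //; lra.
- rewrite ler_normr; apply/orP; right; rewrite /signed; case: e; lra.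
- rewrite ler_normr; apply/orP; left; rewrite /signed; case: e; lra.
- lra.
Qed.

Lemma fold_even r (m : int) : fold (r + 8 / 3 * m%:~R) = fold r.
Proof.
have [n [e er]] := fold_repr r; rewrite {1}er addrAC -mulrDr -intrD.
exact: fold_signed (fold_range r).
Qed.

Lemma fold_odd r (m : int) : fold (r + 4 / 3 * (1 + 2 * m%:~R)) = 4 / 3 - fold r.
Proof.
have [n [e er]] := fold_repr r; have hr := fold_range r.
have := @fold_signed (n + m + (~~ e : nat)%:Z) (~~ e) (4 / 3 - fold r) ltac:(lra).
move=> <-; congr fold; rewrite {1}er !intrD.
by case: e er => /= _; field.
Qed.

End Fold.

Section Octahedron.
Variable R : realType.
Local Notation space := 'rV[R]_3.

Lemma sum3 (V : nmodType) (F : 'I_3 -> V) (j : 'I_3) :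
  \sum_i F i = F j + F (j + 1) + F (j + 1 + 1).
Proof.
rewrite 3!big_ord_recl big_ord0 addr0.
have [-> [-> ->]] : ord0 = 0 :> 'I_3 /\ lift ord0 ord0 = 1 :> 'I_3 /\
  lift ord0 (lift ord0 ord0) = 1 + 1 :> 'I_3 by do !split; apply: val_inj.
case: j => -[|[|[|//]]] hj.
- have -> : Ordinal hj = 0 by apply: val_inj.
  by rewrite add0r addrA.
- have -> : Ordinal hj = 1 by apply: val_inj.
  have -> : 1 + 1 + 1 = 0 :> 'I_3 by apply: val_inj.
  by rewrite addrC.
- have -> : Ordinal hj = 1 + 1 by apply: val_inj.
  have -> : 1 + 1 + 1 = 0 :> 'I_3 by apply: val_inj.
  by rewrite add0r addrA addrC addrA.
Qed.

Lemma cycle3 (j : 'I_3) : j + 1 + 1 + 1 = j.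
Proof. by apply: val_inj; case: j => -[|[|[|//]]]. Qed.

Lemma ord3 (j k : 'I_3) : [\/ k = j, k = j + 1 | k = j + 1 + 1].
Proof.
case: j => -[|[|[|//]]] hj; case: k => -[|[|[|//]]] hk;
  by [constructor 1; apply: val_inj|constructor 2; apply: val_inj|
      constructor 3; apply: val_inj].
Qed.

Lemma ord3_ind (P : 'I_3 -> Prop) j : P j -> P (j + 1) -> P (j + 1 + 1) ->
  forall k, P k.
Proof. by move=> p0 p1 p2 k; case: (ord3 j k) => ->. Qed.

(** In the cube [0, 4/3]^3 the octahedron between the two opposite corners is
    the image of the part [0 <= t <= 1] of [0, 1]^3 under
    [z |-> z + t / 3 * (1, 1, 1)], where [t = z_0 + z_1 + z_2 - 1]. The height
    [t] runs from 0 to 1 between the faces orthogonal to the diagonal, and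
    [cube_coord] is the inverse map. *)
Definition height (x : space) : R := (\sum_j fold (x 0 j) - 1) / 2.

Definition cube_coord (x : space) (j : 'I_3) : R := fold (x 0 j) - height x / 3.

(** The parts of the two octahedra centred at corners of the cube satisfy the
    same six inequalities, with [t <= 0] and [t >= 1]. *)
Definition solid : set space := [set x | forall j, 0 <= cube_coord x j <= 1].

Definition surface : set space := [set x | solid x /\
  exists j, cube_coord x j = 0 \/ cube_coord x j = 1].

Lemma octahedronE : @octahedron R = [set x : space | \sum_j `|x 0 j| <= 1].
Proof.
have vE (k : 'I_3 * bool) j :
    (octahedron_vertex R k) 0 j = if k.1 == j then (-1) ^+ k.2 else 0.
  by rewrite !mxE eqxx /= eq_sym; case: eqP; rewrite ?mulr1 ?mulr0.
have xE (w : 'I_3 * bool -> R) j :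
    (\sum_k w k *: octahedron_vertex R k) 0 j = w (j, false) - w (j, true).
  rewrite summxE (eq_bigr (fun k => w (k.1, k.2) *
    (octahedron_vertex R (k.1, k.2)) 0 j)); last by move=> [i e] _; rewrite mxE.
  rewrite -(pair_bigA _ (fun i e => w (i, e) * (octahedron_vertex R (i, e)) 0 j)) /=.
  rewrite (bigD1 j) //= big_bool /= !vE /= eqxx expr1 expr0 mulr1 mulrN1 addrC.
  rewrite big1 ?add0r 1?addrC // => i ij.
  by rewrite big_bool /= !vE /= (negPf ij) !mulr0 addr0.
have sumE (w : 'I_3 * bool -> R) : \sum_k w k = \sum_j (w (j, false) + w (j, true)).
  rewrite (eq_bigr (fun k => w (k.1, k.2))); last by case.
  rewrite -(pair_bigA _ (fun i e => w (i, e))) /=.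
  by apply: eq_bigr => i _; rewrite big_bool addrC.
apply/seteqP; split=> [x [w [w0 w1 ->]]|x hx] /=.
  rewrite -w1 sumE; apply: ler_sum => j _; rewrite xE.
  by apply: (le_trans (ler_normB _ _)); rewrite !ger0_norm.
pose d := (1 - \sum_j `|x 0 j|) / 6.
have d0 : 0 <= d by rewrite divr_ge0 // subr_ge0.
exists (fun k => (`|x 0 k.1| + signed k.2 (x 0 k.1)) / 2 + d); split.
- move=> [j e] /=; rewrite addr_ge0 // divr_ge0 //.
  have := ler_norm (x 0 j); have := ler_norm (- x 0 j); rewrite normrN.
  by rewrite /signed; case: e; lra.
- rewrite sumE (eq_bigr (fun j => `|x 0 j| + d *+ 2)); last first.
    by move=> j _ /=; rewrite mulr2n; field.
  by rewrite big_split /= sumr_const card_ord -mulrnA /d; field.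
- by apply/rowP => j; rewrite xE /=; field.
Qed.

Lemma signE (e : bool) (y : R) : (-1) ^+ e * y = signed e y.
Proof. by case: e; rewrite /= ?expr1 ?expr0 ?mulN1r ?mul1r. Qed.

Lemma latticeD (u w : space) : lattice u -> lattice w -> lattice (u + w).
Proof.
move=> [c ->] [d ->]; exists (fun s => c s + d s); rewrite -big_split.
by apply: eq_bigr => s _; rewrite intrD scalerDl.
Qed.

Lemma lattice_sign_vector s : lattice ((4 / 3) *: sign_vector R s).
Proof.
exists (fun s' => (s' == s)%:R); rewrite (bigD1 s) //= eqxx big1 ?addr0.
  by rewrite scale1r.
by move=> s' /negPf ->; rewrite scale0r.
Qed.

(** The lattice is body-centred cubic. *)
Lemma latticeE (v : space) : lattice v <-> exists (k : int) (n : 'I_3 -> int),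
  forall j, v 0 j = 4 / 3 * (k%:~R + 2 * (n j)%:~R).
Proof.
split=> [[c ->]|[k [n vE]]].
  exists (\sum_s c s), (fun j => - \sum_(s : {ffun 'I_3 -> bool} | s j) c s) => j.
  rewrite summxE rmorphN /= !rmorph_sum /= mulrN mulr_sumr -sumrN.
  rewrite [X in _ + X]big_mkcond -big_split mulr_sumr; apply: eq_bigr => s _.
  by rewrite !mxE; case: (s j); rewrite /= ?expr1 ?expr0; field.
have latZ (m : int) u : lattice u -> lattice (m%:~R *: u).
  move=> [c ->]; exists (fun s => m * c s); rewrite scaler_sumr.
  by apply: eq_bigr => s _; rewrite intrM scalerA.
have two j : @lattice R ((8 / 3) *: delta_mx 0 j).
  have sumP w : w = (4 / 3) *: sign_vector R [ffun=> false] +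
      (4 / 3) *: sign_vector R [ffun i => i != j] -> lattice w.
    by move=> ->; apply: latticeD; exact: lattice_sign_vector.
  apply: sumP; apply/rowP => i; rewrite !mxE !ffunE eqxx /= eq_sym.
  by case: eqP => _; rewrite /= ?expr0 ?expr1; field.
have -> : v = k%:~R *: ((4 / 3) *: sign_vector R [ffun=> false]) +
    \sum_j (n j)%:~R *: ((8 / 3) *: delta_mx 0 j).
  apply/rowP => i; rewrite mxE summxE vE !mxE !ffunE expr0.
  rewrite (bigD1 i) //= big1 ?addr0; last first.
    by move=> j ji; rewrite !mxE eqxx /= eq_sym (negPf ji) !mulr0.
  by rewrite !mxE !eqxx /=; field.
apply: latticeD; first exact/latZ/lattice_sign_vector.
apply: (big_ind (@lattice R)) => [|u w|j _]; [|exact: latticeD|exact: latZ].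
by exists (fun=> 0); rewrite big1 // => s _; rewrite scale0r.
Qed.

Lemma int_parity (k : int) : exists m (b : bool), k = b%:Z + 2 * m.
Proof.
exists (k %/ 2)%Z, ((k %% 2)%Z == 1); rewrite {1}(divz_eq k 2) addrC mulrC.
by congr (_ + _); have := modz_ge0 k (isT : 2 != 0 :> int);
  have := @ltz_pmod k 2 isT; case: (_ %% _)%Z => -[|[|]].
Qed.

(** The two cosets of the cubic sublattice: translations either preserve the
    folded coordinates or reverse them. *)
Lemma lattice_cases (v : space) : lattice v <->
  (exists n : 'I_3 -> int, forall j, v 0 j = 8 / 3 * (n j)%:~R) \/
  (exists n : 'I_3 -> int, forall j, v 0 j = 4 / 3 * (1 + 2 * (n j)%:~R)).
Proof.
rewrite latticeE; split=> [[k [n vE]]|[[n vE]|[n vE]]].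
- have [m [b ek]] := int_parity k; case: b ek => ek; [right|left];
    by exists (fun j => m + n j) => j; rewrite vE ek !intrD intrM /=; field.
- by exists 0, n => j; rewrite vE; field.
- by exists 1, n => j; rewrite vE.
Qed.

Lemma shift_even (x v : space) (n : 'I_3 -> int) :
  (forall j, v 0 j = 8 / 3 * (n j)%:~R) ->
  (forall j, fold ((x + v) 0 j) = fold (x 0 j)) /\ height (x + v) = height x.
Proof.
move=> vE; have f j : fold ((x + v) 0 j) = fold (x 0 j).
  by rewrite mxE vE fold_even.
by split=> //; rewrite /height (eq_bigr _ (fun j _ => f j)).
Qed.

Lemma shift_odd (x v : space) (n : 'I_3 -> int) :
  (forall j, v 0 j = 4 / 3 * (1 + 2 * (n j)%:~R)) ->
  (forall j, fold ((x + v) 0 j) = 4 / 3 - fold (x 0 j)) /\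
  height (x + v) = 1 - height x.
Proof.
move=> vE; have f j : fold ((x + v) 0 j) = 4 / 3 - fold (x 0 j).
  by rewrite mxE vE fold_odd.
by split=> //; rewrite /height (eq_bigr _ (fun j _ => f j)) !(sum3 _ 0); field.
Qed.

Lemma shift_cube (x v : space) : lattice v ->
  (forall j, cube_coord (x + v) j = cube_coord x j) \/
  (forall j, cube_coord (x + v) j = 1 - cube_coord x j).
Proof.
move=> /lattice_cases[[n vE]|[n vE]]; [left|right] => j; rewrite /cube_coord.
  by have [-> ->] := shift_even x vE.
by have [-> ->] := shift_odd x vE; field.
Qed.

Lemma shift_solid (x v : space) : lattice v -> solid x -> solid (x + v).
Proof.
by move=> /(shift_cube x)[] e h j; rewrite e; have := h j; lra.
Qed.

Lemma l1_le (a b c d : R) : a + b + c <= d -> a + b - c <= d -> a - b + c <= d ->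
  a - b - c <= d -> - a + b + c <= d -> - a + b - c <= d -> - a - b + c <= d ->
  - a - b - c <= d -> `|a| + `|b| + `|c| <= d.
Proof.
by move=> *; case: (ger0P a) => _; case: (ger0P b) => _; case: (ger0P c) => _; lra.
Qed.

Lemma l1_ge (a b c d : R) : `|a| + `|b| + `|c| <= d ->
  [/\ a + b + c <= d, a + b - c <= d, a - b + c <= d & a - b - c <= d] /\
  [/\ - a + b + c <= d, - a + b - c <= d, - a - b + c <= d & - a - b - c <= d].
Proof.
have n (x : R) : x <= `|x| /\ - x <= `|x|.
  by split; [exact: ler_norm|rewrite -normrN; exact: ler_norm].
have [? ?] := n a; have [? ?] := n b; have [? ?] := n c.
by move=> h; do !split; lra.
Qed.

Lemma fold_small (y : R) : `|y| <= 4 / 3 -> fold y = `|y|.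
Proof.
move=> h; have := @fold_signed _ 0 (y < 0) `|y|; rewrite mulr0 add0r normr_ge0 h.
move=> /(_ isT) e; rewrite -[in RHS]e; congr fold.
by rewrite /signed; case: ltrP => ?; [rewrite ltr0_norm ?opprK|rewrite ger0_norm].
Qed.

Lemma cubeE (x : space) j : cube_coord x j =
  fold (x 0 j) - (fold (x 0 j) + fold (x 0 (j + 1)) + fold (x 0 (j + 1 + 1)) - 1) / 6.
Proof. by rewrite /cube_coord /height (sum3 _ j); field. Qed.

Lemma octahedron_solid (x : space) : octahedron x -> solid x.
Proof.
rewrite octahedronE /= => h j; rewrite cubeE.
rewrite (sum3 _ j) in h.
have p (k : 'I_3) := normr_ge0 (x 0 k).
have := p j; have := p (j + 1); have := p (j + 1 + 1) => *.
rewrite !fold_small; lra.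
Qed.

Lemma dot_sign_vector s : dot (sign_vector R s) (sign_vector R s) = 3.
Proof.
rewrite /dot (eq_bigr (fun=> 1)); last first.
  by move=> i _; rewrite !mxE -expr2 sqrr_sign.
by rewrite sumr_const card_ord.
Qed.

Lemma face_reflectionE s (x : space) j : (face_reflection s x) 0 j =
  signed (s j) (signed (s j) (x 0 j) - 2 / 3 * (\sum_i signed (s i) (x 0 i) - 1)).
Proof.
have dx : dot (sign_vector R s) x = \sum_i signed (s i) (x 0 i).
  by apply: eq_bigr => i _; rewrite !mxE signE.
rewrite /face_reflection dot_sign_vector dx !mxE; set S := \sum_i _.
by case: (s j); rewrite /= ?expr1 ?expr0; field.
Qed.

Lemma fold_sign e (y : R) : 0 <= y <= 4 / 3 -> fold (signed e y) = y.
Proof. by move=> /(@fold_signed _ 0 e); rewrite mulr0 add0r. Qed.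

Lemma reflected_solid s (x : space) : octahedron x -> solid (face_reflection s x).
Proof.
rewrite octahedronE /= => h j; rewrite cubeE !face_reflectionE.
have sg (k : 'I_3) : `|signed (s k) (x 0 k)| = `|x 0 k|.
  by rewrite /signed; case: (s k); rewrite ?normrN.
rewrite (sum3 _ j) -!sg in h; rewrite (sum3 _ j).
have [[? ? ? ?] [? ? ? ?]] := l1_ge h.
rewrite !fold_sign; lra.
Qed.

(** According to the height, a point of the solid is in an octahedron centred at
    one of the two corners, or in the one between them, which is the reflection
    of the former. *)
Lemma octa8_solidE : @octa8_solid R = solid.
Proof.
apply/seteqP; split=> x /=.
  move=> [f [v lv fE] [w hw <-]].
  by case: fE => [->|[s ->]]; rewrite addrC; apply: shift_solid => //;
    [exact: octahedron_solid|exact: reflected_solid].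
move=> sx; have [m hm] := choice (fun j => fold_repr (x 0 j)).
have [e xE] := choice hm.
pose y j := fold (x 0 j); have hy j : 0 <= y j <= 4 / 3 := fold_range (x 0 j).
pose v : space := \row_j (8 / 3 * (m j)%:~R).
have lv : lattice v by apply/lattice_cases; left; exists m => j; rewrite mxE.
have xv j : x 0 j = v 0 j + signed (e j) (y j) by rewrite mxE -xE.
have zE := cubeE x.
case: (lerP (\sum_j y j) 1) => [h1|h1].
  exists (fun u => v + u); first by exists v => //; left.
  exists (\row_j signed (e j) (y j)); last by apply/rowP => j; rewrite xv !mxE.
  rewrite octahedronE /=; apply: le_trans h1; apply: ler_sum => j _.
  by rewrite mxE /signed; have := hy j; case: (e j); rewrite ?normrN => /andP[h _];
    rewrite ger0_norm.
case: (lerP 3 (\sum_j y j)) => [h3|h3].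
  pose w : space := \row_j (v 0 j + signed (e j) (4 / 3)).
  have lw : lattice w.
    apply/lattice_cases; right; exists (fun j => m j - (e j)%:Z) => j.
    by rewrite !mxE; case: (e j) => /=; rewrite ?subr0 ?intrB; field.
  exists (fun u => w + u); first by exists w => //; left.
  exists (\row_j signed (~~ e j) (4 / 3 - y j)); last first.
    by apply/rowP => j; rewrite xv !mxE signedN; case: (e j) => /=; ring.
  rewrite octahedronE /= (sum3 _ 0) !mxE.
  have a k : `|signed (~~ e k) (4 / 3 - y k)| = 4 / 3 - y k.
    by have := hy k; rewrite /signed; case: (e k) => /= ?; rewrite ?normrN ger0_norm //; lra.
  by rewrite !a; rewrite (sum3 _ 0) in h3; lra.
exists (fun u => v + face_reflection [ffun j => e j] u).
  by exists v => //; right; exists [ffun j => e j].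
pose S := \sum_j y j.
have SE : S = \sum_j y j by [].
pose a j := y j - 2 / 3 * (S - 1).
have aE j : signed (e j) (signed (e j) (a j)) = a j.
  by rewrite /signed; case: (e j); rewrite ?opprK.
exists (\row_j signed (e j) (a j)); last first.
  apply/rowP => j; rewrite mxE face_reflectionE xv; congr (_ + _).
  rewrite ffunE mxE aE (eq_bigr a); last by move=> i _; rewrite ffunE mxE aE.
  by congr signed; rewrite /a (sum3 _ 0) SE (sum3 _ 0); field.
have sa j : `|signed (e j) (a j)| = `|a j|.
  by rewrite /signed; case: (e j); rewrite ?normrN.
rewrite octahedronE /= (eq_bigr (fun j => `|a j|)); last by move=> j _; rewrite mxE sa.
rewrite (sum3 _ 0).
have z0 := sx 0; have z1 := sx (0 + 1); have z2 := sx (0 + 1 + 1).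
rewrite zE in z0; rewrite zE cycle3 in z1.
rewrite zE !cycle3 in z2.
rewrite (sum3 _ 0) in SE; rewrite -/S SE in h1 h3.
by apply: l1_le; rewrite /a SE /y; rewrite /y in h1 h3; lra.
Qed.

End Octahedron.

Section Boundary.
Variable R : realType.
Local Notation space := 'rV[R]_3.

Lemma nbhs_coord (x : space) (A : set space) : nbhs x A <->
  exists2 e : R, 0 < e & forall y : space, (forall j, `|x 0 j - y 0 j| < e) -> A y.
Proof.
split=> [/nbhs_ballP[e /= e0 h]|[e e0 h]].
  exists e => // y hy; apply: h; split=> // i j.
  by rewrite (ord1 i) -ball_normE; exact: hy.
apply/nbhs_ballP; exists e => // y [_ hy]; apply: h => j.
by have := hy 0 j; rewrite -ball_normE.
Qed.

Lemma cube_coord_lip (x y : space) e j : (forall k, `|x 0 k - y 0 k| <= e) ->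
  `|cube_coord x j - cube_coord y j| <= 2 * e.
Proof.
move=> h; rewrite !cubeE.
have l k : `|fold (x 0 k) - fold (y 0 k)| <= e := le_trans (fold_lip _ _) (h k).
have := l j; have := l (j + 1); have := l (j + 1 + 1).
by rewrite !ler_norml; lra.
Qed.

Lemma closure_solid : closure (@solid R) = @solid R.
Proof.
apply/seteqP; split; last exact: subset_closure.
move=> x cx j.
have near e : 0 < e -> exists2 y, solid y & `|cube_coord x j - cube_coord y j| <= 2 * e.
  move=> e0; have [y [sy hy]] : @solid R `&` [set y | forall k, `|x 0 k - y 0 k| < e] !=set0.
    by apply: cx; apply/nbhs_coord; exists e.
  by exists y => //; apply: cube_coord_lip => k; apply/ltW/hy.
apply/andP; split.
  rewrite -oppr_le0; apply/ler_addgt0Pl => e e0.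
  have [y sy hy] := near (e / 2) ltac:(lra).
  by move: hy; rewrite ler_norml; have := sy j; lra.
apply/ler_addgt0Pl => e e0; have [y sy hy] := near (e / 2) ltac:(lra).
by move: hy; rewrite ler_norml; have := sy j; lra.
Qed.

(** Folding is an open map, which allows to move a point of a face out of the
    solid by changing a folded coordinate. *)
Lemma perturb (x : space) j y : 0 <= y <= 4 / 3 -> exists x' : space,
  [/\ forall k, `|x 0 k - x' 0 k| <= `|fold (x 0 j) - y|, fold (x' 0 j) = y &
      forall k, k != j -> fold (x' 0 k) = fold (x 0 k)].
Proof.
move=> hy; have [m [e xE]] := fold_repr (x 0 j).
exists (\row_k if k == j then 8 / 3 * m%:~R + signed e y else x 0 k).
split=> [k||k kj]; rewrite mxE.
- case: eqP => [->|_]; last by rewrite subrr normr0.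
  rewrite {1}xE; set f := fold _.
  have -> : 8 / 3 * m%:~R + signed e f - (8 / 3 * m%:~R + signed e y) = signed e (f - y).
    by case: (e) => /=; ring.
  by case: (e) => /=; rewrite ?normrN.
- by rewrite eqxx fold_signed.
- by rewrite (negPf kj).
Qed.

Lemma cube_coord_perturb (x x' : space) j y k : fold (x' 0 j) = y ->
  (forall i, i != j -> fold (x' 0 i) = fold (x 0 i)) ->
  cube_coord x' k = cube_coord x k +
    (if k == j then 5 / 6 else - (1 / 6)) * (y - fold (x 0 j)).
Proof.
move=> xj xo; have hE : height x' = height x + (y - fold (x 0 j)) / 2.
  rewrite /height (bigD1 j) //= [in RHS](bigD1 j) //= xj.
  by rewrite (eq_bigr _ xo); field.
rewrite /cube_coord hE; case: eqP => [->|/eqP/xo ->]; first by rewrite xj; field.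
by field.
Qed.

Lemma interior_solid (x : space) : interior (@solid R) x <->
  forall j, 0 < cube_coord x j < 1.
Proof.
split=> [/nbhs_coord[e e0 h] j|h]; last first.
  apply/nbhs_coord.
  pose r := \big[Num.min/1]_j Num.min (cube_coord x j) (1 - cube_coord x j).
  have r0 : 0 < r.
    apply: lt_bigmin => // j _; rewrite lt_min; have := h j; lra.
  have rj j : r <= cube_coord x j /\ r <= 1 - cube_coord x j.
    have : r <= Num.min (cube_coord x j) (1 - cube_coord x j) by exact: bigmin_le_cond.
    by rewrite le_min => /andP.
  exists (r / 2); first lra.
  move=> y hy j; have := @cube_coord_lip x y (r / 2) j (fun k => ltW (hy k)).
  by rewrite ler_norml; have := rj j; lra.
have sx : solid x by apply: h => k; rewrite subrr normr0.
(* A point of a face can be moved out of the solid by changing one folded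
   coordinate. *)
have out i y : 0 <= y <= 4 / 3 -> `|fold (x 0 i) - y| < e ->
    (cube_coord x j = 0 /\ (if j == i then 5 / 6 else - (1 / 6)) * (y - fold (x 0 i)) < 0) \/
    (cube_coord x j = 1 /\ 0 < (if j == i then 5 / 6 else - (1 / 6)) * (y - fold (x 0 i))) ->
    False.
  move=> hy ye; have [x' [near xi xo]] := perturb x i hy.
  have s' : solid x' by apply: h => k; apply: le_lt_trans ye; exact: near.
  have := s' j; rewrite (cube_coord_perturb j xi xo); set K := _ * _.
  by move=> hK [[h1 h2]|[h1 h2]]; rewrite h1 in hK; lra.
pose d := Num.min (e / 2) (1 / 30).
have d0 : 0 < d by rewrite /d lt_min; lra.
have [de d3] : d <= e / 2 /\ d <= 1 / 30 by rewrite /d !ge_min !lexx orbT.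
have f0 := fold_range (x 0 j); have f1 := fold_range (x 0 (j + 1)).
have f2 := fold_range (x 0 (j + 1 + 1)).
have nj : (j == j + 1) = false by rewrite -[X in X == _]addr0 (inj_eq (addrI j)).
have cE := cubeE x j; have sj := sx j.
have up i y : y = fold (x 0 i) + d -> y <= 4 / 3 ->
    (cube_coord x j = 0 /\ (if j == i then 5 / 6 else - (1 / 6)) * d < 0) \/
    (cube_coord x j = 1 /\ 0 < (if j == i then 5 / 6 else - (1 / 6)) * d) -> False.
  move=> -> h1 h2; apply: (out i (fold (x 0 i) + d)).
  - by have := fold_range (x 0 i); lra.
  - by rewrite opprD addrA subrr sub0r normrN gtr0_norm //; lra.
  - by have -> : fold (x 0 i) + d - fold (x 0 i) = d by ring.
have down i y : y = fold (x 0 i) - d -> 0 <= y ->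
    (cube_coord x j = 0 /\ (if j == i then 5 / 6 else - (1 / 6)) * - d < 0) \/
    (cube_coord x j = 1 /\ 0 < (if j == i then 5 / 6 else - (1 / 6)) * - d) -> False.
  move=> -> h1 h2; apply: (out i (fold (x 0 i) - d)).
  - by have := fold_range (x 0 i); lra.
  - by rewrite opprB addrC subrK gtr0_norm //; lra.
  - by have -> : fold (x 0 i) - d - fold (x 0 i) = - d by ring.
rewrite !lt_neqAle !(eq_sym 0); have [z0 z1] := andP sj.
rewrite z0 z1 !andbT; apply/andP; split; apply/eqP => cj.
  have [fd|fd] := lerP d (fold (x 0 j)).
    by apply: (down j (fold (x 0 j) - d)) => //; [lra|left; rewrite eqxx; lra].
  by apply: (up (j + 1) (fold (x 0 (j + 1)) + d)) => //; [lra|left; rewrite nj; lra].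
have [fd|fd] := lerP d (4 / 3 - fold (x 0 j)).
  by apply: (up j (fold (x 0 j) + d)) => //; [lra|right; rewrite eqxx; lra].
by apply: (down (j + 1) (fold (x 0 (j + 1)) - d)) => //; [lra|right; rewrite nj; lra].
Qed.

Lemma octa8_boundaryE : @octa8_boundary R = @surface R.
Proof.
rewrite /octa8_boundary octa8_solidE closure_solid; apply/seteqP; split=> x.
  move=> [sx nx]; split=> //; apply: contrapT => nj; apply: nx.
  apply/interior_solid => j; have sj := sx j.
  rewrite !lt_neqAle !(eq_sym 0); have [-> ->] := andP sj.
  by rewrite !andbT; apply/andP; split; apply/eqP => cj; apply: nj; exists j; [left|right].
move=> [sx [j cj]]; split=> // /interior_solid /(_ j); case: cj => ->; rewrite ltxx //.
by rewrite andbF.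
Qed.

End Boundary.

(** * Octa-8 as a surface tiled by rhombi *)

Definition octa8_right : {perm 'I_12} := perm_of_cycles 11 (consecutive_cycles 4 3).
Definition octa8_top : {perm 'I_12} := perm_of_cycles 11 octa8_v.

(** The cell [3 c + k] is the [k]-th rhombus of the [c]-th cube. The four cubes
    are those around the origin that are obtained from [0, 4/3]^3 by changing an
    even number of signs; the [c]-th one keeps all signs if [c = 0], and
    otherwise only that of the coordinate [c - 1]. *)
Definition cell_axis (i : 'I_12) : 'I_3 := inZp i.
Definition cell_sign (i : 'I_12) (j : 'I_3) : bool :=
  (i %/ 3 != 0)%N && (i %/ 3 != j.+1)%N.

Section Combinatorics.
Local Open Scope nat_scope.

Let right_nat := cycles_apply (consecutive_cycles 4 3).
Let top_nat := cycles_apply octa8_v.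
Let sign_nat (i j : nat) := (i %/ 3 != 0) && (i %/ 3 != j.+1).

Let rightE (i : 'I_12) : octa8_right i = right_nat i :> nat.
Proof. by rewrite perm_of_cyclesE. Qed.

Let topE (i : 'I_12) : octa8_top i = top_nat i :> nat.
Proof. by rewrite perm_of_cyclesE. Qed.

Let all_ord n (P : pred nat) : all P (iota 0 n) -> forall i : 'I_n, P i.
Proof. by move=> /allP h i; apply: h; rewrite mem_iota ltn_ord. Qed.

Let has_ord n (P : pred nat) : has P (iota 0 n) -> exists i : 'I_n, P i.
Proof.
by move=> /hasP[i]; rewrite mem_iota => /andP[_ hi] Pi; exists (Ordinal hi).
Qed.

Lemma axis_right i : cell_axis (octa8_right i) = (cell_axis i + 1)%R.
Proof.
apply: val_inj; rewrite /= rightE; apply/eqP; move: i.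
by apply: (@all_ord 12 (fun i => right_nat i %% 3 == (i %% 3 + 1) %% 3)); vm_compute.
Qed.

Lemma sign_right i j : cell_sign (octa8_right i) j = cell_sign i j.
Proof.
rewrite /cell_sign rightE; apply/eqP; move: j.
apply: (@all_ord 3 (fun j => sign_nat (right_nat i) j == sign_nat i j)).
by move: i; apply: (@all_ord 12 (fun i => all (fun j =>
  sign_nat (right_nat i) j == sign_nat i j) (iota 0 3))); vm_compute.
Qed.

Lemma axis_top i : cell_axis (octa8_top i) = (cell_axis i + 1 + 1)%R.
Proof.
apply: val_inj; rewrite /= topE; apply/eqP; move: i.
by apply: (@all_ord 12 (fun i => top_nat i %% 3 == ((i %% 3 + 1) %% 3 + 1) %% 3));
  vm_compute.
Qed.

Lemma sign_top i j : cell_sign (octa8_top i) j =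
  (j == cell_axis i + 1)%R (+) ~~ cell_sign i j.
Proof.
rewrite /cell_sign topE; apply/eqP; move: j.
apply: (@all_ord 3 (fun j => sign_nat (top_nat i) j ==
  (j == (i %% 3 + 1) %% 3) (+) ~~ sign_nat i j)).
by move: i; apply: (@all_ord 12 (fun i => all (fun j =>
  sign_nat (top_nat i) j == (j == (i %% 3 + 1) %% 3) (+) ~~ sign_nat i j)
  (iota 0 3))); vm_compute.
Qed.

Lemma sign_even i (j : 'I_3) :
  cell_sign i j (+) cell_sign i (j + 1)%R (+) cell_sign i (j + 1 + 1)%R = false.
Proof.
have h := @all_ord 12 (fun i => all (fun j =>
  sign_nat i j (+) sign_nat i ((j + 1) %% 3) (+)
  sign_nat i (((j + 1) %% 3 + 1) %% 3) == false) (iota 0 3)) isT i.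
exact/eqP/(@all_ord 3 _ h j).
Qed.

Lemma third_sign (a b c a' b' c' : bool) : a <> a' -> b <> b' ->
  a (+) b (+) c = false -> a' (+) b' (+) c' = false -> c = c'.
Proof. by case: a a' b b' c c' => -[] [] [] [] []. Qed.

(** Cubes with the same sign in one direction are equal or opposite to each
    other across an axis; in the second case they share a vertex, around which
    one turns by going up and right instead of right and up. *)
Lemma cell_eq_or i i' : cell_axis i = cell_axis i' ->
  cell_sign i (cell_axis i) = cell_sign i' (cell_axis i) ->
  i = i' \/ cell_sign i (cell_axis i + 1)%R <> cell_sign i' (cell_axis i + 1)%R /\
    exists x, i = octa8_right (octa8_top x) /\ i' = octa8_top (octa8_right x).
Proof.
move=> /(congr1 val)/eqP /= ea /eqP es.
have := @all_ord 12 (fun i => all (fun i' => (i %% 3 == i' %% 3) ==>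
  (sign_nat i (i %% 3) == sign_nat i' (i %% 3)) ==> ((i == i') ||
  (sign_nat i ((i %% 3 + 1) %% 3) != sign_nat i' ((i %% 3 + 1) %% 3)) &&
  has (fun x => (i == right_nat (top_nat x)) && (i' == top_nat (right_nat x)))
    (iota 0 12))) (iota 0 12)).
move=> /(_ ltac:(by vm_compute) i)/all_ord /(_ i').
rewrite ea es => /orP[/eqP/val_inj ii|/andP[/eqP ne h]]; first by left.
have [x /andP[/eqP e1 /eqP e2]] := @has_ord 12 _ h.
right; split=> //; exists x; split; apply: val_inj.
  by rewrite [LHS]e1 -topE -rightE.
by rewrite [LHS]e2 -rightE -topE.
Qed.

Lemma cell_exists (k : 'I_3) (e : 'I_3 -> bool) :
  e k (+) e (k + 1)%R (+) e (k + 1 + 1)%R = false ->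
  exists i, cell_axis i = k /\ forall j, cell_sign i j = e j.
Proof.
move=> ev.
have : exists i : 'I_12, (i %% 3 == k) && ((sign_nat i k == e k) &&
    (sign_nat i ((k + 1) %% 3) == e (k + 1)%R)).
  apply: (@has_ord 12 (fun i => (i %% 3 == k) && ((sign_nat i k == e k) &&
    (sign_nat i ((k + 1) %% 3) == e (k + 1)%R)))).
  move: (e k) (e (k + 1)%R) => e0 e1 {ev}.
  have h := @all_ord 3 (fun k => all (fun e0 => all (fun e1 =>
    has (fun i => (i %% 3 == k) && ((sign_nat i k == e0) &&
    (sign_nat i ((k + 1) %% 3) == e1))) (iota 0 12)) [:: true; false])
    [:: true; false]) isT k.
  have he (b : bool) : b \in [:: true; false] by case: b.
  exact: (allP (allP h _ (he e0)) _ (he e1)).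
move=> [i /and3P[/eqP ik /eqP e0 /eqP e1]]; exists i.
have ai : cell_axis i = k by apply: val_inj.
have s0 : cell_sign i k = e k by [].
have s1 : cell_sign i (k + 1)%R = e (k + 1)%R by [].
split=> //; apply: (ord3_ind (j := k)) => //.
by move: ev (sign_even i k); rewrite -s0 -s1; case: (cell_sign i k);
  case: (cell_sign i (k + 1)%R); case: (e _); case: (cell_sign i _).
Qed.

Lemma octa8_turn i : turn octa8_right octa8_top i != i.
Proof.
pose x := (octa8_top^-1 (octa8_right^-1 i))%g.
have -> : i = octa8_right (octa8_top x) by rewrite /x !permKV.
rewrite turnE -val_eqE /= rightE topE topE rightE; move: x.
by apply: (@all_ord 12 (fun x => top_nat (right_nat x) != right_nat (top_nat x)));
  vm_compute.
Qed.

End Combinatorics.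

Section Charts.
Variable R : realType.
Local Notation space := 'rV[R]_3.

(** The coordinates of [cube_coord] on the rhombus, which is folded along its
    diagonal [s + t = 1]: the lower triangle is in the face where the last
    coordinate is 0, the upper one in the face where the middle one is 1. *)
Definition rhombus_coord (k : 'I_3) (s t : R) (j : 'I_3) : R :=
  if j == k then 1 - s else
  if j == k + 1 then (if s + t <= 1 then s + t else 1)
  else (if s + t <= 1 then 0 else s + t - 1).

Definition rhombus_point (i : 'I_12) (s t : R) : space :=
  \row_j signed (cell_sign i j) (rhombus_coord (cell_axis i) s t j + t / 3).

Lemma succ_neq (k : 'I_3) : [/\ (k + 1 == k) = false, (k + 1 + 1 == k) = false &
  (k + 1 + 1 == k + 1) = false].
Proof. by case: k => -[|[|[|//]]]. Qed.

Lemma rhombus_coordE k s t : [/\ rhombus_coord k s t k = 1 - s,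
  rhombus_coord k s t (k + 1) = (if s + t <= 1 then s + t else 1) &
  rhombus_coord k s t (k + 1 + 1) = (if s + t <= 1 then 0 else s + t - 1)].
Proof. by have [e1 e2 e3] := succ_neq k; rewrite /rhombus_coord !eqxx e1 e2 e3. Qed.

Lemma rhombus_coord_range k s t j : in01 s -> in01 t ->
  0 <= rhombus_coord k s t j <= 1.
Proof.
rewrite /rhombus_coord /in01 => hs ht; case: eqP => _; first by lra.
by case: eqP => _; case: (leP (s + t) 1) => h; lra.
Qed.

Lemma rhombus_coord_sum k s t : \sum_j rhombus_coord k s t j = 1 + t.
Proof.
by rewrite (sum3 _ k); have [-> -> ->] := rhombus_coordE k s t; case: leP => _; ring.
Qed.

Lemma fold_rhombus i s t j : in01 s -> in01 t ->
  fold (rhombus_point i s t 0 j) = rhombus_coord (cell_axis i) s t j + t / 3.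
Proof.
move=> hs ht; rewrite mxE fold_sign //.
by have := rhombus_coord_range (cell_axis i) j hs ht; move: ht; rewrite /in01; lra.
Qed.

Lemma height_rhombus i s t : in01 s -> in01 t -> height (rhombus_point i s t) = t.
Proof.
move=> hs ht; rewrite /height (eq_bigr _ (fun j _ => fold_rhombus i j hs ht)).
by rewrite big_split /= rhombus_coord_sum sumr_const card_ord; field.
Qed.

Lemma cube_coord_rhombus i s t j : in01 s -> in01 t ->
  cube_coord (rhombus_point i s t) j = rhombus_coord (cell_axis i) s t j.
Proof.
by move=> hs ht; rewrite /cube_coord height_rhombus // fold_rhombus // addrK.
Qed.

Lemma rhombus_surface i s t : in01 s -> in01 t -> surface (rhombus_point i s t).
Proof.
move=> hs ht; split=> [j|].
  by rewrite cube_coord_rhombus //; exact: rhombus_coord_range.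
have [_ e1 e2] := rhombus_coordE (cell_axis i) s t.
case: (leP (s + t) 1) => h.
  exists (cell_axis i + 1 + 1); left.
  by rewrite cube_coord_rhombus // e2 h.
exists (cell_axis i + 1); right.
by rewrite cube_coord_rhombus // e1 leNgt h.
Qed.

Lemma surface_in_boundary (x : space) : surface x -> x \in @octa8_boundary R.
Proof. by move=> h; apply/mem_set; rewrite octa8_boundaryE. Qed.

Definition surface_pt (x : space) (h : surface x) : octa8_point R :=
  exist _ x (surface_in_boundary h).

Definition octa8_pt i s t : octa8_point R :=
  match pselect (in01 s /\ in01 t) with
  | left h => surface_pt (rhombus_surface i h.1 h.2)
  | right _ => surface_pt (rhombus_surface i (in01_0 R) (in01_0 R))
  end.

Lemma octa8_ptE i s t : in01 s -> in01 t -> val (octa8_pt i s t) = rhombus_point i s t.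
Proof. by move=> hs ht; rewrite /octa8_pt; case: pselect => // -[]. Qed.

Definition octa8_chart (i : 'I_12) (s t : R) : octa8 R :=
  \pi_(octa8_quotient R) (octa8_pt i s t).

Lemma octa8_eqP (x y : octa8_point R) :
  \pi_(octa8_quotient R) x = \pi_(octa8_quotient R) y <-> lattice (val y - val x).
Proof.
split=> [/eqquotP /asboolP //|h]; by apply/eqquotP; apply/asboolP.
Qed.

Lemma octa8_glued : glued_family octa8_right octa8_top octa8_chart.
Proof.
split=> i r hr; apply/octa8_eqP; rewrite !octa8_ptE //.
  have -> : rhombus_point (octa8_right i) 0 r - rhombus_point i 1 r = 0.
    apply/eqP; rewrite subr_eq0; apply/eqP/rowP => j; rewrite !mxE sign_right.
    rewrite axis_right; congr (signed _ (_ + _)); move: j.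
    apply: (ord3_ind (j := cell_axis i)); have [a1 a2 a3] := rhombus_coordE (cell_axis i) 1 r;
    have [b1 b2 b3] := rhombus_coordE (cell_axis i + 1) 0 r; rewrite cycle3 in b3.
    - by rewrite a1 b3; move: hr; rewrite /in01 => hr; case: (leP (0 + r) 1); lra.
    - by rewrite a2 b1; move: hr; rewrite /in01 => hr; case: (leP (1 + r) 1); lra.
    - rewrite a3 b2; move: hr; rewrite /in01 => hr.
      by case: (leP (1 + r) 1); case: (leP (0 + r) 1); lra.
  by apply/lattice_cases; left; exists (fun=> 0) => j; rewrite mxE mulr0.
apply/lattice_cases; right.
exists (fun j => - (~~ cell_sign i j : nat)%:Z) => j.
rewrite !mxE sign_top axis_top; move: j.
have [a1 a2 a3] := rhombus_coordE (cell_axis i) r 1.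
have [b1 b2 b3] := rhombus_coordE (cell_axis i + 1 + 1) r 0.
have [n1 n2 n3] := succ_neq (cell_axis i).
rewrite !cycle3 in b2 b3; move: hr; rewrite /in01 => hr.
apply: (ord3_ind (j := cell_axis i)).
- rewrite a1 b2 eq_sym n1 /=.
  by case: (cell_sign i _) => /=; case: (leP (r + 0) 1) => ?; lra.
- rewrite a2 b3 eqxx /=.
  by case: (cell_sign i _) => /=; case: (leP (r + 1) 1) => ?;
    case: (leP (r + 0) 1) => ?; lra.
- rewrite a3 b1 n3 /=.
  by case: (cell_sign i _) => /=; case: (leP (r + 1) 1) => ?; lra.
Qed.

Lemma no_int_between (n : int) : ~ (0 < (n%:~R : R) < 1).
Proof. by rewrite ltr0z ltrz1; lia. Qed.

Lemma glued_normal a b (i : 'I_12) s t : in01 s -> in01 t ->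
  exists i' s' t', [/\ 0 <= s' < 1, 0 <= t' < 1 & forall Y (f : 'I_12 -> R -> R -> Y),
    glued_family a b f -> f i s t = f i' s' t'].
Proof.
move=> hs ht.
have [j [s' [hs' es]]] : exists j s', 0 <= s' < 1 /\ forall Y (f : 'I_12 -> R -> R -> Y),
    glued_family a b f -> f i s t = f j s' t.
  have [->|sn] := eqVneq s 1.
    exists (a i), 0; split; first exact: zero_ico.
    by move=> Y f [gh _]; exact: gh.
  by exists i, s; split=> //; move: hs sn; rewrite /in01; lra.
have hs1 : in01 s' by rewrite /in01; lra.
have [tn|tn] := eqVneq t 1.
  exists (b j), s', 0; split=> //; first exact: zero_ico.
  by move=> Y f gf; rewrite (es _ _ gf) tn; exact: gf.2.
by exists j, s', t; split=> //; move: ht tn; rewrite /in01; lra.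
Qed.

(** Every point is in a cell with both coordinates less than 1. For two such
    representatives that differ by the lattice, the folded coordinates are equal
    or complementary. The second case would need heights [t] and [1 - t] and a
    point on a wall of the cube, which is impossible for [0 < t < 1]. In the first
    case the positions in the cubes are equal, and the cubes differ only if the
    point is on two of the walls, hence a vertex. *)
Lemma octa8_tiling : tiling octa8_right octa8_top octa8_chart.
Proof.
split; first exact: octa8_glued.
move=> Y f gf i s t i' s' t' hs0 ht0 hs0' ht0' e.
have [j [r [q [hs ht ef]]]] := glued_normal octa8_right octa8_top i hs0 ht0.
have [j' [r' [q' [hs' ht' ef']]]] := glued_normal octa8_right octa8_top i' hs0' ht0'.
move: e; rewrite (ef _ _ gf) (ef' _ _ gf) (ef _ _ octa8_glued) (ef' _ _ octa8_glued).
move=> {ef ef' hs0 ht0 hs0' ht0'} e.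
move: j r q hs ht j' r' q' hs' ht' e => {i s t i' s' t'}.
move=> i s t hs ht i' s' t' hs' ht' /octa8_eqP.
have [is_ it] : in01 s /\ in01 t by rewrite /in01; split; lra.
have [is' it'] : in01 s' /\ in01 t' by rewrite /in01; split; lra.
rewrite !octa8_ptE //; set v := _ - _ => lv.
have xv : rhombus_point i' s' t' = rhombus_point i s t + v by rewrite addrC subrK.
clearbody v; have zr := fun j => rhombus_coord_range (cell_axis i) j is_ it.
case/lattice_cases: lv => -[n vn].
- have [fe he] := shift_even (rhombus_point i s t) vn.
  rewrite -xv !height_rhombus // in he; subst t'.
  have ze j : rhombus_coord (cell_axis i') s' t j = rhombus_coord (cell_axis i) s t j.
    by have := fe j; rewrite -xv !fold_rhombus // => /addIr.
  have [a1 a2 a3] := rhombus_coordE (cell_axis i) s t.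
  have [b1 b2 b3] := rhombus_coordE (cell_axis i') s' t.
  have kk : cell_axis i = cell_axis i'.
    case: (ord3 (cell_axis i) (cell_axis i')) => ek //; exfalso.
    + rewrite ze ek ?cycle3 in b1; rewrite ze ek ?cycle3 in b2; rewrite ze ek ?cycle3 in b3.
      have e1 := etrans (esym a1) b3; have e2 := etrans (esym a2) b1.
      have e3 := etrans (esym a3) b2.
      by move: e1 e2 e3; case: (leP (s + t) 1) => ?; case: (leP (s' + t) 1) => ?; lra.
    + rewrite ze ek ?cycle3 in b1; rewrite ze ek ?cycle3 in b2; rewrite ze ek ?cycle3 in b3.
      have e1 := etrans (esym a1) b2; have e2 := etrans (esym a2) b3.
      have e3 := etrans (esym a3) b1.
      by move: e1 e2 e3; case: (leP (s + t) 1) => ?; case: (leP (s' + t) 1) => ?; lra.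
  have ss : s = s' by move: b1; rewrite ze -kk a1; lra.
  subst s'.
  (* Different signs force the folded coordinate to be 0. *)
  have sg j : cell_sign i j <> cell_sign i' j ->
      rhombus_coord (cell_axis i) s t j + t / 3 = 0.
    move=> ne; have := zr j; set z := rhombus_coord _ _ _ _ => hz.
    have := congr1 (fun x : space => x 0 j) xv; rewrite !mxE vn -kk -/z.
    have nn m : z + t / 3 = 4 / 3 * m%:~R -> z + t / 3 = 0.
      move=> em; have [m0|m0] := leP m 0.
        have : (m%:~R : R) <= 0 by rewrite lerz0.
        by lra.
      have : (1 : R) <= m%:~R by rewrite ler1z -gtz0_ge1.
      by lra.
    case: (cell_sign i j) ne; case: (cell_sign i' j) => //= _ h.
      by apply: (nn (n j)); lra.
    by apply: (nn (- n j)); rewrite rmorphN /=; lra.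
  have same : cell_sign i (cell_axis i) = cell_sign i' (cell_axis i).
    by apply: contrapT => /sg; rewrite a1; lra.
  have [<- //|[/sg + [x [ex ex']]]] := cell_eq_or kk same.
  rewrite a2 => h0.
  have [s0 t0] : s = 0 /\ t = 0 by move: h0; case: (leP (s + t) 1); lra.
  have [gh gv] := gf.
  by rewrite s0 t0 ex ex' -gh // -gv // gh // gv.
- have [fe he] := shift_odd (rhombus_point i s t) vn.
  rewrite -xv !height_rhombus // in he; exfalso.
  have [j ej] : exists j, cell_sign i j = cell_sign i' j.
    have [e0|/eqP n0] := eqVneq (cell_sign i 0) (cell_sign i' 0); first by exists 0.
    have [e1|/eqP n1] := eqVneq (cell_sign i (0 + 1)) (cell_sign i' (0 + 1)).
      by exists (0 + 1).
    exists (0 + 1 + 1).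
    exact: third_sign n0 n1 (sign_even i 0) (sign_even i' 0).
  have := zr j; set z := rhombus_coord _ _ _ _ => hz.
  have fj := fe j; rewrite -xv !fold_rhombus // -/z in fj.
  have := congr1 (fun x : space => x 0 j) xv; rewrite !mxE vn fj ej -/z.
  move=> h; have [m em] : exists m : int, (m%:~R : R) = (z + t / 3) * (3 / 4).
    by case: (cell_sign i' j) h => /= h; [exists (n j + 1)|exists (- n j)];
      rewrite ?intrD ?rmorphN /=; lra.
  by apply: (@no_int_between m); rewrite em; lra.
Qed.

End Charts.

Section Octa8Metric.
Variable R : realType.
Local Notation space := 'rV[R]_3.

Definition face_axis (j : 'I_3) (c : bool) : 'I_3 :=
  if c then j + 1 + 1 else j + 1.

Definition same_half (c : bool) (s t : R) := if c then 1 <= s + t else s + t <= 1.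

(** Each of the six faces of the band is half of one rhombus. *)
Lemma face_rhombus (j : 'I_3) (c : bool) (y : 'I_3 -> R) :
  let t := (\sum_i y i - 1) / 2 in
  let k := face_axis j c in let s := 1 - (y k - t / 3) in
  (forall i, 0 <= y i <= 4 / 3) -> (forall i, 0 <= y i - t / 3 <= 1) ->
  y j - t / 3 = c%:R ->
  [/\ in01 s, in01 t, same_half c s t &
    forall i, rhombus_coord k s t i + t / 3 = y i].
Proof.
move=> t k s hy hz hj.
have et : t = (y j + y (j + 1) + y (j + 1 + 1) - 1) / 2 by rewrite /t (sum3 _ j).
have [a1 a2 a3] := rhombus_coordE k s t.
have := hy j; have := hy (j + 1); have := hy (j + 1 + 1) => y2 y1 y0.
have := hz j; have := hz (j + 1); have := hz (j + 1 + 1) => z2 z1 z0.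
rewrite /in01 /same_half; case: c @k @s hj a1 a2 a3 => /= hj; rewrite ?cycle3 => a1 a2 a3.
  split; [lra|lra|lra|apply: (ord3_ind (j := j))].
  - by rewrite a2; case: (leP _ 1) => ?; lra.
  - by rewrite a3; case: (leP _ 1) => ?; lra.
  - by rewrite a1; lra.
split; [lra|lra|lra|apply: (ord3_ind (j := j))].
- by rewrite a3; case: (leP _ 1) => ?; lra.
- by rewrite a1; lra.
- by rewrite a2; case: (leP _ 1) => ?; lra.
Qed.

(** If the number of minus signs is odd, the opposite corner of the cube is
    taken as the origin: this changes all signs and exchanges each face with the
    opposite one. *)
Lemma face_cell (x x' : space) (m : 'I_3 -> int) (e : 'I_3 -> bool) j (c : bool) :
  (forall k, x 0 k = 8 / 3 * (m k)%:~R + signed (e k) (fold (x 0 k))) ->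
  (forall k, x' 0 k = 8 / 3 * (m k)%:~R + signed (e k) (fold (x' 0 k))) ->
  solid x -> solid x' -> cube_coord x j = c%:R -> cube_coord x' j = c%:R ->
  exists i v c', lattice v /\ forall z, z = x \/ z = x' -> exists s t,
    [/\ in01 s, in01 t, same_half c' s t & z = rhombus_point i s t + v].
Proof.
move=> xE xE' sx sx' cx cx'.
have par : (e j (+) e (j + 1) (+) e (j + 1 + 1) = false) \/
    (~~ e j (+) ~~ e (j + 1) (+) ~~ e (j + 1 + 1) = false).
  by case: (e j); case: (e _); case: (e _); [right|left|left|right|left|right|right|left].
have all_par (e' : 'I_3 -> bool) k : e' j (+) e' (j + 1) (+) e' (j + 1 + 1) = false ->
    e' k (+) e' (k + 1) (+) e' (k + 1 + 1) = false.
  case: (ord3 j k) => -> //; rewrite ?cycle3 => <-.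
    by rewrite addbC addbA.
  by rewrite addbC addbA addbC addbA.
case: par => par.
  have [i [ai si]] := cell_exists (all_par e (face_axis j c) par).
  exists i, (\row_k (8 / 3 * (m k)%:~R)), c; split.
    by apply/lattice_cases; left; exists m => k; rewrite mxE.
  move=> z hz; have [zE [sz cz]] : (forall k, z 0 k =
      8 / 3 * (m k)%:~R + signed (e k) (fold (z 0 k))) /\
      solid z /\ cube_coord z j = c%:R by case: hz => ->.
  have [s01 t01 sh yE] := face_rhombus (fun k => fold_range (z 0 k)) sz cz.
  exists (1 - (fold (z 0 (face_axis j c)) - (\sum_i fold (z 0 i) - 1) / 2 / 3)),
    ((\sum_i fold (z 0 i) - 1) / 2); split=> //.
  by apply/rowP => k; rewrite !mxE ai si yE addrC -zE.
have [i [ai si]] := cell_exists (all_par (fun k => ~~ e k) (face_axis j (~~ c)) par).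
exists i, (\row_k (8 / 3 * (m k)%:~R + signed (e k) (4 / 3))), (~~ c); split.
  apply/lattice_cases; right; exists (fun k => m k - (e k : nat)%:Z) => k.
  by rewrite mxE; case: (e k); rewrite /= ?subr0 ?intrB; field.
move=> z hz; have [zE [sz cz]] : (forall k, z 0 k =
    8 / 3 * (m k)%:~R + signed (e k) (fold (z 0 k))) /\
    solid z /\ cube_coord z j = c%:R by case: hz => ->.
pose y k := 4 / 3 - fold (z 0 k).
have ty : (\sum_i y i - 1) / 2 = 1 - height z.
  by rewrite /height !(sum3 _ j) /y; field.
have hy k : 0 <= y k <= 4 / 3 by have := fold_range (z 0 k); rewrite /y; lra.
have hz' k : 0 <= y k - (\sum_i y i - 1) / 2 / 3 <= 1.
  by have := sz k; rewrite ty /y /cube_coord; lra.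
have hj : y j - (\sum_i y i - 1) / 2 / 3 = (~~ c)%:R.
  by move: cz; rewrite ty /y /cube_coord; case: (c) => /=; lra.
have [s01 t01 sh yE] := face_rhombus hy hz' hj.
exists (1 - (y (face_axis j (~~ c)) - (\sum_i y i - 1) / 2 / 3)),
  ((\sum_i y i - 1) / 2); split=> //.
apply/rowP => k; rewrite zE !mxE ai si yE /y signedN.
by case: (e k) => /=; ring.
Qed.

Lemma chart_lattice (x : octa8_point R) i s t v : in01 s -> in01 t -> lattice v ->
  val x = rhombus_point i s t + v -> \pi_(octa8_quotient R) x = octa8_chart i s t.
Proof.
move=> hs ht lv ex; apply/esym/octa8_eqP.
by rewrite octa8_ptE // ex addrC addKr.
Qed.

Lemma boundary_surface (z : space) : octa8_boundary z <-> surface z.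
Proof. by rewrite octa8_boundaryE. Qed.

Lemma surface_val (x : octa8_point R) : surface (val x).
Proof.
by apply/boundary_surface; exact: set_mem (valP x).
Qed.

Lemma octa8_covered (x : octa8 R) : covered (@octa8_chart R) x.
Proof.
have [sx [j hj]] := surface_val (repr x).
have [m hm] := choice (fun k => fold_repr (val (repr x) 0 k)).
have [e xE] := choice hm.
have [c hc] : exists c : bool, cube_coord (val (repr x)) j = c%:R.
  by case: hj => ->; [exists false|exists true].
have [i [v [c' [lv /(_ _ (or_introl erefl))[s [t [hs ht _ ex]]]]]]] :=
  face_cell xE xE sx sx hc hc.
exists i, s, t; split=> //.
by rewrite -[x]reprK; exact: chart_lattice lv ex.
Qed.

Lemma rhombus_dist i c s t s' t' : same_half c s t -> same_half c s' t' ->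
  dot (rhombus_point i s t - rhombus_point i s' t')
    (rhombus_point i s t - rhombus_point i s' t') =
  2 * ((s' - s) ^+ 2 + 1 * ((s' - s) * (t' - t)) + (t' - t) ^+ 2).
Proof.
move=> h h'; pose k := cell_axis i.
have [a1 a2 a3] := rhombus_coordE k s t; have [b1 b2 b3] := rhombus_coordE k s' t'.
have sq (e : bool) (a b : R) : (signed e a - signed e b) * (signed e a - signed e b) =
  (a - b) ^+ 2 by case: e => /=; ring.
rewrite /dot (sum3 _ k) !mxE !sq -/k a1 a2 a3 b1 b2 b3.
case: c h h'; rewrite /same_half => h h'; last by rewrite h h'; field.
case: (leP (s + t) 1) => ?; case: (leP (s' + t') 1) => ?.
- have [-> ->] : t = 1 - s /\ t' = 1 - s' by split; lra.
  by field.
- have -> : t = 1 - s by lra.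
  by field.
- have -> : t' = 1 - s' by lra.
  by field.
- by field.
Qed.

Lemma rhombus_convex i c s t s' t' (k : R) : same_half c s t -> same_half c s' t' ->
  0 <= k <= 1 -> (1 - k) *: rhombus_point i s t + k *: rhombus_point i s' t' =
  rhombus_point i ((1 - k) * s + k * s') ((1 - k) * t + k * t').
Proof.
move=> h h' hk; pose S := (1 - k) * s + k * s'; pose T := (1 - k) * t + k * t'.
have h2 : same_half c S T.
  have eST : S + T = (1 - k) * (s + t) + k * (s' + t') by rewrite /S /T; ring.
  have k0 : 0 <= k by lra.
  have k1 : 0 <= 1 - k by lra.
  move: h h'; rewrite /same_half eST; case: (c) => h h'.
    have := ler_wpM2l k0 h'; have := ler_wpM2l k1 h; lra.
  have := ler_wpM2l k0 h'; have := ler_wpM2l k1 h; lra.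
apply/rowP => j; rewrite !mxE -/S -/T.
have sg (e : bool) (x y : R) : (1 - k) * signed e x + k * signed e y =
    signed e ((1 - k) * x + k * y) by case: e => /=; ring.
rewrite sg; congr signed; move: j.
apply: (ord3_ind (j := cell_axis i)).
- have [-> _ _] := rhombus_coordE (cell_axis i) s t.
  have [-> _ _] := rhombus_coordE (cell_axis i) s' t'.
  have [-> _ _] := rhombus_coordE (cell_axis i) S T.
  by rewrite /S /T; field.
- have [_ -> _] := rhombus_coordE (cell_axis i) s t.
  have [_ -> _] := rhombus_coordE (cell_axis i) s' t'.
  have [_ -> _] := rhombus_coordE (cell_axis i) S T.
  have val c0 x y : same_half c0 x y ->
      (if x + y <= 1 then x + y else 1) = if c0 then 1 else x + y.
    by rewrite /same_half; case: c0; case: (leP (x + y) 1) => // *; lra.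
  by rewrite (val _ _ _ h) (val _ _ _ h') (val _ _ _ h2) /S /T; case: (c); field.
- have [_ _ ->] := rhombus_coordE (cell_axis i) s t.
  have [_ _ ->] := rhombus_coordE (cell_axis i) s' t'.
  have [_ _ ->] := rhombus_coordE (cell_axis i) S T.
  have val c0 x y : same_half c0 x y ->
      (if x + y <= 1 then 0 else x + y - 1) = if c0 then x + y - 1 else 0.
    by rewrite /same_half; case: c0; case: (leP (x + y) 1) => // *; lra.
  by rewrite (val _ _ _ h) (val _ _ _ h') (val _ _ _ h2) /S /T; case: (c); field.
Qed.

Lemma half_near i c s t s' t' : in01 s -> in01 t -> in01 s' -> in01 t' ->
  same_half c s t -> same_half c s' t' ->
  near_line (octa8_chart i s t) (octa8_chart i s' t')
    (quad_norm 2 1 (s' - s) (t' - t)).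
Proof.
move=> hs ht hs' ht' h h'; exists (0 + quad_norm 2 1 (s' - s) (t' - t)).
  by rewrite add0r.
apply: BrokenLineStep; first exact: BrokenLineNil.
exists (octa8_pt i s t), (octa8_pt i s' t'); rewrite !octa8_ptE //; split=> //.
  move=> k hk; rewrite octa8_boundaryE (rhombus_convex i h h' hk).
  have k0 : 0 <= k by lra.
  have k1 : 0 <= 1 - k by lra.
  have mid x y : in01 x -> in01 y -> in01 ((1 - k) * x + k * y).
    move=> /andP[x0 x1] /andP[y0 y1]; rewrite /in01 addr_ge0 ?mulr_ge0 //=.
    have := ler_wpM2l k0 y1; have := ler_wpM2l k1 x1; lra.
  by apply: rhombus_surface; exact: mid.
by rewrite (rhombus_dist i h h').
Qed.

Let quad2 : strict_norm (quad_norm (2 : R) 1).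
Proof. by apply: quad_norm_strict; rewrite ?normr1 ?ltr1n. Qed.

Lemma octa8_near (x y : octa8 R) u v : move (@octa8_chart R) x u v y ->
  near_line x y (quad_norm 2 1 u v).
Proof.
move=> [i [s [t [[hs ht hsu htv] [-> ->]]]]].
have near c s1 t1 s2 t2 := @half_near i c s1 t1 s2 t2.
have total (a : R) : exists c : bool, if c then 1 <= a else a <= 1.
  by case: (leP a 1) => h; [exists false|exists true => //; exact: ltW].
have [c h] := total (s + t).
have [h'|[h' h2]] : same_half c (s + u) (t + v) \/
    same_half (~~ c) (s + u) (t + v) /\ u + v != 0.
- have uv : u + v = (s + u + (t + v)) - (s + t) by ring.
  rewrite /same_half; case: c h => /= h; case: (lerP 1 (s + u + (t + v))) => h1.
  + by left.
  + right; split; first exact: ltW.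
    by rewrite uv; apply/eqP; lra.
  + have [e1|e1] := eqVneq (s + u + (t + v)) 1; first by left; lra.
    right; split=> //; rewrite uv; apply/eqP => e2.
    have : 1 < s + u + (t + v) by rewrite lt_neqAle eq_sym e1.
    lra.
  + by left; exact: ltW.
- by have := near c s t (s + u) (t + v) hs ht hsu htv h h'; rewrite !(addrC _ u) ?(addrC _ v) !addrK.
(* The segment is cut where it crosses the fold. *)
pose k := (1 - (s + t)) / (u + v).
have hk : 0 <= k <= 1.
  move: h h' h2; rewrite /same_half /k.
  have [p|p|->] := ltrgtP (u + v) 0; last by [].  
    by rewrite ler_ndivlMr // ler_ndivrMr // mul0r mul1r; case: (c) => /=; lra.
  by rewrite ler_pdivlMr // ler_pdivrMr // mul0r mul1r; case: (c) => /=; lra.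
have ek : s + k * u + (t + k * v) = 1.
  by rewrite /k addrACA -mulrDr divfK // addrC subrK.
clearbody k; have k0 : 0 <= k by lra.
have k1 : 0 <= 1 - k by lra.
have mid (r w : R) : in01 r -> in01 (r + w) -> in01 (r + k * w).
  move=> /andP[x0 x1] /andP[y0 y1].
  have -> : r + k * w = (1 - k) * r + k * (r + w) by ring.
  rewrite /in01 addr_ge0 ?mulr_ge0 //=.
  have := ler_wpM2l k0 y1; have := ler_wpM2l k1 x1; lra.
have hm c0 : same_half c0 (s + k * u) (t + k * v) by rewrite /same_half ek lexx; case: c0.
have hs' := mid s u hs hsu; have ht' := mid t v ht htv.
have n1 := near c _ _ _ _ hs ht hs' ht' h (hm c).
have n2 := near (~~ c) _ _ _ _ hs' ht' hsu htv (hm _) h'.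
have := near_cat n1 n2.
have -> : s + k * u - s = k * u by ring.
have -> : t + k * v - t = k * v by ring.
have -> : s + u - (s + k * u) = (1 - k) * u by ring.
have -> : t + v - (t + k * v) = (1 - k) * v by ring.
by rewrite !(nrm_hom quad2) // -mulrDl (addrC k) subrK mul1r.
Qed.

Lemma foldN (r : R) : fold (- r) = fold r.
Proof.
have [m [e er]] := fold_repr r.
rewrite -[RHS](fold_signed (- m) (~~ e) (fold_range r)); congr fold.
by rewrite {1}er signedN rmorphN /=; ring.
Qed.

(** Moving along a line, a coordinate stays for a while in one interval on
    which [fold] is affine. *)
Lemma fold_right (a b t : R) : exists d (m : int) (e : bool), 0 < d /\
  forall r, t <= r <= t + d -> a + r * b = 8 / 3 * m%:~R + signed e (fold (a + r * b)).
Proof.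
wlog b0 : a b / 0 <= b.
  move=> W; case: (leP 0 b) => b0; first exact: W.
  have [|d [m [e [d0 h]]]] := W (- a) (- b); first by rewrite oppr_ge0 ltW.
  exists d, (- m), (~~ e); split=> // r /h.
  have -> : - a + r * - b = - (a + r * b) by ring.
  by rewrite foldN signedN rmorphN /=; lra.
have [r0 er0] : exists r0, r0 = a + t * b by eexists.
have := floor_itv (r0 * (3 / 4)); move: (Num.floor _) => n.
rewrite intrD mulr1z => hn; have b1 : 0 < b + 1 by lra.
pose d := (4 / 3 * (n%:~R + 1) - r0) / (b + 1).
have d0 : 0 < d by rewrite divr_gt0 //; lra.
have db : d * b <= 4 / 3 * (n%:~R + 1) - r0.
  have <- : d * (b + 1) = 4 / 3 * (n%:~R + 1) - r0 by rewrite divfK // gt_eqF.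
  by rewrite ler_pM2l //; lra.
have range r : t <= r <= t + d -> 4 / 3 * n%:~R <= a + r * b <= 4 / 3 * (n%:~R + 1).
  move=> hr; have -> : a + r * b = r0 + (r - t) * b by rewrite er0; ring.
  have : 0 <= (r - t) * b by rewrite mulr_ge0 //; lra.
  have : (r - t) * b <= d * b by rewrite ler_wpM2r //; lra.
  lra.
have [m [c en]] := int_parity n.
have enR : n%:~R = (c : nat)%:R + 2 * m%:~R :> R by rewrite en intrD intrM /= natz.
exists d, (m + (c : nat)%:Z), c; split=> // r /range; rewrite enR => hr.
have eqr : a + r * b = 8 / 3 * (m + (c : nat)%:Z)%:~R +
    signed c (signed c (a + r * b - 8 / 3 * (m + (c : nat)%:Z)%:~R)).
  by case: (c) => /=; ring.
rewrite {1}eqr; congr (_ + signed _ _); rewrite [in RHS]eqr fold_signed //.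
by move: hr; rewrite intrD; case: (c) => /=; lra.
Qed.

(** A segment contained in the surface may pass through many faces, but just
    after any of its points it stays in one of them. *)
Lemma line_face (p b : space) (t : R) : exists2 d : R, 0 < d & forall r,
  t < r < t + d -> (forall r', t <= r' <= r -> surface (p + r' *: b)) ->
  exists m e j (c : bool), [/\
    forall k, (p + t *: b) 0 k = 8 / 3 * (m k : int)%:~R +
      signed (e k) (fold ((p + t *: b) 0 k)),
    forall k, (p + r *: b) 0 k = 8 / 3 * (m k)%:~R +
      signed (e k) (fold ((p + r *: b) 0 k)),
    cube_coord (p + t *: b) j = c%:R & cube_coord (p + r *: b) j = c%:R].
Proof.
have coordE r k : (p + r *: b) 0 k = p 0 k + r * b 0 k by rewrite !mxE.
have [d hd] := choice (fun k => fold_right (p 0 k) (b 0 k) t).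
have [m hm] := choice hd; have [e he] := choice hm.
exists (\big[Num.min/1]_k d k).
  by apply: lt_bigmin => // k _; case: (he k).
move=> r hr sur.
have rd k : r <= t + d k.
  have : \big[Num.min/1]_k d k <= d k by exact: bigmin_le_cond.
  lra.
have xE r' k : t <= r' <= r -> (p + r' *: b) 0 k =
    8 / 3 * (m k)%:~R + signed (e k) (fold ((p + r' *: b) 0 k)).
  move=> hr'; rewrite coordE; apply: (he k).2; have := rd k; lra.
pose ya k := signed (e k) (p 0 k - 8 / 3 * (m k)%:~R).
pose yb k := signed (e k) (b 0 k).
have fE r' k : t <= r' <= r -> fold ((p + r' *: b) 0 k) = ya k + r' * yb k.
  move=> hr'; have := xE r' k hr'; rewrite {1}coordE /ya /yb.
  by case: (e k) => /=; lra.
pose za k := ya k - (ya k + ya (k + 1) + ya (k + 1 + 1) - 1) / 6.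
pose zb k := yb k - (yb k + yb (k + 1) + yb (k + 1 + 1)) / 6.
have cE r' k : t <= r' <= r -> cube_coord (p + r' *: b) k = za k + r' * zb k.
  by move=> hr'; rewrite cubeE !fE // /za /zb; field.
(* Seven points of the segment are on the six faces: two of them are on the
   same face, hence so is the whole segment. *)
pose pt (q : 'I_7) := t + (r - t) * (q%:R / 6).
have hpt q : t <= pt q <= r.
  have q6 : (q%:R : R) <= 6 by rewrite ler_nat -ltnS.
  have q0 : 0 <= (q%:R : R) by [].
  have : 0 <= (r - t) * (q%:R / 6) by rewrite mulr_ge0 ?divr_ge0 //; lra.
  have : (r - t) * (q%:R / 6) <= (r - t) * 1.
    by rewrite ler_wpM2l //; [lra|rewrite ler_pdivrMr // mul1r].
  by rewrite /pt; lra.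
have faces q : exists jc : 'I_3 * bool, cube_coord (p + pt q *: b) jc.1 = jc.2%:R.
  have /sur[_ [j [h|h]]] := hpt q; first by exists (j, false).
  by exists (j, true).
have [f hf] := choice faces.
have [q [q' [qq' ff]]] : exists q q', q != q' /\ f q = f q'.
  apply: contrapT => no; have : (#|'I_7| <= #|{: 'I_3 * bool}|)%N.
    apply: (@leq_card _ _ f) => q q' e'; apply: contrapT => /eqP ne.
    by apply: no; exists q, q'.
  by rewrite card_prod !card_ord card_bool.
have hq := hf q; have hq' := hf q'; rewrite -ff in hq'.
move: (f q) hq hq' => [j c] /= hq hq'; exists m, e, j, c.
have b0 : zb j = 0.
  rewrite cE // in hq; rewrite cE // in hq'.
  have : (pt q - pt q') * zb j = 0 by lra.
  move=> /eqP; rewrite mulf_eq0 => /orP[|/eqP //].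
  rewrite /pt opprD addrACA subrr add0r -mulrBr -mulrBl !mulf_eq0 invr_eq0.
  rewrite pnatr_eq0 orbF !subr_eq0 eqr_nat => /orP[/eqP|/eqP/val_inj/eqP].
    by move=> er; move: hr; rewrite er ltxx.
  by rewrite (negPf qq').
have ht : t <= t <= r by lra.
have hr1 : t <= r <= r by lra.
split.
- by move=> k; exact: xE.
- by move=> k; exact: xE.
- by rewrite cE // -hq cE // b0 !mulr0.
- by rewrite cE // -hq cE // b0 !mulr0.
Qed.

Lemma face_move (x x' : octa8_point R) m e j (c : bool) :
  (forall k, val x 0 k = 8 / 3 * (m k : int)%:~R + signed (e k) (fold (val x 0 k))) ->
  (forall k, val x' 0 k = 8 / 3 * (m k)%:~R + signed (e k) (fold (val x' 0 k))) ->
  cube_coord (val x) j = c%:R -> cube_coord (val x') j = c%:R ->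
  exists u v, move (@octa8_chart R) (\pi_(octa8_quotient R) x) u v
      (\pi_(octa8_quotient R) x') /\
    quad_norm 2 1 u v = Num.sqrt (dot (val x - val x') (val x - val x')).
Proof.
move=> xE xE' cx cx'.
have sol (y : octa8_point R) : solid (val y).
  by have [] := surface_val y.
have [i [v [c' [lv h]]]] := face_cell xE xE' (sol x) (sol x') cx cx'.
have [s [t [hs ht h1 ex]]] := h _ (or_introl erefl).
have [s' [t' [hs' ht' h1' ex']]] := h _ (or_intror erefl).
exists (s' - s), (t' - t); split.
  rewrite (chart_lattice hs ht lv ex) (chart_lattice hs' ht' lv ex').
  by exists i, s, t; rewrite !(addrC _ (_ - _)) !subrK.
rewrite ex ex' opprD addrACA subrr addr0 (rhombus_dist i h1 h1').
by [].
Qed.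

Lemma mirror_range (s t d : R) : s < t -> `|s - t| < d -> t < 2 * t - s < t + d.
Proof. by move=> st; rewrite ltr0_norm; lra. Qed.

Lemma mirror_in01 (s t r : R) : 0 <= s <= 1 -> 0 <= t <= 1 ->
  t <= r <= 2 * t - s -> 0 <= 2 * t - r <= 1.
Proof. by move=> *; lra. Qed.

(** The pieces given by [line_face] on both sides of each point are put together
    by [interval_chain]. *)
Lemma octa8_cell (x y : octa8 R) l : segment x y l ->
  exists2 l', l' <= l & cell_line (quad_norm 2 1) (@octa8_chart R) x y l'.
Proof.
move=> [p [q [-> -> hpq ->]]]; set l0 := Num.sqrt _.
pose X (r : R) := val p + r *: (val q - val p).
have XE r : X r = (1 - r) *: val p + r *: val q.
  by apply/rowP => k; rewrite !mxE; ring.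
have sX r : 0 <= r <= 1 -> surface (X r).
  by move=> /hpq /boundary_surface; rewrite -XE.
pose P s t := forall (hs : surface (X s)) (ht : surface (X t)),
  cell_line (quad_norm 2 1) (@octa8_chart R)
    (\pi_(octa8_quotient R) (surface_pt hs))
    (\pi_(octa8_quotient R) (surface_pt ht)) ((t - s) * l0).
have eqpt (u w : octa8_point R) : val u = val w -> u = w by exact: val_inj.
have dist s t : s <= t -> Num.sqrt (dot (X s - X t) (X s - X t)) = (t - s) * l0.
  move=> st; have -> : X s - X t = (t - s) *: (val p - val q).
    apply/rowP => k; rewrite !mxE; ring.
  have -> : dot ((t - s) *: (val p - val q)) ((t - s) *: (val p - val q)) =
      (t - s) ^+ 2 * dot (val p - val q) (val p - val q).
    by rewrite /dot mulr_sumr; apply: eq_bigr => k _; rewrite !mxE; ring.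
  by rewrite sqrtrM ?sqr_ge0 // sqrtr_sqr ger0_norm // subr_ge0.
have P01 : P 0 1.
  apply: interval_chain => //.
  - move=> r _ hs ht; rewrite subrr mul0r.
    by rewrite (eqpt (surface_pt hs) (surface_pt ht)) //; exact: BrokenLineNil.
  - move=> a b c a0 ab bc c1 Pab Pbc ha hc; have hb : surface (X b) by apply: sX; lra.
    have -> : (c - a) * l0 = (b - a) * l0 + (c - b) * l0 by ring.
    exact: (@broken_cat _ (cell_surface _ _) _ _ _ _ _ (Pab ha hb) (Pbc hb hc)).
  - move=> t ht; have [d d0 hd] := line_face (val p) (val q - val p) t.
    have [d' d0' hd'] := line_face (val p + (2 * t) *: (val q - val p))
      (- (val q - val p)) t.
    have back r : val p + (2 * t) *: (val q - val p) + r *: - (val q - val p) =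
        X (2 * t - r).
      by rewrite /X scalerBl scalerN addrA.
    exists (Num.min d d'); first by rewrite lt_min d0.
    move=> s hs; rewrite lt_min => /andP[sd sd'].
    split=> st hs1 ht1.
      have [est|nst] := eqVneq s t.
        move: hs1; rewrite est => hs1; rewrite subrr mul0r.
        by rewrite (eqpt (surface_pt hs1) (surface_pt ht1)) //; exact: BrokenLineNil.
      have lst : s < t by rewrite lt_neqAle nst.
      have [||m [e [j [c [e1 e2 c1 c2]]]]] := hd' (2 * t - s).
      + exact: mirror_range lst sd'.
      + by move=> r' hr'; rewrite back; apply/sX/(mirror_in01 hs ht hr').
      have ett : 2 * t - t = t by ring.
      have ess : 2 * t - (2 * t - s) = s by ring.
      rewrite back ess in e2 c2; rewrite back ett in e1 c1.
      have [u [v [mv nv]]] := @face_move (surface_pt hs1) (surface_pt ht1) m e j c e2 e1 c2 c1.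
      rewrite -[(t - s) * l0]add0r; apply: BrokenLineStep; first exact: BrokenLineNil.
      by exists u, v; split=> //; rewrite nv /= dist.
    have [est|nst] := eqVneq s t.
      move: ht1; rewrite est => ht1; rewrite subrr mul0r.
      by rewrite (eqpt (surface_pt hs1) (surface_pt ht1)) //; exact: BrokenLineNil.
    have lst : t < s by rewrite lt_neqAle eq_sym nst.
    have [||m [e [j [c [e1 e2 c1 c2]]]]] := hd s.
    + by move: sd; rewrite gtr0_norm; lra.
    + by move=> r' hr'; apply: sX; lra.
    have [u [v [mv nv]]] := @face_move (surface_pt hs1) (surface_pt ht1) m e j c e1 e2 c1 c2.
    rewrite -[(s - t) * l0]add0r; apply: BrokenLineStep; first exact: BrokenLineNil.
    by exists u, v; split=> //; rewrite nv /= dist.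
have s0 : surface (X 0) by apply: sX; lra.
have s1 : surface (X 1) by apply: sX; lra.
exists ((1 - 0) * l0); first by rewrite subr0 mul1r.
have -> : p = surface_pt s0 by apply: val_inj; rewrite /= /X scale0r addr0.
have -> : q = surface_pt s1 by apply: val_inj; rewrite /= /X scale1r addrC subrK.
exact: P01.
Qed.

Lemma rhombus_vertex i :
  rhombus_point i 0 0 = octahedron_vertex R (cell_axis i, cell_sign i (cell_axis i)).
Proof.
have [n1 n2 n3] := succ_neq (cell_axis i).
have [a1 a2 a3] := rhombus_coordE (cell_axis i) (0 : R) 0.
apply/rowP; apply: (ord3_ind (j := cell_axis i)); rewrite !mxE ?n1 ?n2 ?eqxx /=.
- by rewrite a1 subr0 mul0r addr0 signE.
- rewrite a2 addr0 ler01 mul0r addr0 mulr0.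
  by case: (cell_sign i _); rewrite /= ?oppr0.
- rewrite a3 addr0 ler01 mul0r addr0 mulr0.
  by case: (cell_sign i _); rewrite /= ?oppr0.
Qed.

Lemma octa8_regular (x : octa8 R) : ~ singular x -> regular (@octa8_chart R) x.
Proof.
move=> ns i j ex _; exfalso; apply: ns; exists (octa8_pt i 0 0); first by rewrite -ex.
rewrite octa8_ptE // rhombus_vertex.
exists (fun u => 0 + u); last by eexists; [eexists|rewrite add0r].
exists 0; last by left.
by exists (fun=> 0); rewrite big1 // => s _; rewrite scale0r.
Qed.

(** Reflecting a vertex of the octahedron in a face fixes it or translates it by
    a lattice vector. *)
Lemma octa8_singular (x : octa8 R) : singular x -> exists i,
  x = octa8_chart i 0 0 /\ turn octa8_right octa8_top i != i.
Proof.
move=> [p -> [f [v lv fE] [_ [[k b] _ <-] ep]]].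
pose e (j : 'I_3) := (j != k + 1 + 1) && b.
have [n1 n2 n3] := succ_neq k.
have [|i [ai si]] := @cell_exists k e.
  by rewrite /e eqxx (eq_sym k) n2 (eq_sym (k + 1)) n3 /= addbb.
exists i; split; last exact: octa8_turn.
have vert : rhombus_point i 0 0 = octahedron_vertex R (k, b).
  by rewrite rhombus_vertex ai si /e eq_sym n2.
have [w lw ew] : exists2 w, lattice w & val p = rhombus_point i 0 0 + w.
  case: fE => [fE|[s fE]]; rewrite -ep fE vert; first by exists v; rewrite // addrC.
  have se : signed (s k) ((octahedron_vertex R (k, b)) 0 k) = (-1) ^+ (s k (+) b).
    by rewrite !mxE !eqxx /= mulr1; case: (s k); case: b {e si vert ep};
      rewrite /= ?expr0 ?expr1 ?opprK.
  have dt : dot (sign_vector R s) (octahedron_vertex R (k, b)) = (-1) ^+ (s k (+) b).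
    rewrite -se /dot (bigD1 k) //= big1 ?addr0; first by rewrite [sign_vector R s _ _]mxE signE.
    by move=> j /negPf jk; rewrite !mxE jk andbF !mulr0.
  rewrite /face_reflection dt dot_sign_vector; case: (s k (+) b).
    exists (v + (4 / 3) *: sign_vector R s).
      by apply: latticeD => //; exact: lattice_sign_vector.
    rewrite expr1 addrCA; congr (_ + (_ + _)); rewrite -scaleNr; congr (_ *: _).
    by field.
  by exists v => //; rewrite expr0 subrr mulr0 mul0r scale0r subr0 addrC.
exact: chart_lattice lw ew.
Qed.

Theorem octa8_no_closed_saddle_connection (L : R) (g : R -> octa8 R) :
  ~ closed_saddle_connection L g.
Proof.
apply: (@no_closed_saddle_connection _ _ _ _ _ (quad_norm 2 1) (@octa8_chart R)) L g.
- exact: quad2.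
- exact: octa8_tiling.
- exact: octa8_covered.
- exact: octa8_cell.
- exact: octa8_near.
- exact: octa8_regular.
- exact: octa8_singular.
- exact: octa8_no_closed_orbit.
Qed.

End Octa8Metric.

(** * The six surfaces *)

Theorem theorem1p4 (R : realType) :
  (forall (L : R) (g : R -> mucube R), ~ closed_saddle_connection L g) /\
  (forall (L : R) (g : R -> muoctahedron R), ~ closed_saddle_connection L g) /\
  (forall (L : R) (g : R -> mutetrahedron R), ~ closed_saddle_connection L g) /\
  (forall (L : R) (g : R -> octa4 R), ~ closed_saddle_connection L g) /\
  (forall (L : R) (g : R -> octa8 R), ~ closed_saddle_connection L g) /\
  (forall (L : R) (g : R -> truncated_octa8 R),
     ~ closed_saddle_connection L g).
Proof.
split; first exact: square_no_closed_saddle_connection mucube_no_closed_orbit.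
split; first exact: square_no_closed_saddle_connection muoctahedron_no_closed_orbit.
split; first exact: square_no_closed_saddle_connection mutetrahedron_no_closed_orbit.
split; first exact: square_no_closed_saddle_connection octa4_no_closed_orbit.
split; first exact: octa8_no_closed_saddle_connection.
exact: square_no_closed_saddle_connection truncated_octa8_no_closed_orbit.
Qed.
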